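(* Let $N\ge2$, $\mathsf{A}=(A_1,\ldots,A_N)\in GL_2(\mathbb{R})^N$ be irreducible, $s>0$, and let $\mu$ be an equilibrium state for $\Phi^s$. Then the following three statements are equivalent: (1) $\mu$ is a Gibbs measure for some H\''older continuous potential; (2) $\{A_1,\dots,A_N\}$ has a strongly invariant multicone or is strongly conformal; (3) there exist a constant $C>0$ and a H\''older continuous potential $f:\Sigma\to\mathbb{R}$ such that $\bigl|\sum_{k=0}^{n-1}f(\sigma^k\mathtt{i})-\log\|A_{\mathtt{i}|_n}\|\bigr|\le C$ for all $\mathtt{i}\in\Sigma$ and $n\in\mathbb{N}$.
   Context: $\|\cdot\|$ is the operator norm. $\Sigma=\{1,\ldots,N\}^{\mathbb{N}}$ with left shift $\sigma$; $\Sigma_n$ the words of length $n$, $\mathtt{i}|_n$ the first $n$ symbols, $[\mathtt{i}]$ the cylinder of a finite word, $\mathtt{i}\wedge\mathtt{j}$ the longest common prefix, $A_{i_1\cdots i_n}=A_{i_1}\cdots A_{i_n}$. $\Phi^s=(\phi_n^s)$ with $\phi^s_n(\mathtt{i})=\log\|A_{\mathtt{i}|_n}\|^s$; for any sequence $\Phi=(\phi_n)$ the pressure is $P(\Phi)=\lim_n\frac1n\log\sum_{\mathtt{i}\in\Sigma_n}\exp\max_{\mathtt{j}\in[\mathtt{i}]}\phi_n(\mathtt{j})$; an equilibrium state for $\Phi^s$ is a $\sigma$-invariant probability measure $\mu$ with $P(\Phi^s)=h_\mu+\lim_n\frac1n\int\phi^s_n d\mu$. A potential $\phi:\Sigma\to\mathbb{R}$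 is H\''older continuous if $|\phi(\mathtt{i})-\phi(\mathtt{j})|\le C\tau^{|\mathtt{i}\wedge\mathtt{j}|}$ for some $C>0$, $0<\tau<1$. A Borel probability measure $\mu$ is a Gibbs measure for $\phi$ if there is $C\ge1$ with $C^{-1}\exp(-nP+\sum_{k=0}^{n-1}\phi(\sigma^k\mathtt{j}))\le\mu([\mathtt{i}])\le C\exp(-nP+\sum_{k=0}^{n-1}\phi(\sigma^k\mathtt{j}))$ for all $\mathtt{i}\in\Sigma_n$, $\mathtt{j}\in[\mathtt{i}]$, $n\in\mathbb{N}$, where $P$ is the pressure of $(\sum_{k=0}^{n-1}\phi\circ\sigma^k)_n$. $\mathsf{A}$ is irreducible if no 1-dimensional subspace is invariant under all $A_i$. A set of matrices is strongly conformal if there is a single invertible $M$ with $|\det A|^{-1/2}MAM^{-1}\in O(2)$ for all $A$ in the set. A multicone is a proper subset of $\mathbb{RP}^1$ that is a finite union of closed projective intervals; it is strongly invariant for a set $\mathsf{B}$ if $A\mathcal{C}\subset\mathcal{C}^o$ for all $A\in\mathsf{B}$. *)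

(* Defs.v *)
From HB Require Import structures.
From mathcomp Require Import all_boot all_order all_algebra.
From mathcomp Require Import all_classical all_reals all_analysis.
Unset Printing Implicit Defensive.
Import Order.TTheory GRing.Theory Num.Theory.
Import numFieldNormedType.Exports.
Local Open Scope classical_set_scope.
Local Open Scope ring_scope.

(* Alphabet {1,...,N} with N = n.+2 >= 2 (encoded as 'I_n.+2). *)
Notation Alph n := 'I_n.+2.
Definition Seq (n : nat) := nat -> Alph n.
HB.instance Definition _ n := Choice.on (Seq n).
HB.instance Definition _ n := isPointed.Build (Seq n) (fun _ => ord0).

Definition shift {n : nat} (x : Seq n) : Seq n := fun m => x m.+1.

Definition word (n k : nat) := {ffun 'I_k -> Alph n}.

Definition trunc {n : nat} (x : Seq n) (k : nat) : word n k := [ffun j : 'I_k => x j].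

Definition cyl {n k : nat} (w : word n k) : set (Seq n) :=
  [set x | forall j : 'I_k, x j = w j].

Definition cylinders (n : nat) : set (set (Seq n)) :=
  [set C | exists k (w : word n k), C = cyl w].

(* Sigma with the sigma-algebra generated by cylinders (= Borel sigma-algebra) *)
Notation SigmaM n := (g_sigma_algebraType (cylinders n)).

Definition enorm {R : realType} (v : 'cV[R]_2) : R :=
  Num.sqrt (v 0 0 ^+ 2 + v 1 0 ^+ 2).
Definition opnorm {R : realType} (B : 'M[R]_2) : R :=
  sup [set enorm (B *m v) | v in [set v : 'cV[R]_2 | enorm v = 1]].

Definition prodw {R : realType} {n k : nat} (A : Alph n -> 'M[R]_2) (w : word n k)
  : 'M[R]_2 := \prod_(j < k) A (w j).

Definition birk {R : realType} {n : nat} (f : Seq n -> R) (k : nat) (x : Seq n) : R :=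
  \sum_(j < k) f (iter j shift x).

Definition pressure {R : realType} {n : nat} (phi : nat -> Seq n -> R) : R :=
  limn (fun k : nat => k%:R^-1 *
    ln (\sum_(w : word n k) expR (sup [set phi k x | x in cyl w]))).

Definition phis {R : realType} {n : nat} (A : Alph n -> 'M[R]_2) (s : R)
  (k : nat) (x : Seq n) : R := ln (opnorm (prodw A (trunc x k)) `^ s).

(* measure-theoretic entropy of the shift (via the generating partition
   into cylinders) *)
Definition entropy {R : realType} {n : nat} (mu : probability (SigmaM n) R) : R :=
  limn (fun k : nat => k%:R^-1 *
    \sum_(w : word n k) - (fine (mu (cyl w)) * ln (fine (mu (cyl w))))).

Definition shift_invariant {R : realType} {n : nat} (mu : probability (SigmaM n) R) :=
  forall E : set (SigmaM n), measurable E -> mu (@shift n @^-1` E) = mu E.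

Definition equilibrium_state {R : realType} {n : nat} (A : Alph n -> 'M[R]_2) (s : R)
  (mu : probability (SigmaM n) R) : Prop :=
  shift_invariant mu /\
  pressure (phis A s) = entropy mu +
    limn (fun k : nat => k%:R^-1 * fine (\int[mu]_x (phis A s k x)%:E)).

Definition holder {R : realType} {n : nat} (f : Seq n -> R) : Prop :=
  exists C tau : R, 0 < C /\ 0 < tau < 1 /\
    forall (x y : Seq n) (k : nat), (forall j, (j < k)%N -> x j = y j) ->
      `|f x - f y| <= C * tau ^+ k.

Definition gibbs {R : realType} {n : nat} (mu : probability (SigmaM n) R)
  (f : Seq n -> R) : Prop :=
  exists C : R, 1 <= C /\
    forall (k : nat) (w : word n k) (x : Seq n), cyl w x ->
      let e := expR (- (k%:R * pressure (birk f)) + birk f k x) in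
      ((C^-1 * e)%:E <= mu (cyl w))%E /\ (mu (cyl w) <= (C * e)%:E)%E.

Definition irreducible {R : realType} {n : nat} (A : Alph n -> 'M[R]_2) : Prop :=
  forall v : 'cV[R]_2, v != 0 -> ~ (forall i, exists c : R, A i *m v = c *: v).

Definition strongly_conformal {R : realType} {n : nat} (A : Alph n -> 'M[R]_2) : Prop :=
  exists M : 'M[R]_2, M \in unitmx /\
    forall i, let B := (`|\det (A i)| `^ (- 2^-1)) *: (M *m A i *m invmx M) in
      B *m B^T = 1%:M.

(* RP^1 is parametrised by angles t in R (mod pi): t |-> the line through dir t *)
Definition dir {R : realType} (t : R) : 'cV[R]_2 :=
  \col_(i < 2) (if i == 0 then cos t else sin t).

Definition parallel {R : realType} (u v : 'cV[R]_2) : Prop :=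
  u 0 0 * v 1 0 - u 1 0 * v 0 0 = 0.

(* a multicone, as a pi-periodic set of angles: a nonempty finite union of
   closed projective intervals, proper in RP^1 *)
Definition multicone {R : realType} (M : set R) : Prop :=
  (exists (m : nat) (a b : 'I_m.+1 -> R), (forall j, a j <= b j) /\
     M = [set t | exists j (z : int), a j + z%:~R * pi <= t <= b j + z%:~R * pi])
  /\ M != setT.

Definition strongly_invariant {R : realType} {n : nat} (M : set R)
  (A : Alph n -> 'M[R]_2) : Prop :=
  forall i t u, M t -> parallel (A i *m dir t) (dir u) -> (M°) u.

(* Main.v *)
(** Write [|A_w|] for the norm of the product along a word [w].

    (1) <-> (3).  Irreducibility makes the norm quasi-multiplicative:
    [|A_u| |A_v| <= C (|A_uv| + sum_a |A_uav|)].  An equilibrium state [mu] then satisfies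
    [mu[w] ~ exp(-|w| P) |A_w|^s]: testing the Gibbs inequality against weights tilted by
    [exp(t * number of occurrences of w)], with [t] of either sign and of order [1/|w|],
    compares [mu[w]] with the quasi-multiplicative weight.  Hence [mu] is Gibbs for [f] iff
    Birkhoff sums of an affine image of [f] follow [ln |A_w|].

    (2) -> (3).  If a multicone is strictly invariant, its complement is contracted
    exponentially by the inverses, so [ln |A_(x|k) v| - ln |A_(shift x|k-1) v|] converges
    exponentially for [v] inside it; the limit is the potential.  In the conformal case the
    potential depends on one letter only.

    (3) -> (2).  Rescale to [|det| = 1]; then (3) makes the norm almost multiplicative.  If
    the products are bounded, the quadratic form of maximal determinant below
    [sup_w |A_w x|^2] is unique, hence invariant.  Otherwise all long products are large:
    a bounded sequence of ever longer words has a limit [E], Hoelder continuity forces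
    [|E A_(a_1) ... E A_(a_m)|] to be comparable to a product [r(a_1) ... r(a_m)], and the
    bounded semigroup generated by the [E A_a / r(a)] contains a contraction of the
    area, whose powers tend to rank one; this yields a line invariant under all [A_i].
    When long products are large, the images of the vectors that every product expands
    almost maximally form a strictly invariant cone, which is thickened to a multicone. *)
Require Import Defs.
From HB Require Import structures.
From mathcomp Require Import all_boot all_order all_algebra.
From mathcomp Require Import all_classical all_reals all_analysis.
From mathcomp Require Import ring lra zify.
Import Order.TTheory GRing.Theory Num.Theory.
Import numFieldNormedType.Exports.
Local Open Scope classical_set_scope.
Local Open Scope ring_scope.

Set Implicit Arguments.
Unset Strict Implicit.

(** * Planar linear algebra *)

Section Planar.
Context {R : realType}.
Implicit Types (u v x y : 'cV[R]_2) (A B : 'M[R]_2) (c t : R).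

(** The constant comparing [mu[w]] with the weight must not depend on [w]. The number of occurrences
    of [w] is additive under concatenation up to an error of order [|w|], so a tilt of order [1/|w|]
    keeps the weight quasi-multiplicative at the cost of one factor [e]; this fixes the size of [t].
    The estimate is made at length [|w| + M], and letting [M] grow removes the remaining error of
    order [1/t].

    In the last direction the obstacle is that bounded and unbounded long products might coexist.
    Long copies of a bounded word are put before every inserted word: the Hoelder errors between
    neighbouring blocks then vanish in the limit, while the constant [C] is paid once per product
    and not once per block.

    Planar estimates go through [wedge], which is multiplied by the determinant and whose absolute
    value on unit vectors is the sine of the angle. It takes the place of singular values and of a
    projective metric. *)

Definition wedge u v : R := u 0 0 * v 1 0 - u 1 0 * v 0 0.
Definition inner u v : R := u 0 0 * v 0 0 + u 1 0 * v 1 0.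
Definition vperp u : 'cV[R]_2 := \col_i (if i == 0 then - u 1 0 else u 0 0).

Lemma cv2P u v : u 0 0 = v 0 0 -> u 1 0 = v 1 0 -> u = v.
Proof.
move=> h0 h1; apply/matrixP => i j; rewrite (ord1 j).
by case: i => [[|[|//]] hi]; [move: h0|move: h1]; congr (u _ _ = v _ _); apply/val_inj.
Qed.

Lemma mx2P A B : A 0 0 = B 0 0 -> A 0 1 = B 0 1 -> A 1 0 = B 1 0 ->
  A 1 1 = B 1 1 -> A = B.
Proof.
move=> h00 h01 h10 h11; apply/matrixP => i j.
case: i => [[|[|//]] hi]; case: j => [[|[|//]] hj];
 [move: h00|move: h01|move: h10|move: h11];
 by congr (A _ _ = B _ _); apply/val_inj.
Qed.

Lemma mulmx2v A v i : (A *m v) i 0 = A i 0 * v 0 0 + A i 1 * v 1 0.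
Proof. by rewrite mxE big_ord_recl big_ord1; congr (_ + A i _ * v _ _); apply/val_inj. Qed.

Lemma mulmx22 A B i j : (A *m B) i j = A i 0 * B 0 j + A i 1 * B 1 j.
Proof. by rewrite mxE big_ord_recl big_ord1; congr (_ + A i _ * B _ _); apply/val_inj. Qed.

Lemma det2 A : \det A = A 0 0 * A 1 1 - A 0 1 * A 1 0.
Proof.
rewrite (expand_det_row _ 0) !big_ord_recl big_ord0 /cofactor !det_mx11 !mxE /= addr0.
rewrite /bump /= expr0 expr1 mul1r mulN1r mulrN.
by congr (A _ _ * A _ _ - A _ _ * A _ _); apply/val_inj.
Qed.

Lemma vperpE0 u : vperp u 0 0 = - u 1 0. Proof. by rewrite mxE eqxx. Qed.
Lemma vperpE1 u : vperp u 1 0 = u 0 0. Proof. by rewrite mxE. Qed.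
Definition vE := (vperpE0, vperpE1, mulmx2v, mulmx22).

Lemma wedge_mul A u v : wedge (A *m u) (A *m v) = \det A * wedge u v.
Proof. by rewrite /wedge !vE det2; ring. Qed.

Lemma wedgexx u : wedge u u = 0. Proof. by rewrite /wedge; ring. Qed.
Lemma wedgeC u v : wedge u v = - wedge v u. Proof. by rewrite /wedge; ring. Qed.
Lemma wedgeZl c u v : wedge (c *: u) v = c * wedge u v.
Proof. by rewrite /wedge !mxE; ring. Qed.
Lemma wedgeZr c u v : wedge u (c *: v) = c * wedge u v.
Proof. by rewrite /wedge !mxE; ring. Qed.
Lemma wedgeDl u v x : wedge (u + v) x = wedge u x + wedge v x.
Proof. by rewrite /wedge !mxE; ring. Qed.
Lemma wedgeDr u v x : wedge x (u + v) = wedge x u + wedge x v.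
Proof. by rewrite /wedge !mxE; ring. Qed.

Lemma enorm_ge0 u : 0 <= enorm u. Proof. exact: sqrtr_ge0. Qed.

Lemma enorm_sqr u : enorm u ^+ 2 = inner u u.
Proof. by rewrite /enorm sqr_sqrtr ?addr_ge0 ?sqr_ge0 // /inner !expr2. Qed.

Lemma lagrange2 u v : inner u v ^+ 2 + wedge u v ^+ 2 = (enorm u * enorm v) ^+ 2.
Proof. by rewrite exprMn !enorm_sqr /inner /wedge; ring. Qed.

Lemma wedge_le u v : `|wedge u v| <= enorm u * enorm v.
Proof.
rewrite -ler_sqr ?nnegrE ?mulr_ge0 ?enorm_ge0 // -lagrange2.
by rewrite real_normK ?num_real // lerDr sqr_ge0.
Qed.

Lemma inner_le u v : `|inner u v| <= enorm u * enorm v.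
Proof.
rewrite -ler_sqr ?nnegrE ?mulr_ge0 ?enorm_ge0 // -lagrange2.
by rewrite real_normK ?num_real // lerDl sqr_ge0.
Qed.

Lemma enorm_eq0 u : (enorm u == 0) = (u == 0).
Proof.
apply/idP/eqP => [|->]; last first.
  by rewrite /enorm !mxE expr0n /= addr0 sqrtr0.
rewrite -(@eqrXn2 _ 2) // ?enorm_ge0 // expr0n /= enorm_sqr /inner -!expr2.
rewrite paddr_eq0 ?sqr_ge0 // !sqrf_eq0 => /andP[/eqP h0 /eqP h1].
by apply: cv2P; rewrite ?h0 ?h1 mxE.
Qed.

Lemma enorm0 : enorm (0 : 'cV[R]_2) = 0.
Proof. by apply/eqP; rewrite enorm_eq0. Qed.

Lemma enorm_gt0 u : (0 < enorm u) = (u != 0).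
Proof. by rewrite lt0r enorm_ge0 andbT enorm_eq0. Qed.

Lemma enormZ c u : enorm (c *: u) = `|c| * enorm u.
Proof.
apply/eqP; rewrite -(@eqrXn2 _ 2) ?mulr_ge0 ?enorm_ge0 // exprMn !enorm_sqr.
by rewrite real_normK ?num_real // /inner !mxE; apply/eqP; ring.
Qed.

Lemma enormN u : enorm (- u) = enorm u.
Proof. by rewrite -scaleN1r enormZ normrN1 mul1r. Qed.

Lemma enormD u v : enorm (u + v) <= enorm u + enorm v.
Proof.
rewrite -ler_sqr ?nnegrE ?addr_ge0 ?enorm_ge0 // sqrrD !enorm_sqr.
have := le_trans (ler_norm _) (inner_le u v).
rewrite /inner !mxE; lra.
Qed.

Lemma enorm_perp u : enorm (vperp u) = enorm u.
Proof. by rewrite /enorm !vE sqrrN addrC. Qed.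

(** Coordinates of [v] in the orthogonal basis [u], [vperp u], cleared of the denominator. It serves
    wherever a singular value decomposition would otherwise choose a basis. *)
Lemma frame u v : enorm u ^+ 2 *: v = inner u v *: u + wedge u v *: vperp u.
Proof. by rewrite enorm_sqr; apply: cv2P; rewrite !mxE /inner /wedge /=; ring. Qed.

Lemma wedge_shear c u v x :
  wedge (u + c *: x) (v + (- c) *: x) = wedge u v + c * (wedge x v + wedge x u).
Proof. by rewrite /wedge !mxE; ring. Qed.

(** Cramer's rule without division: the wedges of [x] with two independent vectors control all of
    [x]. *)
Lemma plucker u v x : wedge u v *: x = wedge x v *: u - wedge x u *: v.
Proof. by apply: cv2P; rewrite !mxE /wedge; ring. Qed.

Lemma wedge_perp u : wedge u (vperp u) = enorm u ^+ 2.
Proof. by rewrite enorm_sqr /wedge /inner !vE; ring. Qed.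

(* Sign-adjusted unit vectors: the angle between two lines is controlled by the
   wedge, and [2 - 2 cos <= 2 (1 - cos ^ 2)] when [0 <= cos]. *)
Lemma near_sign u v : enorm u = 1 -> enorm v = 1 ->
  exists e : R, `|e| = 1 /\ enorm (u - e *: v) <= 2 * `|wedge u v|.
Proof.
move=> hu hv; have := lagrange2 u v; rewrite hu hv mulr1 expr1n => L.
have hi := inner_le u v; rewrite hu hv mulr1 in hi.
suff [e [he h]] : exists e : R, `|e| = 1 /\ enorm (u - e *: v) ^+ 2 <= (2 * wedge u v) ^+ 2.
  exists e; split => //.
  rewrite -ler_sqr ?nnegrE ?enorm_ge0 ?mulr_ge0 // exprMn real_normK ?num_real //.
  by rewrite -exprMn.
have E e : enorm (u - e *: v) ^+ 2 = 1 - 2 * e * inner u v + e ^+ 2.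
  have -> : enorm (u - e *: v) ^+ 2 =
     enorm u ^+ 2 - 2 * e * inner u v + e ^+ 2 * enorm v ^+ 2.
    by rewrite !enorm_sqr /inner !mxE; ring.
  by rewrite hu hv; ring.
rewrite exprMn -[wedge u v ^+ 2](addKr (inner u v ^+ 2)) L.
case: (lerP 0 (inner u v)) => h.
  exists 1; rewrite normr1; split => //; rewrite E; move: hi; rewrite ger0_norm //; nra.
exists (-1); rewrite normrN1; split => //; rewrite E; move: hi; rewrite ltr0_norm //; nra.
Qed.

Let unitv : set 'cV[R]_2 := [set v | enorm v = 1].

Lemma entry_le_enorm u i : `|u i 0| <= enorm u.
Proof.
rewrite -ler_sqr ?nnegrE ?enorm_ge0 // real_normK ?num_real // enorm_sqr /inner -!expr2.
have [->|->] : i = 0 \/ i = 1.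
  by case: i => [[|[|//]] hi]; [left|right]; apply/val_inj.
- by rewrite lerDl sqr_ge0.
- by rewrite lerDr sqr_ge0.
Qed.

Definition e0 : 'cV[R]_2 := \col_i (i == 0)%:R.
Definition e1 : 'cV[R]_2 := \col_i (i == 1)%:R.

Lemma enorm_e0 : enorm e0 = 1.
Proof. by rewrite /enorm !mxE /= expr1n expr0n addr0 sqrtr1. Qed.
Lemma enorm_e1 : enorm e1 = 1.
Proof. by rewrite /enorm !mxE /= expr1n expr0n add0r sqrtr1. Qed.

Lemma vec_split v : v = v 0 0 *: e0 + v 1 0 *: e1.
Proof. by apply: cv2P; rewrite !mxE /=; ring. Qed.

Lemma enorm_mul_le A v : enorm (A *m v) <= (enorm (A *m e0) + enorm (A *m e1)) * enorm v.
Proof.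
rewrite {1}(vec_split v) mulmxDr -!scalemxAr (le_trans (enormD _ _)) // !enormZ.
rewrite mulrDl lerD // mulrC ler_wpM2l ?enorm_ge0 // entry_le_enorm //.
Qed.

Let opset A := [set enorm (A *m v) | v in unitv].

Lemma opset_sup A : has_sup (opset A).
Proof.
split; first by exists (enorm (A *m e0)), e0 => //; exact: enorm_e0.
exists (enorm (A *m e0) + enorm (A *m e1)) => _ [v hv <-].
by rewrite (le_trans (enorm_mul_le _ _)) // hv mulr1.
Qed.

Lemma opnorm_cols A : opnorm A <= enorm (A *m e0) + enorm (A *m e1).
Proof.
apply: ge_sup; first by case: (opset_sup A).
by move=> _ [v hv <-]; rewrite (le_trans (enorm_mul_le _ _)) // hv mulr1.
Qed.

Lemma enorm_mul A v : enorm (A *m v) <= opnorm A * enorm v.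
Proof.
case: (eqVneq v 0) => [->|v0]; first by rewrite mulmx0 enorm0 mulr0.
have n0 : 0 < enorm v by rewrite enorm_gt0.
rewrite -ler_pdivrMr //.
have -> : enorm (A *m v) / enorm v = enorm (A *m ((enorm v)^-1 *: v)).
  by rewrite -scalemxAr enormZ ger0_norm ?invr_ge0 ?enorm_ge0 // mulrC.
apply: sup_upper_bound; first exact: opset_sup.
exists ((enorm v)^-1 *: v) => //; rewrite /unitv /= enormZ ger0_norm ?invr_ge0 ?enorm_ge0 //.
by rewrite mulVf ?gt_eqF.
Qed.

Lemma opnorm_le A c : (forall v, enorm (A *m v) <= c * enorm v) -> opnorm A <= c.
Proof.
move=> h; apply: ge_sup; first by case: (opset_sup A).
by move=> _ [v hv <-]; rewrite (le_trans (h _)) // hv mulr1.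
Qed.

Lemma opnorm_ge0 A : 0 <= opnorm A.
Proof. by rewrite (le_trans (enorm_ge0 (A *m e0))) // (le_trans (enorm_mul _ _)) // enorm_e0 mulr1. Qed.

Lemma opnormM A B : opnorm (A *m B) <= opnorm A * opnorm B.
Proof.
apply: opnorm_le => v; rewrite -mulmxA (le_trans (enorm_mul _ _)) // -mulrA.
by rewrite ler_wpM2l ?opnorm_ge0 // enorm_mul.
Qed.

Lemma opnormD A B : opnorm (A + B) <= opnorm A + opnorm B.
Proof.
apply: opnorm_le => v; rewrite mulmxDl (le_trans (enormD _ _)) // mulrDl.
by rewrite lerD // enorm_mul.
Qed.

Lemma opnormZ c A : opnorm (c *: A) = `|c| * opnorm A.
Proof.
have H d B : opnorm (d *: B) <= `|d| * opnorm B.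
  apply: opnorm_le => v; rewrite -scalemxAl enormZ -mulrA ler_wpM2l // enorm_mul //.
apply/eqP; rewrite eq_le H /=.
case: (eqVneq c 0) => [->|c0]; first by rewrite normr0 mul0r opnorm_ge0.
rewrite -ler_pdivlMl ?normr_gt0 // -normfV (le_trans _ (H _ _)) //.
by rewrite scalerA mulVf // scale1r.
Qed.

Lemma opnorm1 : opnorm (1%:M : 'M[R]_2) = 1.
Proof.
apply/eqP; rewrite eq_le; apply/andP; split.
  by apply: opnorm_le => v; rewrite mul1mx mul1r.
by have := enorm_mul 1%:M e0; rewrite mul1mx enorm_e0 mulr1.
Qed.

(** The smaller singular value is [|det A| / opnorm A]: the square on [v], [vperp v] has its area
    multiplied by [|det A|], and the image of the second side has length at most
    [opnorm A * enorm v]. *)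
Lemma det_enorm A v : `|\det A| * enorm v <= opnorm A * enorm (A *m v).
Proof.
case: (eqVneq v 0) => [->|v0]; first by rewrite mulmx0 enorm0 !mulr0.
have n0 : 0 < enorm v by rewrite enorm_gt0.
rewrite -(ler_pM2r n0) -mulrA -expr2 -wedge_perp.
have -> : wedge v (vperp v) = `|wedge v (vperp v)|.
  by rewrite ger0_norm // wedge_perp sqr_ge0.
rewrite -normrM -wedge_mul (le_trans (wedge_le _ _)) //.
rewrite mulrC -mulrA [X in _ <= _ * X]mulrC mulrA ler_wpM2r ?enorm_ge0 //.
by rewrite (le_trans (enorm_mul _ _)) // enorm_perp.
Qed.

Lemma det_opnorm A : `|\det A| <= opnorm A ^+ 2.
Proof.
have := det_enorm A e0; rewrite enorm_e0 mulr1 => /le_trans -> //.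
by rewrite expr2 ler_wpM2l ?opnorm_ge0 // (le_trans (enorm_mul _ _)) // enorm_e0 mulr1.
Qed.

Lemma unit_det A : (A \in unitmx) = (\det A != 0).
Proof. by rewrite unitmxE unitfE. Qed.

Lemma opnorm_gt0 A : A \in unitmx -> 0 < opnorm A.
Proof.
rewrite unit_det => hA; rewrite lt0r opnorm_ge0 andbT; apply/eqP => h.
have := det_opnorm A; rewrite h expr0n /= normr_le0; exact/negP.
Qed.

Lemma unit_mul_neq0 A v : A \in unitmx -> v != 0 -> A *m v != 0.
Proof.
move=> hA; apply: contra => /eqP h; apply/eqP.
by rewrite -(mulKmx hA v) h mulmx0.
Qed.

Lemma entry_le_opnorm A i j : `|A i j| <= opnorm A.
Proof.
have [->|->] : j = 0 \/ j = 1.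
  by case: j => [[|[|//]] hi]; [left|right]; apply/val_inj.
- have -> : A i 0 = (A *m e0) i 0 by rewrite mulmx2v !mxE /=; ring.
  rewrite (le_trans (entry_le_enorm _ _)) // (le_trans (enorm_mul _ _)) //.
  by rewrite enorm_e0 mulr1.
- have -> : A i 1 = (A *m e1) i 0 by rewrite mulmx2v !mxE /=; ring.
  rewrite (le_trans (entry_le_enorm _ _)) // (le_trans (enorm_mul _ _)) //.
  by rewrite enorm_e1 mulr1.
Qed.

Lemma enorm_le_entries u : enorm u <= `|u 0 0| + `|u 1 0|.
Proof.
rewrite {1}(vec_split u) (le_trans (enormD _ _)) // !enormZ enorm_e0 enorm_e1 !mulr1 //.
Qed.

Lemma opnorm_le_entries A :
  opnorm A <= `|A 0 0| + `|A 1 0| + (`|A 0 1| + `|A 1 1|).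
Proof.
rewrite (le_trans (opnorm_cols _)) // lerD // (le_trans (enorm_le_entries _)) //;
 by rewrite !mulmx2v !mxE /= !mulr0 !mulr1 ?addr0 ?add0r.
Qed.

(** Avoids showing that the supremum in [opnorm] is attained: one of the two basis vectors realises
    it up to the factor 2. *)
Lemma opnorm_col_half A : exists x, enorm x = 1 /\ opnorm A <= 2 * enorm (A *m x).
Proof.
have := opnorm_cols A; case: (lerP (enorm (A *m e0)) (enorm (A *m e1))) => h h'.
  by exists e1; split; [exact: enorm_e1 | lra].
by exists e0; split; [exact: enorm_e0 | lra].
Qed.

Lemma enorm_dir t : enorm (dir t : 'cV[R]_2) = 1.
Proof. by rewrite /enorm !mxE /= cos2Dsin2 sqrtr1. Qed.

Lemma dir_neq0 t : (dir t : 'cV[R]_2) != 0.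
Proof. by rewrite -enorm_gt0 enorm_dir. Qed.

Lemma wedge_dir s t : wedge (dir s) (dir t) = sin (t - s) :> R.
Proof. by rewrite /wedge !mxE /= sinB; ring. Qed.

Lemma dir_pi t (z : int) : exists e : R, `|e| = 1 /\ dir (t + z%:~R * pi) = e *: dir t.
Proof.
have H (k : nat) : exists e : R, `|e| = 1 /\ forall s, dir (s + k%:R * pi) = e *: dir s.
  elim: k => [|k [e [he IH]]].
    by exists 1; rewrite normr1; split => // s; rewrite mul0r addr0 scale1r.
  exists (- e); rewrite normrN he; split => // s.
  have -> : s + k.+1%:R * pi = (s + k%:R * pi) + pi by rewrite -natr1; ring.
  rewrite scaleNr -IH; apply: cv2P; rewrite !mxE /= ?cosDpi ?sinDpi //.
case: z => k.
  by have [e [he h]] := H k; exists e; split => //; rewrite h.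
have [e [he h]] := H k.+1; exists e; split => //.
have := h (t + (Negz k)%:~R * pi).
rewrite NegzE mulrNz mulNr subrK => ->; rewrite scalerA.
by rewrite -expr2 -real_normK ?num_real // he expr1n scale1r.
Qed.

Lemma polar v : exists2 t, t \in `[- pi, pi] & v = enorm v *: dir t.
Proof.
case: (eqVneq v 0) => [->|v0]; first exists 0; rewrite ?enorm0 ?scale0r //.
  by rewrite in_itv /=; have := pi_ge0 R; lra.
have n0 : 0 < enorm v by rewrite enorm_gt0.
set a := v 0 0 / enorm v; set b := v 1 0 / enorm v.
have hab : a ^+ 2 + b ^+ 2 = 1.
  rewrite /a /b !expr_div_n -mulrDl enorm_sqr /inner -!expr2 divff //.
  by rewrite !expr2 -/(inner v v) -enorm_sqr expf_eq0 /= gt_eqF.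
have a1 : -1 <= a <= 1.
  by rewrite -ler_norml -(@expr_le1 _ 2) // real_normK ?num_real // -hab lerDl sqr_ge0.
have hs : `|sin (acos a)| = `|b|.
  rewrite sin_acos // -[1]hab addrC addKr sqrtr_sqr normr_id //.
have [hb|hb] : sin (acos a) = b \/ sin (acos a) = - b.
  have : sin (acos a) ^+ 2 == b ^+ 2.
    by rewrite -(real_normK (num_real (sin _))) hs real_normK ?num_real.
  by rewrite eqf_sqr => /orP[] /eqP; [left|right].
- exists (acos a).
    by rewrite in_itv /= acos_lepi // andbT; have := pi_ge0 R; have := acos_ge0 a1; lra.
  by apply: cv2P; rewrite !mxE /= ?acosK // ?hb /a /b mulrC divfK ?gt_eqF.
- exists (- acos a).
    by rewrite in_itv /=; have := pi_ge0 R; have := acos_ge0 a1; have := acos_lepi a1; lra.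
  by apply: cv2P; rewrite !mxE /= ?cosN ?sinN ?acosK // ?hb ?opprK /a /b mulrC divfK ?gt_eqF.
Qed.

Lemma parallelE u v : parallel u v <-> wedge u v = 0. Proof. by []. Qed.

Lemma wedge_eq0_scale u v : u != 0 -> wedge u v = 0 -> exists c, v = c *: u.
Proof.
move=> u0 h; have n0 : enorm u ^+ 2 != 0 by rewrite expf_eq0 /= enorm_eq0.
exists (inner u v / enorm u ^+ 2).
have E0 : inner u v * u 0 0 = enorm u ^+ 2 * v 0 0.
  have : inner u v * u 0 0 - enorm u ^+ 2 * v 0 0 = - u 1 0 * wedge u v * -1.
    by rewrite enorm_sqr /inner /wedge; ring.
  by rewrite h; lra.
have E1 : inner u v * u 1 0 = enorm u ^+ 2 * v 1 0.
  have : inner u v * u 1 0 - enorm u ^+ 2 * v 1 0 = - u 0 0 * wedge u v.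
    by rewrite enorm_sqr /inner /wedge; ring.
  by rewrite h; lra.
by apply: cv2P; rewrite mxE mulrAC ?E0 ?E1 mulrAC divff // mul1r.
Qed.

End Planar.

(** * Quasi-multiplicative weights on words *)

Section Words.
Context {T : finType}.
Implicit Types (u v w i : seq T).

(** Words are plain sequences so that concatenation needs no cast; [sum_word] translates sums over
    length-indexed words. *)
Fixpoint words (k : nat) : seq (seq T) :=
  if k is k'.+1 then [seq a :: w | a <- index_enum T, w <- words k'] else [:: [::]].

Lemma mem_words k w : (w \in words k) = (size w == k).
Proof.
elim: k w => [|k IH] [|a w] //=.
  by apply/allpairsP => -[[b v] [_ _]].
rewrite eqSS -IH; apply/allpairsP/idP => [[[b v] [_ hv [_ ->]]] //|hw].
by exists (a, w); split => //; exact: mem_index_enum.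
Qed.

Lemma size_words k w : w \in words k -> size w = k.
Proof. by rewrite mem_words => /eqP. Qed.

Context {R : realType}.
Implicit Types (F : seq T -> R).

Lemma sum_words0 F : \sum_(w <- words 0) F w = F [::].
Proof. by rewrite big_seq1. Qed.

Lemma sum_wordsS k F :
  \sum_(w <- words k.+1) F w = \sum_a \sum_(w <- words k) F (a :: w).
Proof. exact: big_allpairs_dep. Qed.

Lemma sum_words_cat p q F : \sum_(w <- words (p + q)) F w =
  \sum_(u <- words p) \sum_(v <- words q) F (u ++ v).
Proof.
elim: p F => [|p IH] F; first by rewrite sum_words0.
by rewrite addSn !sum_wordsS; apply: eq_bigr => a _; rewrite IH.
Qed.

Lemma sum_words1 F : \sum_(w <- words 1) F w = \sum_a F [:: a].
Proof. by rewrite sum_wordsS; apply: eq_bigr => a _; rewrite sum_words0. Qed.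

Lemma sum_words_rcons k F :
  \sum_(w <- words k.+1) F w = \sum_(w <- words k) \sum_a F (rcons w a).
Proof.
rewrite -addn1 sum_words_cat; apply: eq_bigr => w _; rewrite sum_words1.
by apply: eq_bigr => a _; rewrite cats1.
Qed.

Lemma sum_words_cons k F :
  \sum_(w <- words k.+1) F w = \sum_(w <- words k) \sum_a F (a :: w).
Proof. by rewrite sum_wordsS exchange_big. Qed.

Lemma sum_words_prefix (r : nat) i F :
  \sum_(w <- words (size i + r)) F w * (prefix i w)%:R = \sum_(v <- words r) F (i ++ v).
Proof.
elim: i F => [|a i IH] F.
  by apply: eq_bigr => v _; rewrite prefix0s mulr1.
have -> : (size (a :: i) + r = (size i + r).+1)%N by [].
rewrite sum_wordsS (bigD1 a) //= [X in _ + X]big1 ?addr0; last first.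
  move=> b ba; apply: big1 => w _; rewrite eq_sym (negbTE ba) /= mulr0 //.
by rewrite -(IH (fun w => F (a :: w))); apply: eq_bigr => w _; rewrite eqxx.
Qed.

(** The position [p = size w] counts for the empty [i]; including it makes the identities below hold
    for every [i]. *)
Definition occ i w : nat := \sum_(p < (size w).+1) prefix i (drop p w).

Lemma occ_nil i : occ i [::] = nilp i.
Proof. by rewrite /occ big_ord1 /=; case: i. Qed.

Lemma occ_cons i a w : occ i (a :: w) = (prefix i (a :: w) + occ i w)%N.
Proof. by rewrite /occ big_ord_recl. Qed.

Lemma prefix_mono i u v : prefix i u -> prefix i (u ++ v).
Proof. by move=> h; exact: prefix_catl. Qed.

(** The [+ 1] pays for the empty [i], whose occurrence at the junction is counted in both parts. *)
Lemma occ_cat_ge i u v : (occ i u + occ i v <= occ i (u ++ v) + 1)%N.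
Proof.
elim: u => [|a u IH]; first by rewrite occ_nil /=; case: nilp; lia.
rewrite cat_cons !occ_cons.
have : (prefix i (a :: u) <= prefix i (a :: u ++ v))%N.
  by case h : (prefix i (a :: u)) => //; rewrite -cat_cons prefix_mono.
move: IH; lia.
Qed.

(** An occurrence that straddles the junction starts among the last [size i] letters of [u]. *)
Lemma occ_cat_le i u v : (occ i (u ++ v) <= occ i u + occ i v + minn (size u) (size i))%N.
Proof.
elim: u => [|a u IH]; first by rewrite /= min0n addn0 leq_addl.
rewrite cat_cons !occ_cons.
case: (ltnP (size u) (size i)) => hs.
  have : (prefix i (a :: u ++ v) <= 1)%N by case: prefix.
  move: IH; rewrite /=; lia.
have -> : prefix i (a :: u ++ v) = prefix i (a :: u).
  rewrite -cat_cons !prefixE take_cat; case: ltnP => //= h.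
  suff -> : (size i - (size u).+1)%N = 0%N by rewrite take0 cats0 take_oversize //.
  by move: h hs; rewrite /=; lia.
move: IH; rewrite /=; lia.
Qed.

Lemma occ_self i : (1 <= occ i i <= (size i).+1)%N.
Proof.
rewrite /occ; apply/andP; split.
  by rewrite big_ord_recl /= drop0 prefix_refl.
rewrite -[X in (_ <= X)%N](card_ord) -sum1_card leq_sum // => p _; by case: prefix.
Qed.

Lemma occ_le_size i w : (occ i w <= (size w).+1)%N.
Proof.
rewrite /occ -[X in (_ <= X)%N](card_ord) -sum1_card leq_sum // => p _; by case: prefix.
Qed.

(* The windows of a word [w] of length [size i + M] that may contain [i] are those
   starting at [p <= M]. *)
Lemma sum_occ i (M : nat) F :
  \sum_(w <- words (size i + M)) F w * (occ i w)%:R =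
  \sum_(p < M.+1) \sum_(u <- words p) \sum_(v <- words (M - p)) F (u ++ i ++ v).
Proof.
have E p : (p <= M)%N -> \sum_(w <- words (size i + M)) F w * (prefix i (drop p w))%:R =
    \sum_(u <- words p) \sum_(v <- words (M - p)) F (u ++ i ++ v).
  move=> hp; have -> : (size i + M = p + (size i + (M - p)))%N by lia.
  rewrite sum_words_cat; apply: eq_big_seq => u /size_words hu.
  rewrite -[RHS](sum_words_prefix _ _ (fun v => F (u ++ v))); apply: eq_bigr => v _.
  by rewrite drop_size_cat.
transitivity (\sum_(w <- words (size i + M)) \sum_(p < M.+1) F w * (prefix i (drop p w))%:R).
  apply: eq_big_seq => w /size_words hw; rewrite -mulr_sumr -natr_sum; congr (_ * _%:R).
  rewrite /occ hw [in RHS](big_ord_widen (size i + M).+1 (fun p => nat_of_bool (prefix i (drop p w)))); last lia.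
  rewrite [RHS]big_mkcond; apply: eq_bigr => p _.
  case: ltnP => // hp; apply/eqP; rewrite eqb0; apply/negP => /prefixP [v hv].
  have h : (size (i ++ v) = size i + M - p)%N by rewrite -hv size_drop hw.
  by move: h; rewrite size_cat; have := ltn_ord p; lia.
rewrite exchange_big; apply: eq_bigr => p _; apply: E; case: p => p hp /=; lia.
Qed.

End Words.

Section GibbsInequality.
Context {R : realType}.

Lemma ln_le_sub1 (x : R) : 0 < x -> ln x <= x - 1.
Proof. by move=> x0; have := le_ln1Dx (x := x - 1); rewrite (addrC 1) subrK; apply; lra. Qed.

(** Jensen's inequality in the form [ln x <= x - 1], for families that are not normalised. A zero of
    [p] contributes [0 <= q x]. *)
Lemma gibbs_ineq (I : eqType) (r : seq I) (p q : I -> R) :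
  (forall x, 0 <= p x) -> (forall x, x \in r -> 0 <= q x) ->
  (forall x, x \in r -> 0 < p x -> 0 < q x) ->
  \sum_(x <- r) p x * (ln (q x) - ln (p x)) <= \sum_(x <- r) q x - \sum_(x <- r) p x.
Proof.
move=> hp hq hpq; rewrite -sumrB big_seq [X in _ <= X]big_seq; apply: ler_sum => x xr.
have := hp x; rewrite le_eqVlt => /orP[/eqP <-|px]; first by rewrite mul0r subr0 hq.
have qx := hpq x xr px.
have h : p x * ln (q x / p x) <= p x * (q x / p x - 1).
  by rewrite ler_pM2l // ln_le_sub1 // divr_gt0.
rewrite -ln_div ?posrE //; apply: le_trans h _.
by rewrite mulrBr mulr1 mulrCA divff ?gt_eqF // mulr1.
Qed.

End GibbsInequality.

Section Weights.
Context {T : finType} {R : realType}.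
Implicit Types (u v w i : seq T) (W : seq T -> R) (C : R).

Definition total W k := \sum_(w <- words k) W w.

(** The bridge in [qm_sup] has length zero or one, so lengths are only controlled up to one letter;
    [qm_pad] lengthens a word and [qm_one] shortens a total to repair the mismatch. *)
Record qm_weight C W : Prop := QMWeight {
  qm_gt0 : forall w, 0 < W w;
  qm_ge1 : 1 <= C;
  qm_sub : forall u v, W (u ++ v) <= C * (W u * W v);
  qm_sup : forall u v, W u * W v <= C * (W (u ++ v) + \sum_a W (u ++ a :: v));
  qm_pad : forall w, W w <= C * \sum_a W (rcons w a);
  qm_one : \sum_a W [:: a] <= C }.

Section Fixed.
Variables (C : R) (W : seq T -> R).
Hypothesis H : qm_weight C W.

Let C1 : 1 <= C. Proof. exact: qm_ge1 H. Qed.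
Let C0 : 0 <= C. Proof. exact: le_trans ler01 C1. Qed.
Let W0 w : 0 <= W w. Proof. exact/ltW/(qm_gt0 H). Qed.
Let Z := total W.

Lemma total_ge0 k : 0 <= Z k.
Proof. by apply: sumr_ge0 => w _. Qed.

Lemma total_cat p q : Z (p + q) <= C * (Z p * Z q).
Proof.
rewrite /Z /total sum_words_cat mulr_suml mulr_sumr; apply: ler_sum => u _.
by rewrite mulr_sumr mulr_sumr; apply: ler_sum => v _; exact: qm_sub H _ _.
Qed.

(** Bridging produces words of length [p + q] and [p + q + 1]; the longer ones are brought back by
    [total_cat] and the bound on one-letter totals. *)
Lemma total_catS p q : Z p * Z q <= (C * (1 + C ^+ 2)) * Z (p + q).
Proof.
have E : Z p * Z q <= C * (Z (p + q) + Z (p + q).+1).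
  rewrite -addnS /Z /total 2!sum_words_cat mulr_suml -big_split mulr_sumr.
  apply: ler_sum => u _; rewrite mulr_sumr sum_wordsS exchange_big -big_split mulr_sumr /=.
  by apply: ler_sum => v _; exact: qm_sup H _ _.
have h1 : Z (p + q).+1 <= C ^+ 2 * Z (p + q).
  rewrite -addn1 (le_trans (total_cat _ _)) // expr2 -mulrA ler_wpM2l //.
  rewrite mulrC ler_wpM2r ?total_ge0 // /Z /total sum_words1; exact: qm_one H.
apply: le_trans E _; rewrite -mulrA ler_wpM2l // mulrDl mul1r lerD2l //.
Qed.

Variable i : seq T.
Let n := size i.
Let X p q := \sum_(u <- words p) \sum_(v <- words q) W (u ++ i ++ v).

Let X0 p q : 0 <= X p q.
Proof. by apply: sumr_ge0 => u _; apply: sumr_ge0. Qed.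

Let XS p q : X p q <= C * X p q.+1.
Proof.
rewrite /X mulr_sumr; apply: ler_sum => u _; rewrite sum_words_rcons mulr_sumr.
apply: ler_sum => v _; apply: le_trans (qm_pad H _) _.
by under eq_bigr do rewrite !rcons_cat.
Qed.

Let X_le p q : X p q <= C ^+ 2 * W i * (Z p * Z q).
Proof.
rewrite /X /Z /total mulr_suml mulr_sumr; apply: ler_sum => u _.
rewrite mulr_sumr mulr_sumr; apply: ler_sum => v _.
apply: le_trans (qm_sub H _ _) _; rewrite expr2 -!mulrA ler_wpM2l //.
have h : W u * W (i ++ v) <= W u * (C * (W i * W v)).
  by rewrite ler_pM2l ?(qm_sub H) // (qm_gt0 H).
by apply: le_trans h _; rewrite le_eqVlt; apply/orP; left; apply/eqP; ring.
Qed.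

(** One bridge on each side of [i] gives four patterns. Padding on the right brings all of them to
    [p + q + 2] letters around [i], and [i] then sits at position [p] or [p.+1]. *)
Let X_ge p q : W i * (Z p * Z q) <= 2 * C ^+ 4 * (X p q.+2 + X p.+1 q.+1).
Proof.
have E : W i * (Z p * Z q) <= C ^+ 2 * (X p q + X p q.+1 + (X p.+1 q + X p.+1 q.+1)).
  rewrite {1}/Z {1}/total mulr_suml mulr_sumr.
  have -> : X p q + X p q.+1 + (X p.+1 q + X p.+1 q.+1) =
    \sum_(u <- words p) \sum_(v <- words q) (W (u ++ i ++ v) + \sum_b W (u ++ i ++ b :: v)
     + \sum_a (W (u ++ a :: i ++ v) + \sum_b W (u ++ a :: i ++ b :: v))).
    have -> : X p q.+1 = \sum_(u <- words p) \sum_(v <- words q) \sum_b W (u ++ i ++ b :: v).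
      by apply: eq_bigr => u _; rewrite sum_words_cons.
    have -> : X p.+1 q = \sum_(u <- words p) \sum_(v <- words q) \sum_a W (u ++ a :: i ++ v).
      rewrite /X sum_words_rcons; apply: eq_bigr => u _; rewrite exchange_big.
      by do 2!apply: eq_bigr => ? _; rewrite cat_rcons.
    have -> : X p.+1 q.+1 = \sum_(u <- words p) \sum_(v <- words q)
        \sum_a \sum_b W (u ++ a :: i ++ b :: v).
      rewrite /X sum_words_rcons; apply: eq_bigr => u _.
      under eq_bigr do rewrite sum_words_cons.
      by rewrite exchange_big; do 3!apply: eq_bigr => ? _; rewrite cat_rcons.
    rewrite -!big_split; apply: eq_bigr => u _; rewrite -!big_split.
    by apply: eq_bigr => v _; rewrite big_split.
  rewrite mulr_sumr; apply: ler_sum => u _; rewrite !mulr_sumr; apply: ler_sum => v _.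
  rewrite mulrA [W i * _]mulrC.
  have h1 := qm_sup H u i; rewrite -(ler_pM2r (qm_gt0 H v)) in h1.
  apply: le_trans h1 _; rewrite expr2 -!mulrA ler_wpM2l // mulrDl mulrDr lerD //.
    by have := qm_sup H (u ++ i) v; under eq_bigr do rewrite -catA; rewrite -catA.
  rewrite mulr_suml mulr_sumr; apply: ler_sum => a _.
  by have := qm_sup H (u ++ a :: i) v; under eq_bigr do rewrite -catA; rewrite -catA.
have h1 : X p q <= C ^+ 2 * X p q.+2.
  by rewrite expr2 -mulrA (le_trans (XS _ _)) // ler_wpM2l.
have h2 := XS p q.+1; have h3 := XS p.+1 q.
have CC : C <= C ^+ 2 by rewrite expr2 ler_peMl.
have CC1 : 1 <= C ^+ 2 by rewrite exprn_ege1.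
apply: le_trans E _.
have -> : 2 * C ^+ 4 = C ^+ 2 * (2 * C ^+ 2) by ring.
rewrite -mulrA ler_wpM2l ?exprn_ge0 //.
have := X0 p q.+2; have := X0 p.+1 q.+1; move: CC CC1 h1 h2 h3; nra.
Qed.

(** Each of the [M.+1] positions contributes at most [C ^+ 2 * W i * (Z p * Z (M - p))].
    Supermultiplicativity is used twice, to join the two totals and, since [Z n] is at least [C^-1],
    to pass from [Z M] to [Z (n + M)]. *)
Lemma sum_occ_le M : C^-1 <= Z n -> \sum_(w <- words (n + M)) W w * (occ i w)%:R <=
  (C ^+ 3 * (C * (1 + C ^+ 2)) ^+ 2) * (M.+1%:R * (W i * Z (n + M))).
Proof.
move=> Zn_ge; set K := C * (1 + C ^+ 2).
have K0 : 0 <= K by rewrite mulr_ge0 // addr_ge0 // exprn_ge0.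
have ZM : Z M <= C * K * Z (n + M).
  have := total_catS n M; rewrite -/K -mulrA => h; apply: le_trans (ler_wpM2l C0 h).
  rewrite mulrA ler_peMl ?total_ge0 //.
  rewrite -[X in X <= _](@mulfV _ C) ?ler_wpM2l // gt_eqF //; exact: lt_le_trans C1.
have E x : M.+1%:R * x = \sum_(p < M.+1) x by rewrite sumr_const card_ord mulr_natl.
rewrite sum_occ mulrCA E.
apply: ler_sum => p _; apply: le_trans (X_le _ _) _.
have := total_catS p (M - p); rewrite subnKC; last by rewrite -ltnS ltn_ord.
rewrite -/K => h.
have {}h : Z p * Z (M - p) <= K * (C * K * Z (n + M)) by rewrite (le_trans h) // ler_wpM2l.
have h2 : 0 <= C ^+ 2 * W i by rewrite mulr_ge0 ?exprn_ge0.
apply: le_trans (ler_wpM2l h2 h) _.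
by rewrite le_eqVlt; apply/orP; left; apply/eqP; ring.
Qed.

(** The two extra letters in [M.+2] are room for the bridges. The constant collects [C ^+ 3] from
    splitting [Z (n + M.+2)] around a block of total at most [C], [2 * C ^+ 4] from [X_ge], and 2
    from counting positions twice. *)
Lemma sum_occ_ge M : Z n.+2 <= C -> (M.+1)%:R * (W i * Z (n + M.+2)) <=
  4 * C ^+ 7 * \sum_(w <- words (n + M.+2)) W w * (occ i w)%:R.
Proof.
move=> Zn2_le; have Zsplit p : (p < M.+1)%N -> W i * Z (n + M.+2) <= C ^+ 3 * (W i * (Z p * Z (M - p))).
  move=> hp; have -> : (n + M.+2 = p + (n.+2 + (M - p)))%N by lia.
  have a : Z (n.+2 + (M - p)) <= C * (C * Z (M - p)).
    by rewrite (le_trans (total_cat _ _)) // ler_wpM2l // ler_wpM2r ?total_ge0.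
  rewrite [C ^+ 3 * _]mulrCA ler_wpM2l //; apply: le_trans (total_cat _ _) _.
  rewrite 2!exprS expr1 -!mulrA ler_wpM2l // [C * (C * (Z p * _))]mulrA [C * C * _]mulrCA.
  by rewrite -mulrA ler_wpM2l ?total_ge0.
have E x : M.+1%:R * x = \sum_(p < M.+1) x by rewrite sumr_const card_ord mulr_natl.
(* Both families of terms, at positions [p] and [p.+1], are parts of the sum in [sum_occ]; hence the
   factor 2. *)
rewrite {}E; have E : \sum_(p < M.+1) (X p (M - p).+2 + X p.+1 (M - p).+1) <=
   2 * \sum_(w <- words (n + M.+2)) W w * (occ i w)%:R.
  rewrite sum_occ (eq_bigr (fun p : 'I_M.+3 => X p (M.+2 - p))) // big_split mulr_natl mulr2n.
  apply: lerD.
    rewrite [X in _ <= X]big_ord_recr [X in _ <= X + _]big_ord_recr /= -addrA.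
    rewrite ler_wpDr ?addr_ge0 ?X0 //; apply: ler_sum => p _.
    by have -> : (M.+2 - p = (M - p).+2)%N by have := ltn_ord p; lia.
  rewrite [X in _ <= X]big_ord_recl [X in _ <= _ + X]big_ord_recr /= addrCA.
  rewrite ler_wpDr ?addr_ge0 ?X0 //; apply: ler_sum => p _; rewrite /bump /=.
  by have -> : (M.+2 - (1 + p) = (M - p).+1)%N by have := ltn_ord p; lia.
have C7 : 0 <= 2 * C ^+ 7 by rewrite mulr_ge0 ?exprn_ge0.
have -> : 4 * C ^+ 7 = 2 * C ^+ 7 * 2 by ring.
rewrite -mulrA; apply: le_trans (ler_wpM2l C7 E); rewrite [X in _ <= X]mulr_sumr; apply: ler_sum => p _.
apply: le_trans (Zsplit p (ltn_ord p)) _.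
apply: le_trans (ler_wpM2l (exprn_ge0 _ C0) (X_ge _ _)) _.
by rewrite le_eqVlt; apply/orP; left; apply/eqP; ring.
Qed.

End Fixed.
End Weights.

(** * Weights tilted by the number of occurrences of a word *)

Section Tilt.
Context {T : finType} {R : realType}.
Implicit Types (u v w i : seq T) (a W : seq T -> R) (C t : R).

Definition tilt a i t w : R := a w * expR (t * (occ i w)%:R).

Lemma expR_le_e (x : R) : `|x| <= 1 -> expR (- 1) <= expR x <= expR 1.
Proof. by rewrite !ler_expR ler_norml. Qed.

Lemma tilt_le a i t w (k : R) : 0 <= a w -> `|t * (occ i w)%:R + k| <= 1 ->
  expR (- 1) * (a w * expR (- k)) <= tilt a i t w <= expR 1 * (a w * expR (- k)).
Proof.
move=> aw /expR_le_e; rewrite expRD => /andP[h1 h2]; rewrite /tilt.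
have ek := expR_gt0 (- k).
have E : expR (t * (occ i w)%:R) * expR k * expR (- k) = expR (t * (occ i w)%:R).
  by rewrite -mulrA -expRD subrr expR0 mulr1.
rewrite -E ![_ * (a w * _)]mulrCA !ler_wpM2l // ler_pM2r //.
Qed.

(** In every clause the two sides have occurrence counts differing by at most [2 * size i + 6], so
    the exponential factors differ by at most [e], whatever [i] and [t] are. *)
Lemma tilt_qm a i t C : qm_weight C a -> `|t| * (2 * (size i)%:R + 6) <= 1 ->
  qm_weight (C * expR 1) (tilt a i t).
Proof.
move=> H ht; have C1 := qm_ge1 H; have C0 := le_trans ler01 C1.
have e1 : 1 <= expR 1 :> R by rewrite -[X in X <= _]expR0 ler_expR.
have tx x y : (`|x - y| <= (2 * size i + 6)%:R :> R) ->
    expR (t * x) <= expR 1 * expR (t * y).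
  move=> h; rewrite -expRD ler_expR -lerBlDr -mulrBr (le_trans (ler_norm _)) // normrM.
  by apply: le_trans ht; rewrite ler_wpM2l // (le_trans h) // natrD natrM.
have dn (x y : nat) : (x <= y + (2 * size i + 6))%N -> (y <= x + (2 * size i + 6))%N ->
   `|x%:R - y%:R| <= (2 * size i + 6)%:R :> R.
  by move=> h1 h2; rewrite ler_norml lerBrDr addrC lerBlDr lerBlDl -!natrD !ler_nat; apply/andP; split; lia.
have ae0 w : 0 <= a w := ltW (qm_gt0 H w).
split.
- by move=> w; rewrite mulr_gt0 ?expR_gt0 // (qm_gt0 H).
- by rewrite mulr_ege1.
- move=> u v; rewrite /tilt.
  have -> : C * expR 1 * (a u * expR (t * (occ i u)%:R) * (a v * expR (t * (occ i v)%:R))) =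
     C * (a u * a v) * (expR 1 * expR (t * (occ i u + occ i v)%:R)).
    by rewrite natrD mulrDr [expR (_ + _)]expRD; ring.
  rewrite ler_pM ?expR_ge0 ?(qm_sub H) // tx // dn //;
  have := occ_cat_le i u v; have := occ_cat_ge i u v; have := geq_minr (size u) (size i); lia.
- move=> u v; rewrite /tilt.
  have -> : a u * expR (t * (occ i u)%:R) * (a v * expR (t * (occ i v)%:R)) =
     (a u * a v) * expR (t * (occ i u + occ i v)%:R).
    by rewrite natrD mulrDr expRD; ring.
  apply: le_trans (ler_wpM2r (expR_ge0 _) (qm_sup H u v)) _.
  rewrite -!mulrA ler_wpM2l // mulrDl mulrDr lerD //.
    rewrite mulrCA ler_wpM2l // tx // dn //;
    have := occ_cat_le i u v; have := occ_cat_ge i u v; have := geq_minr (size u) (size i); lia.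
  rewrite mulr_suml mulr_sumr; apply: ler_sum => b _.
  rewrite mulrCA ler_wpM2l // tx // dn //.
    have := occ_cat_ge i u (b :: v); have := occ_cat_ge i [:: b] v; rewrite cat1s; lia.
  have := occ_cat_le i u (b :: v); have := geq_minr (size u) (size i).
  rewrite occ_cons; case: prefix; lia.
- move=> w; rewrite /tilt; apply: le_trans (ler_wpM2r (expR_ge0 _) (qm_pad H w)) _.
  rewrite -!mulrA ler_wpM2l // mulr_suml mulr_sumr; apply: ler_sum => b _.
  rewrite mulrCA ler_wpM2l // tx // dn // -cats1.
    have := occ_cat_ge i w [:: b]; lia.
  have := occ_cat_le i w [:: b]; have := geq_minr (size w) (size i).
  have := occ_le_size i [:: b]; rewrite /=; lia.
- apply: le_trans (ler_wpM2r (ltW (expR_gt0 1)) (qm_one H)).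
  rewrite mulr_suml; apply: ler_sum => b _; rewrite /tilt ler_wpM2l //.
  have := tx (occ i [:: b])%:R 0%:R; rewrite mulr0 expR0 mulr1; apply; apply: dn => //.
  have := occ_le_size i [:: b]; rewrite /=; lia.
Qed.

End Tilt.

(** * Comparison of an invariant measure with a quasi-multiplicative weight *)

Section AbstractGibbs.
Context {T : finType} {R : realType}.
Variables (a m : seq T -> R) (C : R).
Hypothesis Ha : qm_weight C a.
Hypothesis Za : forall k, C^-1 <= total a k <= C.
Hypothesis m_ge0 : forall w, 0 <= m w.
Hypothesis m_nil : m [::] = 1.
Hypothesis m_rcons : forall w, \sum_x m (rcons w x) = m w.
Hypothesis m_cons : forall w, \sum_x m (x :: w) = m w.
Hypothesis free_energy : forall k, 0 <= \sum_(w <- words k) m w * (ln (a w) - ln (m w)).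

Let C1 : 1 <= C := qm_ge1 Ha.
Let C0 : 0 < C := lt_le_trans ltr01 C1.

Lemma m_catl k w : \sum_(u <- words k) m (u ++ w) = m w.
Proof.
elim: k => [|k IH]; first by rewrite sum_words0.
by rewrite sum_words_cons -[RHS]IH; apply: eq_bigr => u _; exact: m_cons.
Qed.

Lemma m_catr k w : \sum_(u <- words k) m (w ++ u) = m w.
Proof.
elim: k => [|k IH]; first by rewrite sum_words0 cats0.
rewrite sum_words_rcons -[RHS]IH; apply: eq_bigr => u _.
by under eq_bigr do rewrite -rcons_cat; exact: m_rcons.
Qed.

Lemma m_total k : total m k = 1.
Proof. by have := m_catl k [::]; rewrite m_nil => <-; apply: eq_bigr => u _; rewrite cats0. Qed.

Lemma mean_occ i M : \sum_(w <- words (size i + M)) m w * (occ i w)%:R = M.+1%:R * m i.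
Proof.
rewrite sum_occ (eq_bigr (fun=> m i)); first by rewrite sumr_const card_ord mulr_natl.
move=> p _; under eq_bigr do under eq_bigr do rewrite catA.
by under eq_bigr do rewrite m_catr; rewrite m_catl.
Qed.

Lemma tilt_total_gt0 i t k : 0 < total (tilt a i t) k.
Proof.
set W := tilt a i t.
have W0 w : 0 < W w by rewrite mulr_gt0 ?(qm_gt0 Ha) ?expR_gt0.
have Z0 : 0 < total a k by case/andP: (Za k) => + _; apply: lt_le_trans; rewrite invr_gt0.
rewrite lt0r sumr_ge0 ?andbT => [|w _]; last exact: ltW.
apply/eqP => S0; have : total a k <= 0; last by rewrite leNgt Z0.
rewrite /total big_seq; apply: sumr_le0 => w hw.
have : W w <= total W k by rewrite /total (big_rem w) //= lerDl sumr_ge0 // => v _; exact: ltW.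
by rewrite S0 leNgt W0.
Qed.

(* The free energy of [m] tilted by [t occ] is at most the tilted pressure, and the
   latter is estimated by its derivative at [t]: two instances of Jensen's inequality. *)
Lemma mean_occ_tilt i t k :
  total (tilt a i t) k * (t * \sum_(w <- words k) m w * (occ i w)%:R) <=
  total (tilt a i t) k * ln C + t * \sum_(w <- words k) tilt a i t w * (occ i w)%:R.
Proof.
set W := tilt a i t; set S := total W k; set Z := total a k.
have W0 w : 0 < W w by rewrite mulr_gt0 ?(qm_gt0 Ha) ?expR_gt0.
have ZC : Z <= C by case/andP: (Za k).
have Z0 : 0 < Z by case/andP: (Za k) => + _; apply: lt_le_trans; rewrite invr_gt0.
have S0 : 0 < S := tilt_total_gt0 i t k.
have lnW w : ln (W w) = ln (a w) + t * (occ i w)%:R.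
  by rewrite lnM ?posrE ?expR_gt0 ?(qm_gt0 Ha) // expRK.
have A1 : t * (\sum_(w <- words k) m w * (occ i w)%:R) <= ln S.
  have : \sum_(w <- words k) m w * (ln (W w / S) - ln (m w)) <=
     \sum_(w <- words k) W w / S - \sum_(w <- words k) m w.
    by apply: gibbs_ineq => // w *; rewrite ?ltW // divr_gt0.
  rewrite -mulr_suml -/(total W k) -/S divff ?gt_eqF // -/(total m k) m_total subrr.
  have -> : \sum_(w <- words k) m w * (ln (W w / S) - ln (m w)) =
     \sum_(w <- words k) m w * (ln (a w) - ln (m w))
     + t * (\sum_(w <- words k) m w * (occ i w)%:R) - ln S.
    have -> : ln S = \sum_(w <- words k) m w * ln S.
      by rewrite -mulr_suml -/(total m k) m_total mul1r.
    rewrite mulr_sumr -big_split -sumrB.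
    apply: eq_bigr => w _; rewrite ln_div ?posrE // lnW /=; ring.
  have := free_energy k; lra.
have A2 : S * ln S <= S * ln C + t * \sum_(w <- words k) W w * (occ i w)%:R.
  have : \sum_(w <- words k) (W w / S) * (ln (a w / Z) - ln (W w / S)) <=
     \sum_(w <- words k) a w / Z - \sum_(w <- words k) W w / S.
    by apply: gibbs_ineq => // w *; rewrite ?divr_ge0 ?divr_gt0 ?(qm_gt0 Ha) // ltW ?(qm_gt0 Ha).
  rewrite -!mulr_suml -/(total W k) -/S divff ?gt_eqF // -/(total a k) -/Z divff ?gt_eqF // subrr.
  rewrite -(ler_pM2l S0) mulr0 [X in X <= _]mulr_sumr.
  have -> : \sum_(w <- words k) S * (W w / S * (ln (a w / Z) - ln (W w / S))) =
     S * (ln S - ln Z) - t * \sum_(w <- words k) W w * (occ i w)%:R.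
    rewrite {4}/S {1}/total mulr_suml mulr_sumr -sumrB; apply: eq_bigr => w _.
    rewrite !ln_div ?posrE ?(qm_gt0 Ha) // lnW; field; exact: lt0r_neq0.
  have : S * ln Z <= S * ln C by rewrite ler_pM2l // ler_ln ?posrE.
  lra.
by apply: le_trans A2; rewrite ler_pM2l.
Qed.

Lemma archi_le (x y c : R) : (forall M : nat, M.+1%:R * x <= c + M.+1%:R * y) -> x <= y.
Proof.
move=> h; rewrite leNgt; apply/negP => xy.
have d0 : 0 < x - y by rewrite subr_gt0.
have := h (Num.truncn (c / (x - y))).
have := truncnS_gt (c / (x - y)); rewrite ltr_pdivrMr //; lra.
Qed.

Let e : R := expR 1.
Let C' := C * e.

Lemma tilt_total_bounds i t k : (k <= (size i).+2)%N -> `|t| * (2 * (size i)%:R + 6) <= 1 ->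
  C'^-1 <= total (tilt a i t) k <= C'.
Proof.
move=> hk ht.
have B w : size w = k -> expR (- 1) * a w <= tilt a i t w <= e * a w.
  move=> hw; have := @tilt_le _ _ a i t w 0 (ltW (qm_gt0 Ha w)).
  rewrite oppr0 expR0 mulr1 addr0; apply; rewrite normrM.
  apply: le_trans ht; rewrite ler_wpM2l // ger0_norm ?ler0n //.
  by rewrite -natrM -natrD ler_nat; have := occ_le_size i w; lia.
case/andP: (Za k) => h1 h2; apply/andP; split.
  rewrite /C' invfM mulrC -expRN; apply: le_trans (ler_wpM2l (expR_ge0 _) h1) _.
  rewrite mulr_sumr /total big_seq [X in _ <= X]big_seq; apply: ler_sum => w /size_words /B /andP[] //.
rewrite /C' mulrC; apply: le_trans (ler_wpM2l (expR_ge0 _) h2).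
rewrite [X in _ <= X]mulr_sumr /total big_seq [X in _ <= X]big_seq.
by apply: ler_sum => w /size_words /B /andP[].
Qed.

Lemma tilt_self_bounds i t : `|t| * (2 * (size i)%:R + 6) <= 1 ->
  expR (- 1) * a i <= tilt a i t i <= e * a i.
Proof.
move=> ht; have := @tilt_le _ _ a i t i 0 (ltW (qm_gt0 Ha i)).
rewrite oppr0 expR0 mulr1 addr0; apply; rewrite normrM.
apply: le_trans ht; rewrite ler_wpM2l // ger0_norm ?ler0n //.
by rewrite -natrM -natrD ler_nat; have := occ_self i; lia.
Qed.

(** The largest tilt that [tilt_qm] allows. *)
Let t (i : seq T) : R := (2 * (size i)%:R + 6)^-1.
Let t0 i : 0 < t i.
Proof. by rewrite invr_gt0 ltr_wpDl // mulr_ge0. Qed.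
Let ht i : `|t i| * (2 * (size i)%:R + 6) <= 1.
Proof. by rewrite gtr0_norm // mulVf // gt_eqF // -invr_gt0; exact: t0. Qed.

(** With a positive tilt, the mean [M.+1 * m i] of the occurrences is at most the mean under the
    tilted weight plus [ln C / t], and [sum_occ_le] bounds the former mean by a multiple of
    [M.+1 * W i]. Growing [M] removes [ln C / t]. *)
Lemma gibbs_upper i : m i <= C' ^+ 3 * (C' * (1 + C' ^+ 2)) ^+ 2 * e * a i.
Proof.
have H := tilt_qm Ha (ht i); rewrite -/e -/C' in H.
set K := C' ^+ 3 * _; set W := tilt a i (t i).
have C'0 : 0 <= C' := le_trans ler01 (qm_ge1 H).
have K0 : 0 <= K by rewrite /K mulr_ge0 ?exprn_ge0 // mulr_ge0 // addr_ge0 ?exprn_ge0.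
have /andP[_ hi] := tilt_self_bounds (ht i).
rewrite -mulrA; apply: le_trans (ler_wpM2l K0 hi).
apply: (@archi_le _ _ (ln C / t i)) => M.
have S0 := tilt_total_gt0 i (t i) (size i + M).
have /andP[hn _] := tilt_total_bounds (leqW (leqnSn (size i))) (ht i).
have h1 := sum_occ_le H M hn.
have h2 := mean_occ_tilt i (t i) (size i + M).
rewrite mean_occ in h2; move: h2; rewrite -/W -/K in h1 *.
set S := total W _ in S0 h1 *; set q := \sum_(w <- _) _ in h1 *.
move=> h2; rewrite -(ler_pM2l S0) -(ler_pM2l (t0 i)).
have -> : t i * (S * (M.+1%:R * m i)) = S * (t i * (M.+1%:R * m i)) by ring.
apply: le_trans h2 _.
have -> : t i * (S * (ln C / t i + M.+1%:R * (K * W i))) =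
   S * ln C + t i * (K * (M.+1%:R * (W i * S))).
  by field; rewrite gt_eqF // t0.
by rewrite lerD2l ler_pM2l // t0.
Qed.

(** A negative tilt reverses the comparison of means, and [sum_occ_ge] bounds the mean under the
    tilted weight from below. *)
Lemma gibbs_lower i : a i <= e * (4 * C' ^+ 7) * m i.
Proof.
have htN : `|- t i| * (2 * (size i)%:R + 6) <= 1 by rewrite normrN ht.
have H := tilt_qm Ha htN; rewrite -/e -/C' in H.
set K := 4 * _; set W := tilt a i (- t i).
have C'0 : 0 <= C' := le_trans ler01 (qm_ge1 H).
have K0 : 0 <= K by rewrite /K mulr_ge0 ?exprn_ge0.
have /andP[hi _] := tilt_self_bounds htN.
rewrite -mulrA.
have {}hi : a i <= e * W i.
  by rewrite -(ler_pM2l (expR_gt0 (- 1))) mulrA -expRD addNr expR0 mul1r.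
apply: le_trans hi _; rewrite ler_pM2l ?expR_gt0 //.
(* The term [2 * m i] is the gap between the [M.+3] positions in [mean_occ] and the [M.+1] in
   [sum_occ_ge]. *)
apply: (@archi_le _ _ (K * (ln C / t i + 2 * m i))) => M.
have S0 := tilt_total_gt0 i (- t i) (size i + M.+2).
have /andP[_ hn] := tilt_total_bounds (leqnn _) htN.
have h1 := sum_occ_ge H M hn.
have h2 := mean_occ_tilt i (- t i) (size i + M.+2).
rewrite mean_occ in h2; move: h2; rewrite -/W -/K in h1 *.
set S := total W _ in S0 h1 *; set q := \sum_(w <- _) _ in h1 *.
move=> h2; rewrite -(ler_pM2l S0) -(ler_pM2l (t0 i)).
apply: (@le_trans _ _ (t i * (K * q))).
  by rewrite ler_pM2l ?t0 // (mulrCA S) (mulrC S).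
have -> : t i * (S * (K * (ln C / t i + 2 * m i) + M.+1%:R * (K * m i))) =
   K * (S * ln C + S * (t i * (M.+3%:R * m i))).
  by rewrite -(natr1 M.+2) -(natr1 M.+1); field; rewrite gt_eqF // t0.
by rewrite mulrCA ler_wpM2l //; move: h2; rewrite mulNr mulrN mulNr; lra.
Qed.

End AbstractGibbs.

(** * Cylinder measures and matrix products *)

Section Fekete.
Context {R : realType}.

Lemma cvg_mean (u : nat -> R) (l c : R) :
  (forall k, k%:R * l <= u k) ->
  (forall e, 0 < e -> exists c, forall k, u k <= k%:R * (l + e) + c) ->
  (fun k => k%:R^-1 * u k) @ \oo --> l.
Proof.
move=> hl hu; apply/cvgrPdist_le => e e0.
have [c0 hc] := hu _ (divr_gt0 e0 (ltr0Sn R 1)).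
near=> k.
have k0 : 0 < k%:R :> R by rewrite ltr0n; near: k; exact: nbhs_infty_gt.
have kc : c0 <= k%:R * (e / 2).
  rewrite -ler_pdivrMr ?divr_gt0 //.
  have : (Num.truncn (c0 / (e / 2)) < k)%N by near: k; exact: nbhs_infty_gt.
  move=> hk; apply/ltW/(lt_le_trans (truncnS_gt _)); by rewrite ler_nat.
have h1 := hl k; have h2 := hc k.
rewrite ler_distlC -(ler_pM2l k0) -[X in _ && X](ler_pM2l k0) mulrA divff ?gt_eqF // mul1r.
by apply/andP; split; nra.
Unshelve. all: by end_near. Qed.

(** The limit is the infimum of the averages. The resulting bound at every [k] is kept because the
    comparison with weights needs inequalities at finite length. *)
Lemma fekete (u : nat -> R) (K : R) : (forall p q, u (p + q)%N <= u p + u q) ->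
  (forall k, - K * k%:R <= u k) ->
  exists l : R, (fun k => k%:R^-1 * u k) @ \oo --> l /\ forall k, k%:R * l <= u k.
Proof.
move=> sub lb.
(* [u 0] may be nonzero, so the empty multiple needs its own term. *)
have umul p q : u (p * q)%N <= p%:R * u q + (p == 0%N)%:R * u 0%N.
  elim: p => [|p IH]; first by rewrite mul0n mul0r add0r mul1r.
  rewrite mulSn mul0r addr0; case: p IH => [|p] IH.
    by rewrite mul0n addn0 mul1r.
  rewrite (le_trans (sub _ _)) // -natr1 mulrDl mul1r addrC lerD2r.
  by rewrite (le_trans IH) // mul0r addr0.
have u0 : 0 <= u 0%N by have := sub 0%N 0%N; rewrite addn0; lra.
pose S := [set (u k.+1 / k.+1%:R) | k in [set: nat]].
have lbS : lbound S (- K).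
  by move=> _ [k _ <-]; rewrite ler_pdivlMr ?ltr0Sn.
have hS : has_inf S by split; [exists (u 1%N / 1), 0%N | exists (- K)].
exists (inf S).
have hle k : k%:R * inf S <= u k.
  case: k => [|k]; first by rewrite mul0r.
  rewrite mulrC -ler_pdivlMr ?ltr0Sn //; apply: ge_inf; first by exists (- K).
  by exists k.
split => //; apply: cvg_mean => // e e0.
have [_ [q _ <-] hq] := inf_adherent e0 hS.
pose c := \sum_(r < q.+1) `|u r| + `|u 0%N| + \sum_(r < q.+1) `|r%:R * (inf S + e)|.
exists c => k.
have kE := divn_eq k q.+1.
rewrite {1}kE; apply: le_trans (sub _ _) _.
apply: le_trans (lerD (umul _ _) (lexx _)) _.
have h1 : (k %/ q.+1)%N%:R * u q.+1 <= (k %/ q.+1 * q.+1)%N%:R * (inf S + e).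
  rewrite natrM -mulrA ler_wpM2l // mulrC -ler_pdivrMr ?ltr0Sn //; exact: ltW.
have rq : (k %% q.+1 < q.+1)%N by rewrite ltn_mod.
have h2 : u (k %% q.+1)%N <= \sum_(r < q.+1) `|u r|.
  rewrite (bigD1 (Ordinal rq)) //= (le_trans (ler_norm _)) // lerDl sumr_ge0 //.
have h3 : - ((k %% q.+1)%N%:R * (inf S + e)) <= \sum_(r < q.+1) `|r%:R * (inf S + e)|.
  rewrite (bigD1 (Ordinal rq)) //= (le_trans (ler_norm _)) // normrN lerDl sumr_ge0 //.
have h4 : ((k %/ q.+1)%N == 0%N)%:R * u 0%N <= `|u 0%N|.
  by case: eqP => _; rewrite ?mul1r ?mul0r ?ler_norm.
have hk : k%:R = (k %/ q.+1 * q.+1)%N%:R + (k %% q.+1)%N%:R :> R by rewrite -natrD -kE.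
rewrite hk mulrDl /c; lra.
Qed.

End Fekete.

Section WordsOfSequences.
Context {n : nat}.
Implicit Types (w : seq (Alph n)) (x : Seq n).

Definition wseq (k : nat) (w : word n k) : seq (Alph n) := [seq w j | j <- enum 'I_k].

Definition cylw w : set (Seq n) := [set x | mkseq x (size w) = w].

Lemma size_wseq k (w : word n k) : size (wseq w) = k.
Proof. by rewrite size_map size_enum_ord. Qed.

Lemma nth_wseq k (w : word n k) (j : 'I_k) a : nth a (wseq w) j = w j.
Proof. by rewrite (nth_map j) ?size_enum_ord // nth_ord_enum. Qed.

Lemma wseq_inj k : injective (@wseq k).
Proof. by move=> u v h; apply/ffunP => j; rewrite -(nth_wseq u j ord0) h nth_wseq. Qed.

Lemma wseq_trunc x k : wseq (trunc x k) = mkseq x k.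
Proof.
apply: (@eq_from_nth _ ord0) => [|j]; first by rewrite size_wseq size_mkseq.
rewrite size_wseq => hj; rewrite nth_mkseq //.
by rewrite -[j]/(val (Ordinal hj)) nth_wseq ffunE.
Qed.

Lemma cyl_wseq k (w : word n k) : cyl w = cylw (wseq w).
Proof.
apply/seteqP; split => x; rewrite /cyl /cylw /= size_wseq.
  move=> h; apply: (@eq_from_nth _ ord0) => [|j]; first by rewrite size_wseq size_mkseq.
  rewrite size_mkseq => hj; rewrite nth_mkseq //.
  by rewrite -[j]/(val (Ordinal hj)) nth_wseq h.
by move=> h j; rewrite -(nth_wseq w j ord0) -h nth_mkseq.
Qed.

Lemma wseq_surj w : exists u : word n (size w), wseq u = w.
Proof.
exists [ffun j : 'I__ => nth ord0 w j]; apply: (@eq_from_nth _ ord0) => [|j].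
  by rewrite size_wseq.
rewrite size_wseq => hj; rewrite -[j]/(val (Ordinal hj)).
by rewrite nth_wseq ffunE.
Qed.

Lemma sum_word {R : realType} k (F : seq (Alph n) -> R) :
  \sum_(w : word n k) F (wseq w) = \sum_(w <- words k) F w.
Proof.
rewrite -(big_map (@wseq k) predT F); apply: perm_big; apply: uniq_perm.
- by rewrite map_inj_uniq ?index_enum_uniq //; exact: wseq_inj.
- elim: k => //= k IH; apply: allpairs_uniq => //; first exact: index_enum_uniq.
  by move=> [a u] [b v] _ _ [-> ->].
move=> w; rewrite mem_words; apply/mapP/eqP => [[u _ ->]|<-]; first exact: size_wseq.
by have [u hu] := wseq_surj w; exists u; rewrite ?mem_index_enum.
Qed.

Definition fillw w : Seq n := fun j => nth ord0 w j.

Lemma mkseq_fillw w v : mkseq (fillw (w ++ v)) (size w) = w.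
Proof.
apply: (@eq_from_nth _ ord0) => [|j]; first by rewrite size_mkseq.
by rewrite size_mkseq => hj; rewrite nth_mkseq // /fillw nth_cat hj.
Qed.

Lemma cylw_fill w : cylw w (fillw w).
Proof. by rewrite /cylw /= -{1}[w]cats0 mkseq_fillw. Qed.

Lemma cylw_cat u v x : cylw (u ++ v) x <-> cylw u x /\ cylw v (fun j => x (size u + j)%N).
Proof.
rewrite /cylw /= size_cat /mkseq iotaD map_cat add0n -(addn0 (size u)) iotaDl -map_comp addn0.
split => [/eqP|[-> ->] //]; rewrite eqseq_cat ?size_map ?size_iota // => /andP[/eqP -> /eqP ->] //.
Qed.

Lemma iter_shift x p : iter p Defs.shift x = fun j => x (p + j)%N.
Proof.
elim: p => [|p IH]; first by apply: funext => j; rewrite add0n.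
by rewrite iterS IH; apply: funext => j; rewrite /Defs.shift addnS.
Qed.

Lemma mkseq_shift x p q : mkseq x (p + q) = mkseq x p ++ mkseq (iter p Defs.shift x) q.
Proof.
rewrite iter_shift /mkseq iotaD map_cat add0n; congr (_ ++ _).
by rewrite -{1}(addn0 p) iotaDl -map_comp.
Qed.

End WordsOfSequences.

Section CylinderMeasure.
Context {R : realType} {n : nat}.
Variable mu : probability (SigmaM n) R.
Implicit Types (w : seq (Alph n)).

Definition mw w : R := fine (mu (cylw w)).

Lemma measurable_cylw w : measurable (cylw w : set (SigmaM n)).
Proof.
have [u hu] := wseq_surj w; rewrite -hu -cyl_wseq.
by apply: sub_sigma_algebra; exists (size w), u.
Qed.

Lemma mwE w : (mw w)%:E = mu (cylw w).
Proof. by rewrite /mw fineK // fin_num_measure //; exact: measurable_cylw. Qed.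

Lemma mw_ge0 w : 0 <= mw w.
Proof. exact/fine_ge0/measure_ge0. Qed.

Lemma mw_nil : mw [::] = 1.
Proof.
have -> : mw [::] = fine (mu setT) by congr (fine (mu _)); apply/seteqP; split.
by rewrite probability_setT.
Qed.

Lemma in_bigsetU (I : finType) (F : I -> set (Seq n)) :
  \big[setU/set0]_i F i = [set x | exists i, F i x].
Proof.
rewrite -bigcup_seq; apply/seteqP; split => [x [i _ Fi]|x [i Fi]]; exists i => //=.
exact: mem_index_enum.
Qed.

Lemma mw_disjoint (E : set (Seq n)) (F : Alph n -> seq (Alph n)) :
  E = [set x | exists a, cylw (F a) x] ->
  (forall x a b, cylw (F a) x -> cylw (F b) x -> a = b) ->
  (\sum_a mw (F a))%:E = mu E.
Proof.
move=> -> dis; rewrite -in_bigsetU measure_bigsetU_ord.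
- rewrite -sumEFin; apply: eq_bigr => a _; exact: mwE.
- by move=> a; exact: measurable_cylw.
- by apply/trivIsetP => a b _ _ /eqP ab; apply/seteqP; split => x // [/= h1 h2];
   apply: ab; exact: dis h1 h2.
Qed.

Lemma mw_rcons w : \sum_a mw (rcons w a) = mw w.
Proof.
apply: EFin_inj; rewrite mwE; apply: mw_disjoint => [|x a b].
  apply/seteqP; split => x /=.
    move=> h; exists (x (size w)); rewrite -cats1; apply/cylw_cat; split => //.
    by rewrite /cylw /= /mkseq /= addn0.
  by move=> [a]; rewrite -cats1 => /cylw_cat[].
by rewrite -!cats1 => /cylw_cat[_ h1] /cylw_cat[_ h2]; case: h1; case: h2 => <- <-.
Qed.

Hypothesis mu_inv : shift_invariant mu.

Lemma mw_cons w : \sum_a mw (a :: w) = mw w.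
Proof.
apply: EFin_inj; rewrite mwE -mu_inv; last exact: measurable_cylw.
apply: mw_disjoint => [|x a b].
  apply/seteqP; split => x /=.
    by move=> h; exists (x 0%N); rewrite -cat1s; apply/cylw_cat.
  by move=> [a]; rewrite -cat1s => /cylw_cat[].
by rewrite -(cat1s a w) -(cat1s b w) => /cylw_cat[h1 _] /cylw_cat[h2 _]; case: h1; case: h2 => <- <-.
Qed.

Lemma integral_cyl k (g : seq (Alph n) -> R) :
  fine (\int[mu]_x (g (mkseq x k))%:E) = \sum_(w <- words k) mw w * g w.
Proof.
have E x : (g (mkseq x k))%:E =
    (\sum_(w <- words k) (g w)%:E * (\1_(cylw w) x)%:E)%E.
  rewrite (eq_bigr (fun w => (g w * \1_(cylw w) x)%:E)) // sumEFin; congr (_%:E).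
  have hx : mkseq x k \in words k by rewrite mem_words size_mkseq.
  have U : uniq (words (T := Alph n) k).
    elim: {hx} k => //= k IH; apply: allpairs_uniq => //; first exact: index_enum_uniq.
    by move=> [a u] [b v] _ _ [-> ->].
  rewrite (bigD1_seq _ hx U) /= big1_seq ?addr0 => [|w /andP[wx /size_words wk]].
    by rewrite indicE mem_set ?mulr1 // /cylw /= size_mkseq.
  rewrite indicE memNset ?mulr0 // /cylw /= wk => h; by rewrite h eqxx in wx.
under eq_integral do rewrite E.
have mi w : mu.-integrable setT (fun x => (\1_(cylw w) x)%:E : \bar R).
  by apply: integrable_indic; exact: measurable_cylw.
rewrite integral_sum // => [|w]; last exact: integrableZl.
have -> : (\sum_(w <- words k) \int[mu]_x ((g w)%:E * (\1_(cylw w) x)%:E) =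
   (\sum_(w <- words k) mw w * g w)%:E)%E.
  rewrite -sumEFin; apply: eq_bigr => w _; rewrite integralZl // integral_indic //.
    by rewrite setIT EFinM mwE muleC.
  exact: measurable_cylw.
by [].
Qed.

End CylinderMeasure.

(** * Norms of matrix products *)

Section Products.
Context {R : realType} {n : nat}.
Variable A : Alph n -> 'M[R]_2.
Hypothesis hA : forall i, A i \in unitmx.
Implicit Types (u v w : seq (Alph n)).

Definition pw w : 'M[R]_2 := \prod_(a <- w) A a.
Definition nw w : R := opnorm (pw w).

Lemma prodw_pw k (w : word n k) : prodw A w = pw (wseq w).
Proof. by rewrite /prodw /pw /wseq big_map enumT [index_enum _]unlock. Qed.

Lemma pw_nil : pw [::] = 1%:M. Proof. exact: big_nil. Qed.

Lemma pw_cons a w : pw (a :: w) = A a *m pw w. Proof. exact: big_cons. Qed.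

Lemma pw_cat u v : pw (u ++ v) = pw u *m pw v. Proof. exact: big_cat. Qed.

Lemma pw_seq1 a : pw [:: a] = A a. Proof. exact: big_seq1. Qed.

Lemma pw_unit w : pw w \in unitmx.
Proof.
by elim: w => [|a w IH]; rewrite ?pw_nil ?unitmx1 // pw_cons unitmx_mul hA.
Qed.

Lemma nw_gt0 w : 0 < nw w. Proof. exact/opnorm_gt0/pw_unit. Qed.

Lemma nw_cat u v : nw (u ++ v) <= nw u * nw v.
Proof. by rewrite /nw pw_cat opnormM. Qed.

Lemma nw_nil : nw [::] = 1. Proof. by rewrite /nw pw_nil opnorm1. Qed.

Lemma nw_rcons_ge : exists2 c, 1 <= c & forall w a, nw w <= c * nw (rcons w a).
Proof.
exists (1 + \sum_a opnorm (invmx (A a))).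
  by rewrite lerDl sumr_ge0 // => a _; exact: opnorm_ge0.
move=> w a; rewrite mulrDl mul1r.
apply: (@le_trans _ _ (opnorm (invmx (A a)) * nw (rcons w a))).
  rewrite mulrC -{1}[nw w]/(opnorm (pw w)) -cats1 /nw pw_cat pw_seq1 -{1}(mulmxK (hA a) (pw w)).
  exact: opnormM.
rewrite -[X in X <= _]add0r lerD ?(ltW (nw_gt0 _)) // ler_wpM2r ?(ltW (nw_gt0 _)) //.
by rewrite (bigD1 a) //= lerDl sumr_ge0 // => b _; exact: opnorm_ge0.
Qed.

Lemma letter_bounds : exists2 K, 0 <= K & forall w, `|ln (nw w)| <= K * (size w)%:R.
Proof.
exists (\sum_a (`|ln (opnorm (A a))| + `|ln (opnorm (invmx (A a)))|)).
  by apply: sumr_ge0 => a _; rewrite addr_ge0.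
elim=> [|a w IH]; first by rewrite nw_nil ln1 normr0 mulr0.
have [K hK] : exists K, \sum_a (`|ln (opnorm (A a))| + `|ln (opnorm (invmx (A a)))|) = K by exists (\sum_a (`|ln (opnorm (A a))| + `|ln (opnorm (invmx (A a)))|)).
rewrite hK in IH *.
have Ka : `|ln (opnorm (A a))| + `|ln (opnorm (invmx (A a)))| <= K.
  by rewrite -hK (bigD1 a) //= lerDl sumr_ge0 // => b _; rewrite addr_ge0.
have p1 : 0 < opnorm (A a) := opnorm_gt0 (hA a).
have p2 : 0 < opnorm (invmx (A a)) by apply: opnorm_gt0; rewrite unitmx_inv hA.
have h1 : ln (nw (a :: w)) <= ln (opnorm (A a)) + ln (nw w).
  rewrite -lnM ?posrE ?p1 ?p2 ?nw_gt0 // ler_ln ?posrE ?mulr_gt0 ?p1 ?p2 ?nw_gt0 //.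
  by rewrite /nw pw_cons opnormM.
have h2 : ln (nw w) <= ln (opnorm (invmx (A a))) + ln (nw (a :: w)).
  rewrite -lnM ?posrE ?p1 ?p2 ?nw_gt0 // ler_ln ?posrE ?mulr_gt0 ?p1 ?p2 ?nw_gt0 //.
  by rewrite {1}/nw -{1}(mulKmx (hA a) (pw w)) -pw_cons opnormM.
suff : `|ln (nw (a :: w))| <= K * (size w)%:R + K.
  by rewrite -[X in _ + X]mulr1 -mulrDr natr1.
move: IH; rewrite !ler_norml => /andP[i1 i2].
have := ler_norm (ln (opnorm (A a))); have := ler_norm (ln (opnorm (invmx (A a)))).
have := normr_ge0 (ln (opnorm (A a))); have := normr_ge0 (ln (opnorm (invmx (A a)))).
move: Ka h1 h2 i1 i2; clear; move: (K * _) (ln (nw (a :: w))) (ln (nw w)).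
move: (ln (opnorm (A a))) (ln (opnorm (invmx (A a)))) => x y z t r *; apply/andP; split; lra.
Qed.

(* [sum_a |e_t ^ A_a e_t|] vanishes exactly on invariant lines, so it is bounded
   below by irreducibility and compactness. *)
Lemma wedge_orbit_gt0 : irreducible A ->
  exists2 c, 0 < c & forall v : 'cV[R]_2, c * enorm v ^+ 2 <= \sum_a `|wedge v (A a *m v)|.
Proof.
move=> hirr.
pose g (t : R) := \sum_a `|wedge (dir t) (A a *m dir t)|.
have cg : continuous g.
  move=> t; rewrite /g.
  have -> : (fun t : R => \sum_a `|wedge (dir t) (A a *m dir t)|) =
    (fun t : R => \sum_a `|cos t * (A a 1 0 * cos t + A a 1 1 * sin t) -
                     sin t * (A a 0 0 * cos t + A a 0 1 * sin t)|).
    by apply: funext => s; apply: eq_bigr => a _; rewrite /wedge !mulmx2v !mxE.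
  apply: cvg_big => [|a _]; first exact: add_continuous.
  apply: cvg_norm; apply: cvgB; apply: cvgM; try exact: continuous_cos; try exact: continuous_sin;
  by apply: cvgD; apply: cvgM; [exact: cvg_cst|exact: continuous_cos|exact: cvg_cst|exact: continuous_sin].
have [t0 t0I ht0] : exists2 c, c \in `[- pi, pi : R] & forall t, t \in `[- pi, pi : R] -> g c <= g t.
  apply: EVT_min; last exact/continuous_subspaceT.
  by have := pi_ge0 R; lra.
have g0 : 0 < g t0.
  rewrite lt0r sumr_ge0 ?andbT //; apply/negP => /eqP g0.
  apply: (hirr (dir t0) (dir_neq0 t0)) => a; apply: wedge_eq0_scale (dir_neq0 t0) _.
  apply/eqP; rewrite -normr_eq0; apply/eqP.
  by apply: (psumr_eq0P _ g0).
exists (g t0) => // v; have [t tI ->] := polar v.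
rewrite enormZ enorm_dir mulr1 ger0_norm ?enorm_ge0 //.
have -> : \sum_a `|wedge (enorm v *: dir t) (A a *m (enorm v *: dir t))| = g t * enorm v ^+ 2.
  rewrite mulr_suml; apply: eq_bigr => a _; rewrite -scalemxAr wedgeZl wedgeZr !normrM.
  by rewrite ger0_norm ?enorm_ge0 //; ring.
by rewrite ler_wpM2r ?sqr_ge0 // ht0.
Qed.

Lemma opnorm_basis (P : 'M[R]_2) (q : 'cV[R]_2) :
  opnorm P * enorm q <= enorm (P *m q) + enorm (P *m vperp q).
Proof.
case: (eqVneq q 0) => [->|q0]; first by rewrite enorm0 mulr0 addr_ge0 ?enorm_ge0.
have n0 : 0 < enorm q by rewrite enorm_gt0.
rewrite -ler_pdivlMr //; apply: opnorm_le => z.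
rewrite mulrAC ler_pdivlMr //.
rewrite -(ler_pM2l n0).
have -> : enorm q * (enorm (P *m z) * enorm q) = enorm (P *m (enorm q ^+ 2 *: z)).
  by rewrite -scalemxAr enormZ ger0_norm ?sqr_ge0 //; ring.
rewrite frame mulmxDr -!scalemxAr (le_trans (enormD _ _)) // !enormZ.
have h1 := ler_wpM2r (enorm_ge0 (P *m q)) (inner_le q z).
have h2 := ler_wpM2r (enorm_ge0 (P *m vperp q)) (wedge_le q z).
move: h1 h2; lra.
Qed.

(** The vector [q] is an image under [pw v] of length at least half the norm. If [pw u] expands [q]
    well, the empty bridge suffices; otherwise it must expand [vperp q], and by irreducibility some
    letter gives [A a *m q] a definite component along [vperp q]. *)
Lemma nw_sup : irreducible A -> exists2 C, 1 <= C & forall u v,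
  nw u * nw v <= C * (nw (u ++ v) + \sum_a nw (u ++ a :: v)).
Proof.
move=> /wedge_orbit_gt0[c c0 hc].
pose K := \sum_a opnorm (A a).
have K0 : 0 <= K by apply: sumr_ge0 => a _; exact: opnorm_ge0.
pose D := 2 * (1 + (K + c)) / c.
have D0 : 0 <= D by rewrite /D divr_ge0 ?mulr_ge0 ?addr_ge0 // ltW.
exists (1 + D); first by rewrite lerDl.
move=> u v; have [x [x1 hx]] := opnorm_col_half (pw v).
set q := pw v *m x in hx; set P := pw u.
have q0 : 0 < enorm q.
  have := nw_gt0 v; rewrite /nw; lra.
have key a : `|wedge q (A a *m q)| * enorm (P *m vperp q) <=
   enorm q ^+ 2 * (enorm (P *m (A a *m q)) + opnorm (A a) * enorm (P *m q)).
  have -> : `|wedge q (A a *m q)| * enorm (P *m vperp q) =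
     enorm (enorm q ^+ 2 *: (P *m (A a *m q)) - inner q (A a *m q) *: (P *m q)).
    by rewrite scalemxAr frame mulmxDr -!scalemxAr addrAC subrr add0r enormZ.
  rewrite (le_trans (enormD _ _)) // enormN !enormZ mulrDr ger0_norm ?sqr_ge0 // lerD2l.
  have := inner_le q (A a *m q) => /le_trans h.
  rewrite mulrA ler_wpM2r ?enorm_ge0 // h // expr2 -mulrA ler_wpM2l ?enorm_ge0 //.
  by rewrite mulrC enorm_mul.
have hs : c * enorm (P *m vperp q) <= \sum_a enorm (P *m (A a *m q)) + K * enorm (P *m q).
  rewrite -(ler_pM2l (exprn_gt0 2 q0)) mulrA [_ * c]mulrC.
  apply: le_trans (ler_wpM2r (enorm_ge0 _) (hc q)) _.
  rewrite mulr_suml /K mulr_suml -big_split mulr_sumr; apply: ler_sum => a _; exact: key.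
have hP : c * (nw u * enorm q) <= \sum_a enorm (P *m (A a *m q)) + (K + c) * enorm (P *m q).
  apply: (@le_trans _ _ (c * (enorm (P *m q) + enorm (P *m vperp q)))).
    by rewrite ler_pM2l // opnorm_basis.
  rewrite mulrDr mulrDl; move: hs; lra.
have hS : \sum_a enorm (P *m (A a *m q)) <= \sum_a nw (u ++ a :: v).
  apply: ler_sum => a _; rewrite /nw pw_cat pw_cons /q -/P !mulmxA.
  by apply: le_trans (enorm_mul _ _) _; rewrite x1 mulr1.
have hPq : enorm (P *m q) <= nw (u ++ v).
  rewrite /nw pw_cat /q -/P mulmxA.
  by apply: le_trans (enorm_mul _ _) _; rewrite x1 mulr1.
have S0 : 0 <= \sum_a nw (u ++ a :: v) by apply: sumr_ge0 => a _; exact/ltW/nw_gt0.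
set S := \sum_a nw _ in hS S0 *; set T := \sum_a enorm _ in hP hS.
have N0 := ltW (nw_gt0 (u ++ v)).
apply: (@le_trans _ _ (D * (nw (u ++ v) + S))); last by rewrite ler_wpM2r ?addr_ge0 // lerDr.
rewrite -(ler_pM2l c0).
have -> : c * (D * (nw (u ++ v) + S)) = 2 * ((1 + (K + c)) * (nw (u ++ v) + S)).
  by rewrite /D; field; exact: lt0r_neq0.
apply: (@le_trans _ _ (2 * (c * (nw u * enorm q)))).
  by rewrite [X in _ <= X]mulrCA ler_pM2l // [X in _ <= X]mulrCA ler_wpM2l // ltW // nw_gt0.
rewrite ler_pM2l //; apply: le_trans hP _.
have := ler_wpM2l (addr_ge0 K0 (ltW c0)) hPq; have := mulr_ge0 (addr_ge0 K0 (ltW c0)) S0.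
move: N0 hS; lra.
Qed.

End Products.

Lemma sum_ge_elt {R : realType} {I : eqType} (r : seq I) (F : I -> R) i :
  (forall j, 0 <= F j) -> i \in r -> F i <= \sum_(j <- r) F j.
Proof. by move=> F0 ir; rewrite (big_rem i) //= lerDl sumr_ge0. Qed.

(** * Pressure and equilibrium states *)

Section Pressure.
Context {R : realType} {n : nat}.
Variables (A : Alph n -> 'M[R]_2) (s : R).
Hypothesis hA : forall i, A i \in unitmx.
Hypothesis hirr : irreducible A.
Hypothesis hs : 0 < s.
Implicit Types (u v w : seq (Alph n)).

Notation nw := (nw A).
Let npos w : 0 < nw w := nw_gt0 hA w.

Definition w0 w : R := expR (s * ln (nw w)).

Lemma w0E w : w0 w = expR (s * ln (nw w)). Proof. by []. Qed.

#[local] Opaque expR ln w0.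

Lemma phisE k (x : Seq n) : phis A s k x = s * ln (nw (mkseq x k)).
Proof. by rewrite /phis ln_powR prodw_pw wseq_trunc. Qed.

Lemma sup_cyl_const k (w : word n k) (f : Seq n -> R) c :
  (forall x, cyl w x -> f x = c) -> sup [set f x | x in cyl w] = c.
Proof.
move=> h; rewrite (_ : [set f x | x in cyl w] = [set c]) ?sup1 //.
apply/seteqP; split => [_ [x hx <-]|_ ->] /=; first exact: h.
exists (fillw (wseq w)); last by apply: h; rewrite cyl_wseq; exact: cylw_fill.
by rewrite cyl_wseq; exact: cylw_fill.
Qed.

Lemma pressure_phisE : pressure (phis A s) = limn (fun k : nat => k%:R^-1 * ln (total w0 k)).
Proof.
rewrite /pressure; congr (limn _); apply: funext => k; congr (_ * ln _).
rewrite /total -sum_word; apply: eq_bigr => w _; rewrite !w0E; congr expR.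
apply: sup_cyl_const => x; rewrite phisE cyl_wseq /cylw /= size_wseq => -> //.
Qed.

Lemma w0_le c u v : 0 < c -> nw u <= c * nw v -> w0 u <= expR (s * ln c) * w0 v.
Proof.
move=> c0 h; rewrite !w0E -expRD ler_expR -mulrDr ler_pM2l //.
by rewrite -lnM ?posrE // ler_ln ?posrE // mulr_gt0.
Qed.

(** Powers are not additive, so the sum in [nw_sup] is replaced by one large term before raising to
    the power [s]. There are [n.+3] terms: the [n.+2] bridging letters and the empty bridge. *)
Lemma w0_qm : exists C, qm_weight C w0.
Proof.
have [c c1 hc] := nw_rcons_ge hA.
have [K K1 hK] := nw_sup hA hirr.
pose N : R := (n.+3)%:R.
have N0 : 0 < N by rewrite ltr0n.
pose C := 1 + expR (s * ln c) + expR (s * ln (K * N)) + \sum_a w0 [:: a].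
have W0 w : 0 <= w0 w := expR_ge0 _.
have S0 : 0 <= \sum_a w0 [:: a] by apply: sumr_ge0.
have e1 := expR_ge0 (s * ln c); have e2 := expR_ge0 (s * ln (K * N)).
have C0 : 0 <= C by rewrite /C; lra.
exists C; split.
- by move=> w; exact: expR_gt0.
- by rewrite /C; lra.
- move=> u v; apply: (@le_trans _ _ (w0 u * w0 v)).
    rewrite !w0E -expRD ler_expR -mulrDr ler_pM2l // -lnM ?posrE //.
    by rewrite ler_ln ?posrE ?mulr_gt0 // nw_cat.
  by rewrite ler_peMl ?mulr_ge0 // /C; lra.
- move=> u v.
  have key x : nw u * nw v <= (K * N) * nw x -> w0 u * w0 v <= C * w0 x.
    move=> h; apply: (@le_trans _ _ (expR (s * ln (K * N)) * w0 x)).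
      have K0 : 0 < K := lt_le_trans ltr01 K1.
      rewrite !w0E -!expRD ler_expR -!mulrDr ler_pM2l //.
      by rewrite -!lnM ?posrE ?mulr_gt0 // ler_ln ?posrE ?mulr_gt0 // !mulr_gt0.
    by rewrite ler_wpM2r // /C; lra.
  case: (lerP (nw u * nw v) ((K * N) * nw (u ++ v))) => [h|h].
    have h1 : w0 (u ++ v) <= w0 (u ++ v) + \sum_a w0 (u ++ a :: v) by rewrite lerDl sumr_ge0.
    exact: le_trans (key _ h) (ler_wpM2l C0 h1).
  have [a ha] : exists a, nw u * nw v <= (K * N) * nw (u ++ a :: v).
    apply: contrapT => hn.
    have := hK u v; rewrite leNgt => /negP; apply.
    have K0 : 0 < K := lt_le_trans ltr01 K1.
    have t0 : 0 < nw u * nw v / (K * N) by rewrite divr_gt0 ?mulr_gt0.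
    apply: (@lt_le_trans _ _ (K * (N * (nw u * nw v / (K * N))))); last first.
      by rewrite le_eqVlt; apply/orP; left; apply/eqP; field; rewrite !gt_eqF.
    rewrite ltr_pM2l // {1}/N -(natr1 n.+2) mulrDl mul1r addrC ler_ltD //; last by rewrite ltr_pdivlMr ?mulr_gt0 // mulrC.
    have -> : n.+2%:R * (nw u * nw v / (K * N)) = \sum_(a : Alph n) (nw u * nw v / (K * N)).
      by rewrite sumr_const card_ord mulr_natl.
    apply: ler_sum => a _.
    rewrite ler_pdivlMr ?mulr_gt0 // mulrC; case: (lerP (nw u * nw v) ((K * N) * nw (u ++ a :: v))) => [h'|/ltW //].
    by case: hn; exists a.
  have h1 : w0 (u ++ a :: v) <= w0 (u ++ v) + \sum_a w0 (u ++ a :: v).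
    have h2 : w0 (u ++ a :: v) <= \sum_a w0 (u ++ a :: v).
      by apply: (@sum_ge_elt _ _ _ (fun a => w0 (u ++ a :: v))); [move=> ?; exact: W0|exact: mem_index_enum].
    by apply: le_trans h2 _; rewrite lerDr; exact: W0.
  exact: le_trans (key _ ha) (ler_wpM2l C0 h1).
- move=> w; have c0 : 0 < c := lt_le_trans ltr01 c1.
  apply: le_trans (w0_le c0 (hc w ord0)) _.
  apply: ler_pM; [exact: expR_ge0|exact: W0|by rewrite /C; lra|].
  apply: (@sum_ge_elt _ _ _ (fun a => w0 (rcons w a))); last exact: mem_index_enum.
  by move=> ?; exact: W0.
- by rewrite /C; lra.
Qed.

Lemma w0_sub u v : w0 (u ++ v) <= w0 u * w0 v.
Proof.
rewrite !w0E -expRD ler_expR -mulrDr ler_pM2l // -lnM ?posrE //.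
by rewrite ler_ln ?posrE ?mulr_gt0 // nw_cat.
Qed.

Lemma total_w0_gt0 k : 0 < total w0 k.
Proof.
apply: lt_le_trans (expR_gt0 (s * ln (nw (nseq k ord0)))) _.
apply: (@sum_ge_elt _ _ (words k) w0) => [w|]; first exact: expR_ge0.
by rewrite mem_words size_nseq.
Qed.

(* [Z_k = sum_w |A_w|^s] is submultiplicative and, by quasi-multiplicativity,
   supermultiplicative up to a constant; hence [exp(kP) <= Z_k <= C exp(kP)]. *)
Lemma total_w0_bounds : exists P c, [/\ pressure (phis A s) = P,
   (fun k : nat => k%:R^-1 * ln (total w0 k)) @ \oo --> P &
   forall k, k%:R * P <= ln (total w0 k) <= k%:R * P + c].
Proof.
have [K K0 hK] := letter_bounds hA.
have Z0 := total_w0_gt0.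
have sub p q : ln (total w0 (p + q)) <= ln (total w0 p) + ln (total w0 q).
  rewrite -lnM ?posrE // ler_ln ?posrE ?mulr_gt0 //.
  rewrite /total sum_words_cat mulr_suml; apply: ler_sum => u _.
  by rewrite mulr_sumr; apply: ler_sum => v _; exact: w0_sub.
have lb k : - (s * K) * k%:R <= ln (total w0 k).
  rewrite -[X in X <= _]expRK ler_ln ?posrE ?expR_gt0 //.
  apply: (@le_trans _ _ (w0 (nseq k ord0))); last first.
    apply: (@sum_ge_elt _ _ (words k) w0) => [w|]; first exact: expR_ge0.
    by rewrite mem_words size_nseq.
  rewrite !w0E ler_expR mulNr -mulrA -mulrN ler_pM2l //.
  by have := hK (nseq k ord0); rewrite ler_norml size_nseq => /andP[].
have [P [cP hP]] := fekete sub lb.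
have [C HC] := w0_qm.
have C0 : 0 < C := lt_le_trans ltr01 (qm_ge1 HC).
pose D := C * (1 + C ^+ 2).
have D0 : 0 < D by rewrite /D mulr_gt0 // ltr_wpDr ?exprn_ge0 // ltW.
have D1 : 1 <= D.
  by rewrite /D mulr_ege1 ?(qm_ge1 HC) // lerDl exprn_ge0 // ltW.
have sup p q : ln (total w0 p) + ln (total w0 q) <= ln D + ln (total w0 (p + q)).
  have h : total w0 p * total w0 q <= D * total w0 (p + q) := total_catS HC p q.
  by rewrite -!lnM ?posrE // ler_ln // posrE mulr_gt0.
(* [ln Z - ln D] is superadditive; only multiples of one length are needed. *)
have mul k q : q.+1%:R * (ln (total w0 k) - ln D) <= ln (total w0 (q.+1 * k)) - ln D.
  elim: q => [|q IH]; first by rewrite mul1r mul1n.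
  have := sup k (q.+1 * k)%N; rewrite -mulSn -(natr1 q.+1) mulrDl mul1r; lra.
exists P, (ln D); split => //.
  by rewrite pressure_phisE; exact: (cvg_lim _ cP).
move=> k; rewrite hP /=; apply/ler_addgt0Pr => e e0.
case: k => [|k].
  rewrite mul0r add0r /total sum_words0 w0E nw_nil ln1 mulr0 expR0 ln1 addr_ge0 ?ln_ge0 //.
  exact: ltW.
(* The upper bound is read off at a multiple of [k.+1] so long that its average is within [e / k.+1]
   of [P]. *)
have : \forall m \near \oo, `|P - m%:R^-1 * ln (total w0 m)| < e / k.+1%:R.
  by apply: cvgr_dist_lt; rewrite ?divr_gt0.
case=> m0 _ hm0.
have mm : (m0 <= m0.+1 * k.+1)%N by nia.
have q0 : 0 < (m0.+1 * k.+1)%N%:R :> R by rewrite ltr0n muln_gt0.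
have := hm0 _ mm; rewrite /= => /ltr_distlCDr; rewrite mulrC ltr_pdivrMr // [X in _ < X]mulrC.
have := mul k.+1 m0; set Z := ln (total w0 (m0.+1 * k.+1)) => h1 h2.
have lD : 0 <= ln D by rewrite ln_ge0.
have k0 : 0 < k.+1%:R :> R by [].
have m1 : 0 < m0.+1%:R :> R by [].
rewrite -(ler_pM2l m1).
have E : m0.+1%:R * e = (m0.+1 * k.+1)%N%:R * (e / k.+1%:R) :> R.
  by rewrite natrM -mulrA (mulrCA k.+1%:R) divff ?mulr1.
rewrite natrM in h2 E; rewrite mulrDr -E -mulrA in h2.
move: h1 h2 lD; rewrite !mulrDr mulrN; lra.
Qed.

(** Dividing by [exp (|w| P)] keeps the totals between two positive constants, as the tilting
    argument requires. *)
Definition gw P w : R := expR (s * ln (nw w) - (size w)%:R * P).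

Lemma gw_gt0 P w : 0 < gw P w. Proof. exact: expR_gt0. Qed.

Lemma gwE P w : gw P w = w0 w * expR (- ((size w)%:R * P)).
Proof. by rewrite /gw expRD. Qed.

Lemma total_gw P k : total (gw P) k = expR (- (k%:R * P)) * total w0 k.
Proof.
rewrite /total mulr_sumr; apply: eq_big_seq => w /size_words hw.
by rewrite gwE hw mulrC.
Qed.

(** The normalisation is exactly multiplicative except across a bridging or padding letter, which
    costs [exp |P|]. *)
Lemma gw_qm P C : qm_weight C w0 -> qm_weight (C * expR `|P|) (gw P).
Proof.
move=> H; have C1 := qm_ge1 H; have C0 := le_trans ler01 C1.
have e1 : 1 <= expR `|P| by rewrite -expR0 ler_expR.
have eP : expR P <= expR `|P| by rewrite ler_expR ler_norm.
have eNP : expR (- P) <= expR `|P| by rewrite ler_expR -normrN ler_norm.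
have gc w a v : gw P (w ++ a :: v) = w0 (w ++ a :: v) * expR (- ((size w + size v)%:R * P)) * expR (- P).
  rewrite gwE -mulrA -expRD; congr (_ * expR _).
  by rewrite size_cat /= addnS -natr1; ring.
have ee : expR `|P| * expR (- P) >= 1 by rewrite -expRD -expR0 ler_expR subr_ge0 ler_norm.
have W0 w : 0 <= w0 w := expR_ge0 _.
have gr w a : gw P (rcons w a) = w0 (rcons w a) * expR (- ((size w)%:R * P)) * expR (- P).
  by rewrite -cats1 gc addn0.
split.
- exact: gw_gt0.
- by rewrite mulr_ege1.
- move=> u v; rewrite !gwE size_cat natrD mulrDl opprD expRD.
  set x := expR _; set y := expR _.
  have xy : 0 <= x * y by rewrite mulr_ge0 ?expR_ge0.
  have -> : w0 u * x * (w0 v * y) = (w0 u * w0 v) * (x * y) by exact: mulrACA.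
  rewrite [X in _ <= X]mulrA; apply: (ler_wpM2r xy); rewrite mulrAC.
  apply: le_trans (qm_sub H u v) _; apply: ler_peMr e1.
  exact: mulr_ge0 C0 (mulr_ge0 (W0 _) (W0 _)).
- move=> u v; rewrite !gwE.
  set x := expR _; set y := expR _.
  have xy : x * y = expR (- ((size u + size v)%:R * P)).
    by rewrite -expRD natrD mulrDl opprD.
  have -> : w0 u * x * (w0 v * y) = (w0 u * w0 v) * (x * y) by exact: mulrACA.
  apply: le_trans (ler_wpM2r (mulr_ge0 (expR_ge0 _) (expR_ge0 _)) (qm_sup H u v)) _.
  rewrite -!mulrA ler_wpM2l // size_cat xy mulrDl mulrDr lerD //.
    by rewrite ler_peMl // mulr_ge0 ?expR_ge0.
  rewrite mulr_suml mulr_sumr; apply: ler_sum => a _; rewrite gc.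
  by rewrite mulrCA ler_peMr ?mulr_ge0 ?expR_ge0.
- move=> w; rewrite gwE.
  apply: le_trans (ler_wpM2r (expR_ge0 _) (qm_pad H w)) _.
  rewrite -!mulrA ler_wpM2l // mulr_suml mulr_sumr; apply: ler_sum => a _; rewrite gr.
  by rewrite mulrCA ler_peMr ?mulr_ge0 ?expR_ge0.
- have -> : \sum_a gw P [:: a] = (\sum_a w0 [:: a]) * expR (- P).
    by rewrite mulr_suml; apply: eq_bigr => a _; rewrite gwE /= mul1r.
  apply: ler_pM => //; [exact: sumr_ge0|exact: qm_one H].
Qed.

End Pressure.

(** * Equilibrium states are comparable to powers of the norm *)

Section Equilibrium.
Context {R : realType} {n : nat}.
Variables (A : Alph n -> 'M[R]_2) (s : R).
Hypothesis hA : forall i, A i \in unitmx.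
Hypothesis hirr : irreducible A.
Hypothesis hs : 0 < s.
Variable mu : probability (SigmaM n) R.
Hypothesis heq : equilibrium_state A s mu.
Implicit Types (u v w : seq (Alph n)).

Notation nw := (nw A).
Let m := mw mu.
Let npos w : 0 < nw w := nw_gt0 hA w.
Let m0 w : 0 <= m w := mw_ge0 mu w.
Let mr w : \sum_a m (rcons w a) = m w := mw_rcons mu w.
Let mc w : \sum_a m (a :: w) = m w.
Proof. by apply: mw_cons; case: heq. Qed.
Let mn : m [::] = 1 := mw_nil mu.
Let mcl k w : \sum_(u <- words k) m (u ++ w) = m w := m_catl mc k w.
Let mcr k w : \sum_(u <- words k) m (w ++ u) = m w := m_catr mr k w.
Let mt k : total m k = 1 := m_total mn mc k.

Let m_le_l u v : m (u ++ v) <= m u.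
Proof.
rewrite -(mcr (size v) u); apply: (@sum_ge_elt _ _ _ (fun v => m (u ++ v))) => //.
by rewrite mem_words.
Qed.

Let m_le_r u v : m (u ++ v) <= m v.
Proof.
rewrite -(mcl (size u) v); apply: (@sum_ge_elt _ _ _ (fun u => m (u ++ v))) => //.
by rewrite mem_words.
Qed.

Let m_le1 w : m w <= 1.
Proof. by rewrite -mn -{1}[w]cats0 m_le_r. Qed.

Definition ent k := \sum_(w <- words k) - (m w * ln (m w)).
Definition lyap k := \sum_(w <- words k) m w * (s * ln (nw w)).

(** The Gibbs inequality for [m] against the product of its two marginals, both of which are
    positive where the joint mass is. *)
Lemma ent_sub p q : ent (p + q) <= ent p + ent q.
Proof.
pose g w := m (take p w) * m (drop p w).
have : \sum_(w <- words (p + q)) m w * (ln (g w) - ln (m w)) <=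
   \sum_(w <- words (p + q)) g w - \sum_(w <- words (p + q)) m w.
  apply: gibbs_ineq => // [w _|w _ mw]; first by rewrite mulr_ge0.
  rewrite /g; rewrite -(cat_take_drop p w) in mw.
  by rewrite mulr_gt0 // (lt_le_trans mw) ?m_le_l ?m_le_r.
have -> : \sum_(w <- words (p + q)) g w = 1.
  rewrite sum_words_cat -[RHS](mt p); apply: eq_big_seq => u /size_words hu.
  rewrite -[RHS]mulr1 -(mt q) mulr_sumr; apply: eq_bigr => v _.
  by rewrite /g take_size_cat ?drop_size_cat.
rewrite -/(total m (p + q)) mt subrr.
have -> : \sum_(w <- words (p + q)) m w * (ln (g w) - ln (m w)) =
   \sum_(w <- words (p + q)) m w * ln (g w) + ent (p + q).
  by rewrite -big_split; apply: eq_bigr => w _; rewrite mulrBr.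
have -> : \sum_(w <- words (p + q)) m w * ln (g w) = - ent p - ent q.
  have -> : ent p = - \sum_(u <- words p) \sum_(v <- words q) m (u ++ v) * ln (m u).
    rewrite /ent sumrN; congr (- _); apply: eq_bigr => u _.
    by rewrite -mulr_suml mcr.
  have -> : ent q = - \sum_(u <- words p) \sum_(v <- words q) m (u ++ v) * ln (m v).
    rewrite /ent sumrN exchange_big; congr (- _); apply: eq_bigr => v _.
    by rewrite -mulr_suml mcl.
  rewrite !opprK sum_words_cat -big_split; apply: eq_big_seq => u /size_words hu.
  rewrite -big_split; apply: eq_bigr => v _; rewrite /g take_size_cat ?drop_size_cat //=.
  case: (eqVneq (m (u ++ v)) 0) => [->|h]; first by rewrite !mul0r addr0.
  have h0 : 0 < m (u ++ v) by rewrite lt0r h m0.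
  by rewrite lnM ?posrE ?mulrDr // (lt_le_trans h0) ?m_le_l ?m_le_r.
lra.
Qed.

Lemma ent_ge0 k : 0 <= ent k.
Proof.
by apply: sumr_ge0 => w _; rewrite oppr_ge0 mulr_ge0_le0 ?ln_le0 ?m_le1.
Qed.

Lemma lyap_sub p q : lyap (p + q) <= lyap p + lyap q.
Proof.
have -> : lyap p = \sum_(u <- words p) \sum_(v <- words q) m (u ++ v) * (s * ln (nw u)).
  by apply: eq_bigr => u _; rewrite -mulr_suml mcr.
have -> : lyap q = \sum_(u <- words p) \sum_(v <- words q) m (u ++ v) * (s * ln (nw v)).
  by rewrite exchange_big; apply: eq_bigr => v _; rewrite -mulr_suml mcl.
rewrite /lyap sum_words_cat -big_split; apply: ler_sum => u _.
rewrite -big_split /=; apply: ler_sum => v _; rewrite -mulrDr ler_wpM2l // -mulrDr ler_pM2l //.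
by rewrite -lnM ?posrE // ler_ln ?posrE ?mulr_gt0 // nw_cat.
Qed.

(** The sum is [lyap k + ent k - k P]. By Fekete's lemma [P] is the sum of the infima of the
    averages of [ent] and [lyap], so the sign holds at every length and not only in the limit. *)
Lemma free_energy_ge0 k : 0 <= \sum_(w <- words k) m w * (ln (gw A s (pressure (phis A s)) w) - ln (m w)).
Proof.
have [K K0 hK] := letter_bounds hA.
have lb j : - (s * K) * j%:R <= lyap j.
  have -> : - (s * K) * j%:R = \sum_(w <- words j) m w * (- (s * K) * j%:R).
    by rewrite -mulr_suml -/(total m j) mt mul1r.
  rewrite /lyap big_seq [X in _ <= X]big_seq.
  apply: ler_sum => w /size_words hw; rewrite ler_wpM2l // mulNr -mulrA -mulrN ler_pM2l //.
  by have := hK w; rewrite ler_norml hw => /andP[].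
have [L [cL hL]] := fekete lyap_sub lb.
have lb' j : - 0 * j%:R <= ent j by rewrite oppr0 mul0r ent_ge0.
have [H [cH hH]] := fekete ent_sub lb'.
have eqP : pressure (phis A s) = H + L.
  case: heq => _ ->; congr (_ + _).
    rewrite /entropy (_ : (fun k => _) = (fun k => k%:R^-1 * ent k)); first exact: (cvg_lim _ cH).
    apply: funext => j; congr (_ * _); rewrite /ent -sum_word; apply: eq_bigr => w _.
    by rewrite cyl_wseq.
  rewrite (_ : (fun k => _) = (fun k => k%:R^-1 * lyap k)); first exact: (cvg_lim _ cL).
  apply: funext => j; congr (_ * _).
  apply: etrans (integral_cyl mu j (fun w => s * ln (nw w))); congr fine.
  by apply: eq_integral => x _; rewrite phisE.
have -> : \sum_(w <- words k) m w * (ln (gw A s (pressure (phis A s)) w) - ln (m w)) =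
   lyap k + ent k - k%:R * (H + L).
  have -> : k%:R * (H + L) = \sum_(w <- words k) m w * (k%:R * (H + L)).
    by rewrite -mulr_suml -/(total m k) mt mul1r.
  rewrite /lyap /ent -big_split -sumrB.
  apply: eq_big_seq => w /size_words hw; rewrite /gw expRK hw eqP /=; ring.
have := hL k; have := hH k; lra.
Qed.

Lemma equilibrium_gibbs : exists C, 1 <= C /\ forall w,
  m w <= C * gw A s (pressure (phis A s)) w /\ gw A s (pressure (phis A s)) w <= C * m w.
Proof.
set P := pressure _.
have [C0 H0] := w0_qm hA hirr hs.
have H : qm_weight (C0 * expR `|P|) (gw A s P) by apply: gw_qm.
have [P' [c [eP _ hP]]] := total_w0_bounds hA hirr hs; rewrite -/P in eP.
pose C := C0 * expR `|P| + expR c.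
have HC : qm_weight C (gw A s P).
  have h : C0 * expR `|P| <= C by rewrite lerDl expR_ge0.
  have g0 w : 0 <= gw A s P w := ltW (gw_gt0 _ _ _ _).
  have C00 : 0 <= C0 := le_trans ler01 (qm_ge1 H0).
  case: H => h1 h2 h3 h4 h5 h6; split => //.
  - exact: le_trans h2 h.
  - by move=> u v; apply: le_trans (h3 u v) _; rewrite ler_wpM2r ?mulr_ge0.
  - by move=> u v; apply: le_trans (h4 u v) _; rewrite ler_wpM2r ?addr_ge0 ?sumr_ge0.
  - by move=> w; apply: le_trans (h5 w) _; rewrite ler_wpM2r ?sumr_ge0.
  - exact: le_trans h6 h.
have C1 := qm_ge1 HC.
have Cpos : 0 < C := lt_le_trans ltr01 C1.
have Z k : C^-1 <= total (gw A s P) k <= C.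
  have /andP[z1 z2] := hP k; rewrite -eP in z1 z2.
  have Z0 := total_w0_gt0 A s k.
  have E : total (gw A s P) k = expR (ln (total (w0 A s) k) - k%:R * P).
    by rewrite total_gw expRD lnK ?posrE // mulrC.
  apply/andP; split.
    apply: (@le_trans _ _ 1); first by rewrite invf_le1.
    by rewrite E -[X in X <= _]expR0 ler_expR subr_ge0.
  rewrite E; apply: (@le_trans _ _ (expR c)); first by rewrite ler_expR lerBlDl.
  by rewrite lerDr mulr_ge0 ?expR_ge0 // (le_trans ler01 (qm_ge1 H0)).
have up := gibbs_upper HC Z m0 mn mr mc free_energy_ge0.
have lo := gibbs_lower HC Z m0 mn mr mc free_energy_ge0.
set K1 : R := _ * expR 1 in up; set K2 : R := expR 1 * _ in lo.
have q0 : 0 <= C * expR 1 by rewrite mulr_ge0 ?expR_ge0 // ltW.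
have K10 : 0 <= K1.
  rewrite /K1; move: (C * expR 1) q0 => q q0.
  by rewrite mulr_ge0 ?expR_ge0 // mulr_ge0 ?exprn_ge0 // mulr_ge0 ?addr_ge0 ?exprn_ge0.
have K20 : 0 <= K2 by rewrite /K2 mulr_ge0 ?expR_ge0 // mulr_ge0 ?exprn_ge0.
exists (1 + K1 + K2); split; first by rewrite -addrA lerDl addr_ge0.
move=> w; split.
  by apply: le_trans (up w) _; rewrite ler_wpM2r ?(ltW (gw_gt0 _ _ _ _)) // -addrA addrCA lerDl addr_ge0.
by apply: le_trans (lo w) _; rewrite ler_wpM2r // lerDr addr_ge0.
Qed.

End Equilibrium.

(** * Gibbs potentials and potentials following the norm *)

Section GibbsPotentials.
Context {R : realType} {n : nat}.
Variables (A : Alph n -> 'M[R]_2) (s : R).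
Hypothesis hA : forall i, A i \in unitmx.
Hypothesis hirr : irreducible A.
Hypothesis hs : 0 < s.
Variable mu : probability (SigmaM n) R.
Hypothesis heq : equilibrium_state A s mu.

(** Statement (3), as a property of a family because it is later transferred to rescaled
    matrices. *)
Definition norm_potential (A' : Alph n -> 'M[R]_2) := exists (C : R) (f : Seq n -> R),
  0 < C /\ holder f /\
  forall (x : Seq n) (k : nat), `|birk f k x - ln (opnorm (prodw A' (trunc x k)))| <= C.

Lemma birk_affine (f : Seq n -> R) (a b : R) k x :
  birk (fun y => a * f y + b) k x = a * birk f k x + k%:R * b.
Proof.
rewrite /birk big_split /= -mulr_sumr; congr (_ + _).
by rewrite sumr_const card_ord mulr_natl.
Qed.

Lemma holder_affine (f : Seq n -> R) (a b : R) :
  holder f -> holder (fun y => a * f y + b).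
Proof.
move=> [C [tau [C0 [t01 hf]]]]; exists ((`|a| + 1) * C), tau; split.
  by rewrite mulr_gt0 // ltr_wpDl.
split => // x y k hxy; rewrite opprD addrACA subrr addr0 -mulrBr normrM.
have h := hf x y k hxy; rewrite -mulrA; apply: ler_pM => //; first by rewrite lerDl.
Qed.

Lemma ln_between (C x y : R) : 1 <= C -> 0 < y -> C^-1 * y <= x -> x <= C * y ->
  `|ln x - ln y| <= ln C.
Proof.
move=> C1 y0 h1 h2; have C0 : 0 < C := lt_le_trans ltr01 C1.
have x0 : 0 < x by apply: lt_le_trans h1; rewrite mulr_gt0 ?invr_gt0.
rewrite ler_norml lerBrDr lerBlDr; apply/andP; split.
  by rewrite -lnV ?posrE // -lnM ?posrE ?invr_gt0 // ler_ln ?posrE // mulr_gt0 ?invr_gt0.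
by rewrite -lnM ?posrE // ler_ln ?posrE // mulr_gt0.
Qed.

Lemma gibbs_to_norm_potential : (exists f, holder f /\ gibbs mu f) -> norm_potential A.
Proof.
move=> [f [hf [C [C1 hG]]]].
have [K [K1 hK]] := equilibrium_gibbs hA hirr hs heq.
set P := pressure (phis A s) in hK; set Q := pressure (birk f) in hG.
(* Both estimates of [mu[w]] together say that [birk f k - k Q] and [s ln |A_w| - k P] differ by a
   bounded amount; [g] solves this for [ln |A_w|]. *)
pose g y := s^-1 * f y + s^-1 * (P - Q).
exists (s^-1 * (ln C + ln K) + 1), g; split.
  by rewrite ltr_wpDl // mulr_ge0 ?invr_ge0 ?(ltW hs) // addr_ge0 // ln_ge0.
split; first exact: holder_affine.
move=> x k; rewrite birk_affine prodw_pw wseq_trunc -/(nw A _).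
set w := mkseq x k.
have hw : size w = k by rewrite size_mkseq.
have cw : cyl (trunc x k) x by move=> j; rewrite ffunE.
have := hG k (trunc x k) x cw; rewrite /= cyl_wseq wseq_trunc -/w -mwE !lee_fin.
set e := expR _ => -[h1 h2].
have [h3 h4] := hK w.
have K0 : 0 < K := lt_le_trans ltr01 K1.
have h5 : K^-1 * gw A s P w <= mw mu w by rewrite ler_pdivrMl.
have l1 := ln_between C1 (expR_gt0 _) h1 h2.
have l2 := ln_between K1 (gw_gt0 _ _ _ _) h5 h3.
rewrite /gw /e !expRK hw in l1 l2.
have E : s^-1 * birk f k x + k%:R * (s^-1 * (P - Q)) - ln (nw A w) =
   s^-1 * ((ln (mw mu w) - (s * ln (nw A w) - k%:R * P)) - (ln (mw mu w) - (- (k%:R * Q) + birk f k x))).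
  by field; rewrite gt_eqF.
rewrite E normrM gtr0_norm ?invr_gt0 //.
apply: (@le_trans _ _ (s^-1 * (ln C + ln K))); last by rewrite lerDl.
rewrite ler_pM2l ?invr_gt0 // (le_trans (ler_normB _ _)) // addrC lerD //.
Qed.

Lemma sup_close (T : Type) (B : set T) (f : T -> R) c d x0 : B x0 ->
  (forall x, B x -> `|f x - c| <= d) -> `|sup [set f x | x in B] - c| <= d.
Proof.
move=> Bx h; have hb : has_ubound [set f x | x in B].
  by exists (c + d) => _ [x Bx' <-]; have := h x Bx'; rewrite ler_norml; lra.
have u1 : f x0 <= sup [set f x | x in B] by apply: ub_le_sup => //; exists x0.
have u2 : sup [set f x | x in B] <= c + d.
  apply: ge_sup; first by exists (f x0), x0.
  by move=> _ [x Bx' <-]; have := h x Bx'; rewrite ler_norml; lra.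
have := h x0 Bx; rewrite !ler_norml => /andP[h1 h2]; apply/andP; split; lra.
Qed.

Lemma norm_potential_to_gibbs : norm_potential A -> exists f, holder f /\ gibbs mu f.
Proof.
move=> [C [f [C0 [hf hS]]]].
pose g y := s * f y + 0.
have hg k x : `|birk g k x - s * ln (nw A (mkseq x k))| <= s * C.
  rewrite birk_affine mulr0 addr0 -mulrBr normrM gtr0_norm // ler_pM2l //.
  by have := hS x k; rewrite prodw_pw wseq_trunc.
exists g; split; first exact: holder_affine.
have [P [c [eP cP hP]]] := total_w0_bounds hA hirr hs.
have [K [K1 hK]] := equilibrium_gibbs hA hirr hs heq; rewrite eP in hK.
pose Z k := \sum_(w : word n k) expR (sup [set birk g k x | x in cyl w]).
have hsup k (w : word n k) : `|sup [set birk g k x | x in cyl w] - s * ln (nw A (wseq w))| <= s * C.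
  apply: (@sup_close _ _ _ _ _ (fillw (wseq w))); first by rewrite cyl_wseq; exact: cylw_fill.
  by move=> x; rewrite cyl_wseq /cylw /= size_wseq => <-; exact: hg.
have hZ k : expR (- (s * C)) * total (w0 A s) k <= Z k <= expR (s * C) * total (w0 A s) k.
  rewrite /Z /total -sum_word !mulr_sumr; apply/andP; split; apply: ler_sum => w _;
    rewrite /w0 -expRD ler_expR; have := hsup k w; rewrite ler_norml; lra.
have lZ k : `|ln (Z k) - ln (total (w0 A s) k)| <= s * C.
  have /andP[z1 z2] := hZ k; have t0 := total_w0_gt0 A s k.
  rewrite -[s * C]expRK; apply: ln_between => //; last by rewrite -expRN.
  by rewrite -[X in X <= _]expR0 ler_expR mulr_ge0 ?(ltW hs) ?(ltW C0).
(* Replacing [s ln |A_w|] by Birkhoff sums moves the logarithm of each partition sum by at most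
   [s * C], which disappears after division by [k]. *)
have eQ : pressure (birk g) = P.
  apply: cvg_lim => //; rewrite -/Z.
  have -> : (fun k : nat => k%:R^-1 * ln (Z k)) =
     (fun k : nat => k%:R^-1 * ln (total (w0 A s) k) + k%:R^-1 * (ln (Z k) - ln (total (w0 A s) k))).
    by apply: funext => k; ring.
  rewrite -[P]addr0; apply: cvgD => //.
  apply/cvgrPdist_le => e e0; near=> k.
  have k0 : 0 < k%:R :> R by rewrite ltr0n; near: k; exact: nbhs_infty_gt.
  rewrite sub0r normrN normrM gtr0_norm ?invr_gt0 // ler_pdivrMl //.
  apply: le_trans (lZ k) _; rewrite -ler_pdivrMr //.
  have : (Num.truncn (s * C / e) < k)%N by near: k; exact: nbhs_infty_gt.
  by move=> hk; apply/ltW/(lt_le_trans (truncnS_gt _)); rewrite ler_nat.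
exists (K * expR (s * C)); split.
  rewrite mulr_ege1 // -[X in X <= _]expR0 ler_expR mulr_ge0 ?(ltW hs) ?(ltW C0) //.
move=> k w x hx; rewrite /= eQ cyl_wseq -mwE !lee_fin.
have [h1 h2] := hK (wseq w).
have xw : mkseq x k = wseq w by move: hx; rewrite cyl_wseq /cylw /= size_wseq.
have hb := hg k x; rewrite xw ler_norml in hb.
have K0 : 0 < K := lt_le_trans ltr01 K1.
set e := expR (- (k%:R * P) + _).
have e1 : e <= expR (s * C) * gw A s P (wseq w).
  rewrite /e /gw -expRD ler_expR size_wseq; move: hb; clear.
  by move: (birk g k x) (s * ln _) (k%:R * P) (s * C) => a b c d; lra.
have e2 : gw A s P (wseq w) <= expR (s * C) * e.
  rewrite /e /gw -expRD ler_expR size_wseq; move: hb; clear.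
  by move: (birk g k x) (s * ln _) (k%:R * P) (s * C) => a b c d; lra.
split.
  rewrite ler_pdivrMl ?mulr_gt0 ?expR_gt0 // (le_trans e1) // mulrAC [K * _ * _]mulrC.
  by rewrite ler_pM2l ?expR_gt0.
by apply: le_trans h1 _; rewrite -mulrA ler_pM2l.
Unshelve. all: by end_near. Qed.

End GibbsPotentials.

(** * Birkhoff sums *)

Section BirkhoffSums.
Context {R : realType} {n : nat}.
Implicit Types (x y : Seq n) (f : Seq n -> R) (u v w : seq (Alph n)).

Lemma birkD f p q x : birk f (p + q) x = birk f p x + birk f q (iter p Defs.shift x).
Proof.
rewrite /birk -!(big_mkord predT (fun j => f (iter j Defs.shift _))) (big_cat_nat (n := p)) ?leq_addr //=.
congr (_ + _); rewrite -{1}[p]add0n big_addn addKn; apply: eq_bigr => j _.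
by rewrite iterD.
Qed.

(** Of the first [p] orbit points, each agrees on more than [k] letters, the earlier ones on more
    still, so the variations add up to a geometric sum. *)
Lemma birk_variation f : holder f -> exists V tau, [/\ 0 <= V, 0 < tau < 1 &
  forall p k x y, (forall j, (j < p + k)%N -> x j = y j) -> `|birk f p x - birk f p y| <= V * tau ^+ k].
Proof.
move=> [C [tau [C0 [/andP[t0 t1] hf]]]]; exists (C / (1 - tau)), tau.
have D0 : 0 < C / (1 - tau) by rewrite divr_gt0 // subr_gt0.
split; [exact: ltW|exact/andP|]; set D := C / _ in D0 *.
have CD : C = D * (1 - tau) by rewrite /D divfK // subr_eq0 gt_eqF.
(* The factor [1 - tau ^+ p] is the exact partial geometric sum, with which the induction closes. *)
move=> p k x y hxy; apply: (@le_trans _ _ (D * (1 - tau ^+ p) * tau ^+ k)); last first.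
  by rewrite ler_wpM2r ?exprn_ge0 ?(ltW t0) // ler_piMr ?(ltW D0) // gerBl exprn_ge0 // ltW.
elim: p x y hxy => [|p IH] x y hxy.
  by rewrite /birk !big_ord0 subrr normr0 expr0 subrr mulr0 mul0r.
have E z : birk f p.+1 z = f z + birk f p (Defs.shift z).
  by rewrite -add1n birkD; congr (_ + _); rewrite /birk big_ord_recl big_ord0 addr0.
rewrite !E opprD addrACA; apply: le_trans (ler_normD _ _) _.
have h1 := hf x y (p + k)%N (fun j hj => hxy j (ltnW hj)).
have h2 : `|birk f p (Defs.shift x) - birk f p (Defs.shift y)| <= D * (1 - tau ^+ p) * tau ^+ k.
  by apply: IH => j hj; apply: hxy.
apply: le_trans (lerD h1 h2) _; rewrite CD exprD exprS le_eqVlt; apply/orP; left; apply/eqP; ring.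
Qed.

Lemma mkseq_eq x y k : mkseq x k = mkseq y k -> forall j, (j < k)%N -> x j = y j.
Proof. by move=> h j hj; have := congr1 (fun s => nth ord0 s j) h; rewrite !nth_mkseq. Qed.

Lemma mkseq_cat_inv x u v : mkseq x (size (u ++ v)) = u ++ v ->
  mkseq x (size u) = u /\ mkseq (iter (size u) Defs.shift x) (size v) = v.
Proof.
by rewrite size_cat mkseq_shift => /eqP; rewrite eqseq_cat ?size_mkseq // => /andP[/eqP ? /eqP ?].
Qed.

Lemma mkseq_fill w : mkseq (fillw w) (size w) = w.
Proof. by have := mkseq_fillw w [::]; rewrite cats0. Qed.

Lemma holder_letter f (c : Alph n -> R) : holder f -> holder (fun x => f x + c (x 0%N)).
Proof.
move=> [C [tau [C0 [t01 hf]]]]; exists (C + 2 * \sum_i `|c i|), tau.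
have S0 : 0 <= \sum_i `|c i| by rewrite sumr_ge0.
have t0 : 0 <= tau by case/andP: t01 => /ltW.
split; first by rewrite ltr_pwDl // mulr_ge0.
split=> // x y k hxy; rewrite opprD addrACA; apply: le_trans (ler_normD _ _) _.
rewrite mulrDl lerD ?hf //; case: k hxy => [|k] hxy; last first.
  by rewrite (hxy 0%N) // subrr normr0 !mulr_ge0 ?exprn_ge0.
have Si i : `|c i| <= \sum_i `|c i|.
  by apply: (@sum_ge_elt _ _ _ (fun i => `|c i|)); rewrite ?mem_index_enum.
rewrite expr0 mulr1; apply: le_trans (ler_normB _ _) _.
by apply: le_trans (lerD (Si _) (Si _)) _; rewrite -mulr2n -[X in X <= _]mulr_natl.
Qed.

Lemma birk_letter f (c : Alph n -> R) k x :
  birk (fun y => f y + c (y 0%N)) k x = birk f k x + \sum_(a <- mkseq x k) c a.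
Proof.
rewrite /birk big_split /=; congr (_ + _); rewrite /mkseq big_map.
rewrite -[k in iota 0 k]subn0 -/(index_iota 0 k) big_mkord.
by apply: eq_bigr => j _; rewrite iter_shift addn0.
Qed.

End BirkhoffSums.

(** * Strictly invariant multicones *)

Section Angles.
Context {R : realType}.
Implicit Types (x y t d : R).

Lemma mod_pi x : exists z : int, - (pi / 2) <= x + z%:~R * pi <= pi / 2.
Proof.
have p0 : 0 < pi :> R := pi_gt0 R.
exists (- Num.floor (x / pi + 2^-1)).
have /andP[h1 h2] := floor_itv (x / pi + 2^-1).
rewrite mulrNz mulNr.
have E : x = (x / pi + 2^-1) * pi - pi / 2.
  by rewrite mulrDl divfK ?lt0r_neq0 // [2^-1 * _]mulrC addrK.
rewrite {1 3}E; move: h1 h2; rewrite intrD; move: (_ + 2^-1) (_%:~R) => a b h1 h2.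
by apply/andP; split; nra.
Qed.

Lemma sin_zpi x (z : int) : `|sin (x + z%:~R * pi)| = `|sin x|.
Proof.
have [e [he h]] := dir_pi x z.
have : (dir (x + z%:~R * pi) : 'cV[R]_2) 1 0 = (e *: dir x) 1 0 by rewrite h.
by rewrite !mxE /= => ->; rewrite normrM he mul1r.
Qed.

Lemma sin_far d : 0 < d ->
  exists2 e, 0 < e & forall y, (forall z : int, d <= `|y + z%:~R * pi|) -> e <= `|sin y|.
Proof.
move=> d0; have p0 : 0 < pi :> R := pi_gt0 R.
have p20 : 0 < pi / 2 :> R by rewrite divr_gt0.
pose c : R := Num.min d (pi / 2).
have c0 : 0 < c by rewrite lt_min d0.
have cd : c <= d by rewrite ge_min lexx.
have cp : c <= pi / 2 by rewrite ge_min lexx orbT.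
exists (sin c); first by apply: sin_gt0_pi; rewrite c0 /=; lra.
move=> y hy; have [z /andP[z1 z2]] := mod_pi y.
rewrite -(sin_zpi y z); have := hy z; move: (y + _) z1 z2 => x x1 x2 dx.
have mono a b : a \in `[ - (pi / 2), pi / 2] -> b \in `[ - (pi / 2), pi / 2] ->
    (sin a <= sin b :> R) = (a <= b).
  by move=> ha hb; rewrite !leNgt ltr_sin.
have cI : c \in `[ - (pi / 2), pi / 2] by rewrite in_itv /=; apply/andP; split; lra.
case: (lerP 0 x) => x0.
  rewrite ger0_norm // in dx; apply: le_trans (ler_norm _).
  by rewrite mono // ?in_itv /= ?x1 //; lra.
rewrite ltr0_norm // in dx; rewrite -normrN -sinN; apply: le_trans (ler_norm _).
by rewrite mono // ?in_itv /=; lra.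
Qed.

Lemma sin0_zpi x : sin x = 0 -> exists z : int, x = z%:~R * pi.
Proof.
move=> h; have [z /andP[z1 z2]] := mod_pi x.
exists (- z); rewrite mulrNz mulNr; apply/eqP; rewrite -addr_eq0; apply/eqP.
apply: (@sin_inj R); rewrite ?sin0.
- by rewrite in_itv /= z1.
- by rewrite in_itv /=; have := pi_ge0 R; lra.
- by apply/eqP; rewrite -normr_eq0 sin_zpi h normr0.
Qed.

End Angles.

Section Cones.
Context {R : realType} {n : nat}.
Variable A : Alph n -> 'M[R]_2.
Hypothesis hA : forall i, A i \in unitmx.
Implicit Types (u v x y z : 'cV[R]_2) (w : seq (Alph n)).

(* The multicone as a homogeneous set of nonzero vectors, with a quantitative form of
   [A M] lying in the interior of [M]; [v1], [v2] span two directions outside [M]. *)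
Record strict_cone (cone : 'cV[R]_2 -> Prop) (e : R) : Prop := StrictCone {
  sc_eps : 0 < e;
  sc_scale : forall c x, c != 0 -> cone x -> cone (c *: x);
  sc_neq0 : forall x, cone x -> x != 0;
  sc_deep : forall i x v, cone x -> v != 0 -> ~ cone v ->
    e * (enorm (A i *m x) * enorm v) <= `|wedge (A i *m x) v|;
  sc_nonempty : exists x, cone x;
  sc_out : exists v1 v2, [/\ v1 != 0, v2 != 0, ~ cone v1, ~ cone v2 & wedge v1 v2 != 0] }.

Section MulticoneToCone.
Variable M : set R.
Hypothesis hM : multicone M.
Hypothesis hS : strongly_invariant M A.
Hypothesis hirr : irreducible A.

Lemma multicone_pi t (z : int) : M t -> M (t + z%:~R * pi).
Proof.
case: hM => [[m [a [b [_ ->]]]] _] [j [z' /andP[h1 h2]]].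
exists j, (z' + z); rewrite intrD mulrDl; apply/andP; split; lra.
Qed.

Definition mcone x := x != 0 /\ exists2 t, M t & wedge (dir t) x = 0.

Lemma mcone_dir t : mcone (dir t) <-> M t.
Proof.
split=> [[_ [s Ms]]|Mt]; last first.
  by split; [exact: dir_neq0|exists t => //; exact: wedgexx].
rewrite wedge_dir => /sin0_zpi[z h]; have -> : t = s + z%:~R * pi by rewrite -h; ring.
exact: multicone_pi.
Qed.

Lemma mconeZ c x : c != 0 -> mcone x -> mcone (c *: x).
Proof.
move=> c0 [x0 [t Mt h]]; split; first by rewrite scaler_eq0 negb_or c0.
by exists t => //; rewrite wedgeZr h mulr0.
Qed.

Lemma mcone_mul i x : mcone x -> mcone (A i *m x).
Proof.
move=> [x0 [t Mt h]]; have [c hx] := wedge_eq0_scale (dir_neq0 t) h.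
have c0 : c != 0 by apply: contra x0 => /eqP c0; rewrite hx c0 scale0r.
rewrite hx -scalemxAr; apply: mconeZ => //.
have [u _ hu] := polar (A i *m dir t).
have n0 : enorm (A i *m dir t) != 0 by rewrite enorm_eq0 unit_mul_neq0 // dir_neq0.
rewrite hu; apply: mconeZ => //; apply/mcone_dir.
apply: interior_subset; apply: (hS (i := i) Mt); rewrite parallelE hu wedgeZl wedgexx mulr0 //.
Qed.

Lemma mcone_outdir v : v != 0 -> ~ mcone v -> exists2 t, v = enorm v *: dir t & ~ M t.
Proof.
move=> v0 hv; have [t _ ht] := polar v; exists t => // Mt; apply: hv.
by rewrite ht; apply: mconeZ; [rewrite enorm_eq0|apply/mcone_dir].
Qed.

Lemma local_gap i t : M t -> exists2 e : R, 0 < e &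
  forall u : R, ~ M u -> e <= `|wedge (A i *m dir t) (dir u)|.
Proof.
move=> Mt; have [s _ hs] := polar (A i *m dir t).
set c := enorm _ in hs.
have c0 : 0 < c by rewrite enorm_gt0 unit_mul_neq0 // dir_neq0.
have : (M°) s by apply: (hS (i := i) Mt); rewrite parallelE hs wedgeZl wedgexx mulr0.
move=> /nbhs_ballP[d /= d0 hd].
have [e e0 he] := sin_far d0; exists (c * e); first by rewrite mulr_gt0.
move=> u Mu; rewrite hs wedgeZl wedge_dir normrM gtr0_norm // ler_pM2l //.
apply: he => z; rewrite leNgt; apply/negP => hz; apply: Mu.
have : M (u + z%:~R * pi).
  by apply: hd; rewrite /ball /= distrC; move: hz; congr (`|_| < _); ring.
move=> /(multicone_pi (- z)); congr M; rewrite mulrNz; ring.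
Qed.

(** [M] itself is not compact, but modulo [pi] it is covered by the compact intervals [[a j, b j]].
    Around a fixed [t] the local gap [e] stays at least [e / 2], since [dir t] moves little and
    [opnorm (A i)] is a Lipschitz constant. *)
Lemma uniform_gap : exists2 e : R, 0 < e & forall i (t u : R), M t -> ~ M u ->
  e <= `|wedge (A i *m dir t) (dir u)|.
Proof.
case: (hM) => [[m [a [b [_ EM]]]] _].
pose P i (e t : R) := forall u : R, ~ M u -> e <= `|wedge (A i *m dir t) (dir u)|.
have H i j : \forall e \near 0^'+, `[a j, b j] `<=` P i e.
  have cpt := @segment_compact R (a j) (b j).
  apply: ((compact_near_coveringP _).1 cpt) => t /= tI.
  have Mt : M t.
    by rewrite EM; exists j, 0; rewrite mul0r !addr0; move: tI; rewrite in_itv.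
  have [e e0 he] := local_gap i Mt.
  pose K := opnorm (A i); have K0 : 0 < K := opnorm_gt0 (hA i).
  have d0 : 0 < e / 4 / K by rewrite !divr_gt0.
  near=> t' d => u Mu.
  have h1 := he u Mu.
  have cc : `|cos t - cos t'| < e / 4 / K.
    by near: t'; have /cvgrPdist_lt := @continuous_cos R t; apply.
  have ss : `|sin t - sin t'| < e / 4 / K.
    by near: t'; have /cvgrPdist_lt := @continuous_sin R t; apply.
  have dd : d <= e / 2 by near: d; apply: nbhs_right_le; rewrite divr_gt0.
  have h2 : `|wedge (A i *m dir t - A i *m dir t') (dir u)| <= e / 2.
    apply: le_trans (wedge_le _ _) _; rewrite enorm_dir mulr1 -mulmxBr.
    apply: le_trans (enorm_mul _ _) _; rewrite -/K mulrC -ler_pdivlMr //.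
    apply: le_trans (enorm_le_entries _) _; rewrite !mxE /=.
    have -> : e / 2 / K = e / 4 / K + e / 4 / K by field; exact: lt0r_neq0.
    by rewrite lerD // ltW.
  have h3 : `|wedge (A i *m dir t) (dir u)| <=
      `|wedge (A i *m dir t - A i *m dir t') (dir u)| + `|wedge (A i *m dir t') (dir u)|.
    by rewrite -{1}(subrK (A i *m dir t') (A i *m dir t)) wedgeDl ler_normD.
  rewrite /=; lra.
have [e /= [e0 he]] : exists e : R, 0 < e /\ forall i j, `[a j, b j] `<=` P i e.
  have : \forall e \near (0 : R)^'+, 0 < e /\ forall i j, `[a j, b j] `<=` P i e.
    near=> e; split; first by near: e; exact: nbhs_right_gt.
    near: e; apply: filter_forall => i; apply: filter_forall => j; exact: H.
  by move=> /filter_ex [e he]; exists e.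
exists e => // i t u Mt Mu.
move: (Mt); rewrite EM => -[j [z tz]].
have [c [hc h]] := dir_pi (t - z%:~R * pi) z.
rewrite subrK in h; rewrite h -scalemxAr wedgeZl normrM hc mul1r.
apply: (he i j) => //; rewrite /= in_itv /=; case/andP: tz => *; apply/andP; split; lra.
Unshelve. all: by end_near. Qed.

Lemma multicone_strict : exists e, strict_cone mcone e.
Proof.
have [e e0 he] := uniform_gap.
pose K := 1 + \sum_i opnorm (A i).
have Ki i : opnorm (A i) <= K.
  rewrite /K (bigD1 i) //= addrCA lerDl addr_ge0 // sumr_ge0 // => j _; exact: opnorm_ge0.
have K0 : 0 < K by rewrite /K ltr_pwDl // sumr_ge0 // => j _; exact: opnorm_ge0.
have [u1 Mu1] : exists u : R, ~ M u.
  case: hM => _ /eqP MT; apply: contrapT => h; apply: MT; apply/seteqP; split => // x _.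
  by apply: contrapT => Mx; apply: h; exists x.
exists (e / K); split.
- by rewrite divr_gt0.
- exact: mconeZ.
- by move=> x [].
- move=> i x v [x0 [t Mt h]] v0 hv; have [c hx] := wedge_eq0_scale (dir_neq0 t) h.
  have [u -> Mu] := mcone_outdir v0 hv.
  rewrite hx -scalemxAr wedgeZl wedgeZr !enormZ enorm_dir mulr1 !normrM.
  have := he i t u Mt Mu => h1.
  have h2 : e / K * enorm (A i *m dir t) <= `|wedge (A i *m dir t) (dir u)|.
    apply: le_trans h1; rewrite mulrAC ler_pdivrMr // ler_pM2l //.
    by apply: le_trans (enorm_mul _ _) _; rewrite enorm_dir mulr1.
  have := ler_wpM2l (mulr_ge0 (normr_ge0 c) (normr_ge0 (enorm v))) h2.
  by congr (_ <= _); ring.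
- case: hM => [[m [a [b [ab EM]]]] _]; exists (dir (a ord0)); apply/mcone_dir; rewrite EM.
  by exists ord0, 0; rewrite mul0r !addr0 lexx ab.
(* Inverses map outer directions to outer directions; if [dir u1] were the only one, its line would
   be invariant under every [A i]. *)
exists (dir u1); apply: contrapT => hno.
apply: (hirr (v := dir u1) (dir_neq0 u1)) => i.
have v0 : invmx (A i) *m dir u1 != 0 by rewrite unit_mul_neq0 ?unitmx_inv ?dir_neq0.
have hv : ~ mcone (invmx (A i) *m dir u1).
  by move=> /(mcone_mul i); rewrite mulKVmx // => /mcone_dir.
have [c hc] : exists c, invmx (A i) *m dir u1 = c *: dir u1.
  apply: wedge_eq0_scale (dir_neq0 u1) _; apply/eqP/negPn/negP => hw; apply: hno.
  by exists (invmx (A i) *m dir u1); split => //; [exact: dir_neq0|move/mcone_dir].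
have c0 : c != 0 by apply: contra v0 => /eqP c0; rewrite hc c0 scale0r.
by exists c^-1; rewrite -{1}[dir u1](scalerK c0) -hc -scalemxAr mulKVmx.
Qed.

End MulticoneToCone.

(** * Contraction outside a strict cone and the resulting potential *)

Section Domination.
Variables (cone : 'cV[R]_2 -> Prop) (e : R).
Hypothesis H : strict_cone cone e.

Let e0 : 0 < e := sc_eps H.
Let out v := v != 0 /\ ~ cone v.

(** A uniform angular distance from all outer directions: every nontrivial product sends the cone
    into this set, and the estimates uniform in the word start from it. *)
Definition deep x := x != 0 /\ forall v, v != 0 -> ~ cone v ->
  e * (enorm x * enorm v) <= `|wedge x v|.

Lemma cone_mul i x : cone x -> cone (A i *m x).
Proof.
move=> cx; apply: contrapT => hn.
have x0 := sc_neq0 H cx; have Ax0 : A i *m x != 0 by rewrite unit_mul_neq0.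
have := sc_deep H i cx Ax0 hn; rewrite wedgexx normr0 leNgt => /negP; apply.
by rewrite !mulr_gt0 // enorm_gt0.
Qed.

Lemma cone_deep i x : cone x -> deep (A i *m x).
Proof.
move=> cx; split => [|v v0 hv]; first by rewrite unit_mul_neq0 // (sc_neq0 H).
exact (sc_deep H i cx v0 hv).
Qed.

Lemma deep_cone x : deep x -> cone x.
Proof.
move=> [x0 h]; apply: contrapT => hn; have := h x x0 hn.
by rewrite wedgexx normr0 leNgt => /negP; apply; rewrite !mulr_gt0 // enorm_gt0.
Qed.

Lemma cone_pw w x : cone x -> cone (pw A w *m x).
Proof.
move=> cx; elim: w => [|a w IH]; first by rewrite pw_nil mul1mx.
by rewrite pw_cons -mulmxA; exact: cone_mul.
Qed.

Lemma deep_pw w x : deep x -> deep (pw A w *m x).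
Proof.
case: w => [|a w]; first by rewrite pw_nil mul1mx.
by move=> /deep_cone cx; rewrite pw_cons -mulmxA; apply/cone_deep/cone_pw.
Qed.

Lemma outZ c v : c != 0 -> out v -> out (c *: v).
Proof.
move=> c0 [v0 hv]; split; first by rewrite scaler_eq0 negb_or c0.
move=> h; apply: hv; rewrite -(scalerK c0 v); apply: (sc_scale H) => //.
by rewrite invr_eq0.
Qed.

Lemma out_inv i v : out v -> out (invmx (A i) *m v).
Proof.
move=> [v0 hv]; split; first by rewrite unit_mul_neq0 ?unitmx_inv.
by move=> /(cone_mul i); rewrite mulKVmx.
Qed.

(* [A_w (x + t x^perp)] cannot point outside the cone for [|t| < e]; applied to two
   independent outer directions this compares [A_w x^perp] with [A_w x]. *)
Lemma deep_norm : exists2 c, 0 < c & forall x, deep x -> forall w,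
  c * (nw A w * enorm x) <= enorm (pw A w *m x).
Proof.
have [v1 [v2 [v10 v20 o1 o2 w12]]] := sc_out H.
set W := `|wedge v1 v2|; have W0 : 0 < W by rewrite normr_gt0.
have n1 : 0 < enorm v1 by rewrite enorm_gt0.
have n2 : 0 < enorm v2 by rewrite enorm_gt0.
pose D := 1 + 2 * (enorm v1 * enorm v2) / (e * W).
have D0 : 0 < D by rewrite ltr_pwDl // divr_ge0 ?mulr_ge0 ?enorm_ge0 // ltW.
exists D^-1; first by rewrite invr_gt0.
move=> x [x0 dx] w; rewrite ler_pdivrMl //.
set p := pw A w *m x; set q := pw A w *m vperp x.
have nx : 0 < enorm x by rewrite enorm_gt0.
have key v : v != 0 -> ~ cone v -> e * `|wedge q v| <= `|wedge p v|.
  move=> v0 hv; rewrite leNgt; apply/negP => hlt.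
  have qv : wedge q v != 0.
    apply: contraTneq hlt => ->; by rewrite normr0 mulr0 -leNgt.
  pose t := - (wedge p v / wedge q v); pose z := x + t *: vperp x.
  have te : `|t| < e by rewrite normrN normrM normfV ltr_pdivrMr ?normr_gt0.
  have xz : wedge x z = t * enorm x ^+ 2 by rewrite wedgeDr wedgexx add0r wedgeZr wedge_perp.
  have iz : inner x z = enorm x ^+ 2 by rewrite enorm_sqr /inner !mxE /=; ring.
  have zx : enorm x <= enorm z.
    have := le_trans (ler_norm _) (inner_le x z); rewrite iz expr2 ler_pM2l //.
  have z0 : z != 0 by rewrite -enorm_gt0 (lt_le_trans nx).
  have cz : cone z.
    apply: contrapT => hz; have := dx z z0 hz; rewrite xz normrM (ger0_norm (sqr_ge0 _)) leNgt.
    move=> /negP; apply; apply: (@lt_le_trans _ _ (e * (enorm x * enorm x))).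
      by rewrite expr2 ltr_pM2r ?mulr_gt0.
    by rewrite ler_pM2l // ler_pM2l.
  apply: hv; have := cone_pw w cz.
  have y0 : pw A w *m z != 0 by rewrite unit_mul_neq0 // pw_unit.
  have yv : wedge (pw A w *m z) v = 0.
    rewrite mulmxDr -scalemxAr -/p -/q wedgeDl wedgeZl /t mulNr divfK // subrr //.
  have [c hc] := wedge_eq0_scale y0 yv.
  move=> cy; rewrite hc; apply: (sc_scale H) => //.
  by apply: contra v0 => /eqP c0; rewrite hc c0 scale0r.
have k1 := key _ v10 o1; have k2 := key _ v20 o2.
have pl : W * enorm q <= `|wedge q v2| * enorm v1 + `|wedge q v1| * enorm v2.
  by rewrite /W -enormZ plucker (le_trans (enormD _ _)) // enormN !enormZ.
have hq : e * W * enorm q <= 2 * (enorm v1 * enorm v2) * enorm p.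
  rewrite -mulrA; apply: le_trans (ler_wpM2l (ltW e0) pl) _.
  rewrite mulrDr !mulrA.
  have h1 := ler_wpM2r (ltW n1) (le_trans k2 (wedge_le p v2)).
  have h2 := ler_wpM2r (ltW n2) (le_trans k1 (wedge_le p v1)).
  apply: le_trans (lerD h1 h2) _; rewrite le_eqVlt; apply/orP; left; apply/eqP; ring.
have := opnorm_basis (pw A w) x; rewrite -/p -/q -/(nw A w) => /le_trans; apply.
rewrite /D mulrDl mul1r lerD2l mulrAC ler_pdivlMr ?mulr_gt0 // mulrC //.
Qed.

(* [r] bounds the diameter of the outer directions in the affine chart
   that sends [x] to infinity; it is the reciprocal of a projective metric at [x]. *)
Definition spread x (r : R) := forall u v, out u -> out v ->
  `|wedge u v| <= r * (`|wedge x u| * `|wedge x v|).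

Lemma deep_spread x : deep x -> spread x ((e * enorm x) ^+ 2)^-1.
Proof.
move=> [x0 dx] u v [u0 ou] [v0 ov].
have nx : 0 < enorm x by rewrite enorm_gt0.
rewrite ler_pdivlMl ?exprn_gt0 ?mulr_gt0 //.
have h1 := dx u u0 ou; have h2 := dx v v0 ov.
have h3 := wedge_le u v.
have := ler_wpM2l (exprn_ge0 2 (mulr_ge0 (ltW e0) (ltW nx))) h3 => /le_trans; apply.
have -> : (e * enorm x) ^+ 2 * (enorm u * enorm v) = (e * (enorm x * enorm u)) * (e * (enorm x * enorm v)) by ring.
by apply: ler_pM => //; rewrite !mulr_ge0 ?enorm_ge0 // ltW.
Qed.

(** In the affine chart [wedge x = 1], preimages of outer directions are outer with a margin [eta]:
    the two points can be pushed apart by [eta] each along [x] and remain outer. So [spread x r]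
    gives [|wedge u1 v1| + 2 * eta <= r], and [eta] is a fixed fraction of the a priori bound on
    [r]. *)
Lemma spread_mul : exists2 theta, 0 < theta < 1 & forall i x r, deep x -> 0 <= r ->
  spread x r -> spread (A i *m x) (theta * r / `|\det (A i)|).
Proof.
(* Width of the margin in the chart, up to the factor [enorm x ^+ 2]; it combines the gap [e] with
   the lower bound [det_enorm]. *)
pose d i := e * `|\det (A i)| / opnorm (A i) ^+ 2.
have d0 i : 0 < d i.
  by rewrite /d divr_gt0 ?exprn_gt0 ?opnorm_gt0 // mulr_gt0 // normr_gt0 -unit_det.
(* [S^-1] is below every [d i], and the summand [e ^+ 2] makes [theta] positive. *)
pose S := 2 + \sum_i (d i)^-1 + e ^+ 2.
have S0 : 0 < S by rewrite /S addr_gt0 ?exprn_gt0 // ltr_pwDl // sumr_ge0 // => i _; rewrite invr_ge0 ltW.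
have dS i : S^-1 <= d i.
  rewrite -[d i]invrK lef_pV2 ?posrE ?invr_gt0 //.
  rewrite /S (bigD1 i) //= addrCA -addrA lerDl !addr_ge0 ?exprn_ge0 ?(ltW e0) // sumr_ge0 // => j _.
  by rewrite invr_ge0 ltW.
exists (1 - S^-1 * e ^+ 2).
  have h : S^-1 * e ^+ 2 < 1.
    rewrite mulrC ltr_pdivrMr // mul1r /S ltrDr.
    by rewrite ltr_pwDl // sumr_ge0 // => i _; rewrite invr_ge0 ltW.
  by rewrite subr_gt0 h /= gtrBl mulr_gt0 ?invr_gt0 ?exprn_gt0.
set theta := 1 - _.
have theta0 : 0 <= theta.
  rewrite subr_ge0 mulrC ler_pdivrMr // mul1r /S lerDr.
  by rewrite addr_ge0 // sumr_ge0 // => i _; rewrite invr_ge0 ltW.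
have step i x r : deep x -> r <= ((e * enorm x) ^+ 2)^-1 ->
  spread x r -> spread (A i *m x) (theta * r / `|\det (A i)|).
  move=> [x0 dx] hr sx u v ou ov.
  have nx : 0 < enorm x by rewrite enorm_gt0.
  have D0 : 0 < `|\det (A i)| by rewrite normr_gt0 -unit_det.
  set u' := invmx (A i) *m u; set v' := invmx (A i) *m v.
  have ou' : out u' := out_inv i ou; have ov' : out v' := out_inv i ov.
  have nz y : out y -> wedge x y != 0.
    move=> [y0 oy]; rewrite -normr_gt0 (lt_le_trans _ (dx y y0 oy)) // !mulr_gt0 ?enorm_gt0 //.
  pose u1 := (wedge x u')^-1 *: u'; pose v1 := (wedge x v')^-1 *: v'.
  have xu1 : wedge x u1 = 1 by rewrite wedgeZr mulVf // nz.
  have xv1 : wedge x v1 = 1 by rewrite wedgeZr mulVf // nz.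
  have ou1 : out u1 by apply: outZ => //; rewrite invr_eq0 nz.
  have ov1 : out v1 by apply: outZ => //; rewrite invr_eq0 nz.
  have big y : wedge x y = 1 -> (enorm x)^-1 <= enorm y.
    move=> xy; rewrite -[X in X <= _]mul1r ler_pdivrMr // mulrC.
    by have := wedge_le x y; rewrite xy normr1.
  (* Were [y + t *: x] in the cone, its image would be deep and hence far from the outer vector
     [A i *m y]; but the wedge of the two is only [t * \det (A i)] up to sign. *)
  have shift y t : out (A i *m y) -> wedge x y = 1 -> `|t| < d i / enorm x ^+ 2 -> out (y + t *: x).
    move=> oy xy ht; set z := y + t *: x.
    have xz : wedge x z = 1 by rewrite wedgeDr xy wedgeZr wedgexx mulr0 addr0.
    have z0 : z != 0.
      apply/eqP => z0; move: xz; rewrite z0 /wedge !mxE => /eqP; rewrite !mulr0 subrr eq_sym oner_eq0 //.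
    split => // cz; move: ht; apply/negP; rewrite -leNgt.
    have nA y' : wedge x y' = 1 -> `|\det (A i)| / (opnorm (A i) * enorm x) <= enorm (A i *m y').
      move=> h; have K0 := opnorm_gt0 (hA i).
      rewrite ler_pdivrMr ?mulr_gt0 // mulrA [_ * opnorm _]mulrC.
      rewrite -ler_pdivrMr //; apply: le_trans (det_enorm _ _).
      by rewrite ler_pM2l // big.
    have := (cone_deep i cz).2 (A i *m y) oy.1 oy.2.
    rewrite wedge_mul /z wedgeDl wedgexx add0r wedgeZl xy mulr1 normrM => h.
    have h2 : (`|\det (A i)| / (opnorm (A i) * enorm x)) ^+ 2 <= enorm (A i *m z) * enorm (A i *m y).
      have K0 := opnorm_gt0 (hA i).
      by rewrite expr2; apply: ler_pM; rewrite ?divr_ge0 ?mulr_ge0 ?(ltW D0) ?(ltW K0) ?(ltW nx) ?nA.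
    have {h2}h := le_trans (ler_wpM2l (ltW e0) h2) h.
    rewrite -(ler_pM2l D0); apply: le_trans h.
    rewrite le_eqVlt; apply/orP; left; apply/eqP; rewrite /d; field.
    by rewrite !gt_eqF // opnorm_gt0.
  (* Chosen so that [2 * eta] is the fraction [S^-1 * e ^+ 2] of the a priori bound
     [((e * enorm x) ^+ 2)^-1]. *)
  pose eta := S^-1 / (2 * enorm x ^+ 2).
  have eta0 : 0 < eta by rewrite /eta divr_gt0 ?invr_gt0 // mulr_gt0 ?exprn_gt0.
  have etad : eta < d i / enorm x ^+ 2.
    rewrite /eta invfM mulrA ltr_pM2r ?invr_gt0 ?exprn_gt0 //.
    have := dS i; have : 0 < S^-1 by rewrite invr_gt0.
    by move: (S^-1) => a; lra.
  have oAu : out (A i *m u1).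
    by rewrite -scalemxAr mulKVmx //; apply: outZ => //; rewrite invr_eq0 nz.
  have oAv : out (A i *m v1).
    by rewrite -scalemxAr mulKVmx //; apply: outZ => //; rewrite invr_eq0 nz.
  have hr1 : `|wedge u1 v1| <= theta * r.
    have [sg [sg1 hsg]] : exists sg : R, `|sg| = 1 /\ `|wedge u1 v1| + 2 * eta = `|wedge u1 v1 + 2 * (sg * eta)|.
      case: (lerP 0 (wedge u1 v1)) => hw.
        exists 1; rewrite normr1 mul1r; split => //; rewrite !ger0_norm //.
        by rewrite addr_ge0 // mulr_ge0 // ltW.
      exists (-1); rewrite normrN1; split => //.
      rewrite (ltr0_norm hw) ltr0_norm; first by ring.
      by rewrite mulN1r mulrN; lra.
    have sge : `|sg * eta| < d i / enorm x ^+ 2 by rewrite normrM sg1 mul1r gtr0_norm.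
    have sgm : `|- (sg * eta)| < d i / enorm x ^+ 2 by rewrite normrN.
    have := sx _ _ (shift _ _ oAu xu1 sge) (shift _ _ oAv xv1 sgm).
    rewrite wedge_shear xu1 xv1 -[1 + 1]/(2%:R) [_ * 2]mulrC.
    have sx1 y t : wedge x y = 1 -> wedge x (y + t *: x) = 1.
      by move=> <-; rewrite wedgeDr wedgeZr wedgexx mulr0 addr0.
    rewrite !sx1 // normr1 !mulr1 -hsg.
    have : S^-1 * e ^+ 2 * r <= 2 * eta.
      have -> : 2 * eta = S^-1 * (e ^+ 2 * ((e * enorm x) ^+ 2)^-1).
        by rewrite /eta; field; rewrite !gt_eqF.
      by rewrite -mulrA !ler_pM2l ?invr_gt0 ?exprn_gt0.
    by rewrite /theta mulrBl mul1r; lra.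
  have E1 : wedge u v = \det (A i) * (wedge x u' * wedge x v' * wedge u1 v1).
    rewrite wedgeZl wedgeZr -{1}(mulKVmx (hA i) u) -{1}(mulKVmx (hA i) v) wedge_mul.
    by rewrite -/u' -/v'; field; rewrite !nz.
  have E2 : wedge (A i *m x) u = \det (A i) * wedge x u'.
    by rewrite -{1}(mulKVmx (hA i) u) wedge_mul.
  have E3 : wedge (A i *m x) v = \det (A i) * wedge x v'.
    by rewrite -{1}(mulKVmx (hA i) v) wedge_mul.
  rewrite E1 E2 E3 !normrM.
  have -> : theta * r / `|\det (A i)| * (`|\det (A i)| * `|wedge x u'| * (`|\det (A i)| * `|wedge x v'|))
     = `|\det (A i)| * (`|wedge x u'| * `|wedge x v'| * (theta * r)).
    by field; rewrite gt_eqF.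
  by rewrite ler_pM2l // ler_wpM2l // mulr_ge0.
move=> i x r dx r0 sx.
(* A larger [r] says less than [deep_spread]; the a priori bound is contracted in its place. *)
case: (lerP r ((e * enorm x) ^+ 2)^-1) => hr; first exact: step.
move=> u v ou ov; apply: le_trans (step i x _ dx (lexx _) (deep_spread dx) u v ou ov) _.
rewrite ler_wpM2r ?mulr_ge0 // ler_wpM2r ?invr_ge0 // ler_wpM2l // ltW //.
Qed.

(** The fixed outer pair [v1], [v2] has a nonzero wedge, which the contracted spread at
    [pw A w *m x] must still dominate; this forces that vector to be long compared with the square
    root of the determinant. *)
Lemma det_decay : exists C theta, [/\ 0 < C, 0 < theta < 1 & forall x, deep x -> forall w,
  `|\det (pw A w)| * enorm x ^+ 2 <= C * theta ^+ size w * enorm (pw A w *m x) ^+ 2].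
Proof.
have [theta th htheta] := spread_mul; have /andP[th0 th1] := th.
have [v1 [v2 [v10 v20 o1 o2 w12]]] := sc_out H.
have W0 : 0 < `|wedge v1 v2| by rewrite normr_gt0.
exists (enorm v1 * enorm v2 / (e ^+ 2 * `|wedge v1 v2|)), theta; split => //.
  by rewrite divr_gt0 ?mulr_gt0 ?exprn_gt0 // enorm_gt0.
move=> x dx w; have nx : 0 < enorm x by rewrite enorm_gt0; case: dx.
have D0 b : 0 < `|\det (pw A b)| by rewrite normr_gt0 -unit_det pw_unit.
have S : spread (pw A w *m x) (theta ^+ size w * ((e * enorm x) ^+ 2)^-1 / `|\det (pw A w)|).
  elim: w => [|a w IH]; first by rewrite pw_nil mul1mx det1 normr1 divr1 mul1r; exact: deep_spread.
  rewrite pw_cons -mulmxA; have := htheta a _ _ (deep_pw w dx) _ IH.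
  move=> /(_ _) h u v ou ov; apply: le_trans (h _ u v ou ov) _.
    by rewrite !mulr_ge0 ?invr_ge0 ?exprn_ge0 ?mulr_ge0 ?(ltW e0) ?(ltW nx) ?(ltW th0).
  have -> : theta ^+ size (a :: w) / (e * enorm x) ^+ 2 / `|\det (A a *m pw A w)| =
     theta * (theta ^+ size w / (e * enorm x) ^+ 2 / `|\det (pw A w)|) / `|\det (A a)|.
    have -> : theta ^+ size (a :: w) = theta * theta ^+ size w by rewrite -exprS.
    by rewrite det_mulmx normrM (invfM `|\det (A a)|) !mulrA mulrAC.
  exact: lexx.
have := S v1 v2 (conj v10 o1) (conj v20 o2); set y := pw A w *m x => h.
have h2 : `|wedge v1 v2| <= theta ^+ size w * ((e * enorm x) ^+ 2)^-1 / `|\det (pw A w)| *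
    (enorm y ^+ 2 * (enorm v1 * enorm v2)).
  apply: le_trans h _; rewrite ler_wpM2l //.
    by rewrite !mulr_ge0 ?invr_ge0 ?exprn_ge0 ?mulr_ge0 ?(ltW e0) ?(ltW nx) ?(ltW th0).
  have -> : enorm y ^+ 2 * (enorm v1 * enorm v2) = (enorm y * enorm v1) * (enorm y * enorm v2) by ring.
  by apply: ler_pM => //; exact: wedge_le.
have q0 : 0 < (e * enorm x) ^+ 2 * `|\det (pw A w)| by rewrite mulr_gt0 ?exprn_gt0 ?mulr_gt0.
have h3 : `|wedge v1 v2| * ((e * enorm x) ^+ 2 * `|\det (pw A w)|) <=
    theta ^+ size w * (enorm y ^+ 2 * (enorm v1 * enorm v2)).
  rewrite -ler_pdivlMr //; apply: le_trans h2 _; rewrite le_eqVlt; apply/orP; left.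
  by apply/eqP; field; rewrite !gt_eqF //= D0.
have W1 : 0 < e ^+ 2 * `|wedge v1 v2| by rewrite mulr_gt0 ?exprn_gt0.
rewrite -(ler_pM2l W1).
have -> : e ^+ 2 * `|wedge v1 v2| * (`|\det (pw A w)| * enorm x ^+ 2) =
  `|wedge v1 v2| * ((e * enorm x) ^+ 2 * `|\det (pw A w)|) by ring.
apply: le_trans h3 _; rewrite le_eqVlt; apply/orP; left; apply/eqP; field.
by rewrite !gt_eqF.
Qed.

(** Bounds the condition numbers of the letters, since [|A^-1| = |A| / |det A|] in the plane. *)
Let Cinv := \sum_a (opnorm (A a) ^+ 2 / `|\det (A a)|).

Lemma norm_pos_det i : 0 < `|\det (A i)|.
Proof. by rewrite normr_gt0 -unit_det. Qed.

(* On lines, [y |-> ln (|B y| / |y|)] is Lipschitz for the sine of the angle. *)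
Lemma ln_ratio_lip i x y : x != 0 -> y != 0 ->
  `|ln (enorm (A i *m x) / enorm x) - ln (enorm (A i *m y) / enorm y)| <=
  2 * Cinv * (`|wedge x y| / (enorm x * enorm y)).
Proof.
have CI j : opnorm (A j) ^+ 2 / `|\det (A j)| <= Cinv.
  rewrite /Cinv (bigD1 j) //= lerDl sumr_ge0 // => k _.
  by rewrite divr_ge0 ?exprn_ge0 ?opnorm_ge0.
have K0 := opnorm_gt0 (hA i); have D0 := norm_pos_det i.
have one x' y' : x' != 0 -> y' != 0 ->
  ln (enorm (A i *m x') / enorm x') - ln (enorm (A i *m y') / enorm y') <=
  2 * Cinv * (`|wedge x' y'| / (enorm x' * enorm y')).
  move=> x0 y0; have nx : 0 < enorm x' by rewrite enorm_gt0.
  have ny : 0 < enorm y' by rewrite enorm_gt0.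
  pose u := (enorm x')^-1 *: x'; pose v := (enorm y')^-1 *: y'.
  have u1 : enorm u = 1 by rewrite enormZ ger0_norm ?invr_ge0 ?enorm_ge0 // mulVf ?gt_eqF.
  have v1 : enorm v = 1 by rewrite enormZ ger0_norm ?invr_ge0 ?enorm_ge0 // mulVf ?gt_eqF.
  have -> : enorm (A i *m x') / enorm x' = enorm (A i *m u).
    by rewrite -scalemxAr enormZ ger0_norm ?invr_ge0 ?enorm_ge0 // mulrC.
  have -> : enorm (A i *m y') / enorm y' = enorm (A i *m v).
    by rewrite -scalemxAr enormZ ger0_norm ?invr_ge0 ?enorm_ge0 // mulrC.
  have -> : `|wedge x' y'| / (enorm x' * enorm y') = `|wedge u v|.
    rewrite wedgeZl wedgeZr !normrM !normfV !(ger0_norm (enorm_ge0 _)).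
    by rewrite invfM mulrC -mulrA.
  have [g [g1 hg]] := near_sign u1 v1.
  have Av : `|\det (A i)| / opnorm (A i) <= enorm (A i *m v).
    by rewrite ler_pdivrMr // mulrC; have := det_enorm (A i) v; rewrite v1 mulr1.
  have Av0 : 0 < enorm (A i *m v) by apply: lt_le_trans Av; rewrite divr_gt0.
  have Au0 : 0 < enorm (A i *m u).
    by rewrite enorm_gt0 unit_mul_neq0 // -enorm_gt0 u1.
  rewrite -ln_div ?posrE //; apply: le_trans (ln_le_sub1 (divr_gt0 Au0 Av0)) _.
  have hu : enorm (A i *m u) <= enorm (A i *m v) + opnorm (A i) * (2 * `|wedge u v|).
    have -> : A i *m u = g *: (A i *m v) + A i *m (u - g *: v).
      by rewrite mulmxBr scalemxAr addrC subrK.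
    apply: le_trans (enormD _ _) _; rewrite enormZ g1 mul1r lerD2l.
    by apply: le_trans (enorm_mul _ _) _; rewrite ler_pM2l.
  rewrite lerBlDr ler_pdivrMr // mulrDl mul1r; apply: le_trans hu _.
  rewrite addrC lerD2r.
  have h1 : opnorm (A i) <= Cinv * enorm (A i *m v).
    apply: (@le_trans _ _ (opnorm (A i) ^+ 2 / `|\det (A i)| * (`|\det (A i)| / opnorm (A i)))).
      by rewrite le_eqVlt; apply/orP; left; apply/eqP; field; rewrite !gt_eqF.
    by apply: ler_pM => //; rewrite divr_ge0 ?exprn_ge0 // ltW.
  have := ler_wpM2r (mulr_ge0 (ler0n R 2) (normr_ge0 (wedge u v))) h1.
  by congr (_ <= _); ring.
move=> x0 y0; rewrite ler_norml; apply/andP; split; last exact: one.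
rewrite lerNl opprB; apply: le_trans (one _ _ y0 x0) _.
by rewrite wedgeC normrN [enorm y * _]mulrC.
Qed.

(** The limit is the supremum of the increasing lower bounds [u k - E * theta ^+ k], each of them
    below every decreasing upper bound. *)
Lemma geo_limit (u : nat -> R) D theta : 0 <= D -> 0 < theta < 1 ->
  (forall k, `|u k.+1 - u k| <= D * theta ^+ k) ->
  exists l, forall k, `|l - u k| <= D / (1 - theta) * theta ^+ k.
Proof.
move=> D0 /andP[t0 t1] hu; set E := D / (1 - theta).
have E0 : 0 <= E by rewrite divr_ge0 // subr_ge0 ltW.
have ED : E * theta + D = E.
  by rewrite /E; field; rewrite subr_eq0 gt_eqF.
pose a k := u k - E * theta ^+ k; pose b k := u k + E * theta ^+ k.
have step k : E * theta ^+ k.+1 + D * theta ^+ k = E * theta ^+ k.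
  by rewrite -[in RHS]ED exprS; ring.
have aS k : a k <= a k.+1.
  by have := hu k; have := step k; rewrite ler_norml /a; lra.
have bS k : b k.+1 <= b k.
  by have := hu k; have := step k; rewrite ler_norml /b; lra.
have amono j k : (j <= k)%N -> a j <= a k.
  by move=> /subnK <-; elim: (k - j)%N => [|d IH] //; apply: le_trans IH (aS _).
have bmono j k : (j <= k)%N -> b k <= b j.
  by move=> /subnK <-; elim: (k - j)%N => [|d IH] //; apply: le_trans (bS _) IH.
have ab j k : a j <= b k.
  have p0 i : 0 <= E * theta ^+ i by rewrite mulr_ge0 // exprn_ge0 // ltW.
  apply: (@le_trans _ _ (a (maxn j k))); first exact/amono/leq_maxl.
  apply: (@le_trans _ _ (b (maxn j k))); last exact/bmono/leq_maxr.
  by have := p0 (maxn j k); rewrite /a /b; lra.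
have hs : has_sup [set a k | k in [set: nat]].
  by split; [exists (a 0%N), 0%N | exists (b 0%N) => _ [k _ <-]].
exists (sup [set a k | k in [set: nat]]) => k.
have l1 : a k <= sup [set a k | k in [set: nat]] by apply: ub_le_sup; [case: hs|exists k].
have l2 : sup [set a k | k in [set: nat]] <= b k.
  by apply: ge_sup; [case: hs|move=> _ [j _ <-]].
by move: l1 l2; rewrite ler_norml /a /b; move: (sup _) => l; lra.
Qed.

Lemma cone_norm_potential : norm_potential A.
Proof.
have [z cz] := sc_nonempty H.
set x0 := A ord0 *m z; have dx0 : deep x0 := cone_deep ord0 cz.
have x00 : x0 != 0 by case: dx0.
have n0 : 0 < enorm x0 by rewrite enorm_gt0.
have [c c0 hc] := deep_norm.
have [C [theta [C0 th hdet]]] := det_decay.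
have /andP[th0 th1] := th.
pose Y w := pw A w *m x0.
have Y0 w : Y w != 0 by rewrite unit_mul_neq0 // pw_unit.
have nY w : 0 < enorm (Y w) by rewrite enorm_gt0.
have Cinv0 : 0 <= Cinv.
  by apply: sumr_ge0 => a _; rewrite divr_ge0 ?exprn_ge0 ?opnorm_ge0.
(* Changing the end of a product after [k] letters turns its value at [x0] by an angle of order
   [theta ^+ k], by [det_decay], and the first letter acts on lines in a Lipschitz way; so [G k s]
   converges geometrically. *)
pose G k (s : Seq n) := ln (enorm (Y (mkseq s k.+1))) - ln (enorm (Y (mkseq (Defs.shift s) k))).
have mkS (s : Seq n) k : mkseq s k.+1 = s 0%N :: mkseq (Defs.shift s) k.
  exact: (mkseq_shift s 1 k).
have GE k s : G k s = ln (enorm (A (s 0%N) *m Y (mkseq (Defs.shift s) k)) / enorm (Y (mkseq (Defs.shift s) k))).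
  by rewrite /G mkS {1}/Y pw_cons -mulmxA ln_div // posrE // enorm_gt0 unit_mul_neq0.
pose D := 2 * Cinv * (C / c).
have D0 : 0 <= D.
  apply: mulr_ge0; first by apply: mulr_ge0.
  by apply: divr_ge0; exact: ltW.
have hG (s : Seq n) k : `|G k.+1 s - G k s| <= D * theta ^+ k.
  rewrite !GE; apply: le_trans (ln_ratio_lip _ (Y0 _) (Y0 _)) _.
  have c2 : 0 <= 2 * Cinv by apply: mulr_ge0.
  rewrite /D -[X in _ <= X]mulrA; apply: (ler_wpM2l c2).
  set v := mkseq (Defs.shift s) k.
  have -> : mkseq (Defs.shift s) k.+1 = v ++ [:: Defs.shift s k].
    by rewrite /v mkseqS cats1.
  set a := Defs.shift s k.
  have Ev : Y (v ++ [:: a]) = pw A v *m (A a *m x0) by rewrite /Y pw_cat pw_seq1 mulmxA.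
  have da : deep (A a *m x0) by apply/cone_deep/deep_cone.
  have na : 0 < enorm (A a *m x0) by rewrite enorm_gt0; case: da.
  have h1 := hc _ da v.
  have h2 := hdet x0 dx0 v; rewrite size_mkseq -/(Y v) in h2.
  have h3 : enorm (Y v) <= nw A v * enorm x0 := enorm_mul _ _.
  rewrite ler_pdivrMr ?mulr_gt0 // Ev wedge_mul normrM.
  have h4 := wedge_le (A a *m x0) x0.
  have h5 : `|\det (pw A v)| * `|wedge (A a *m x0) x0| <= `|\det (pw A v)| * (enorm (A a *m x0) * enorm x0).
    by rewrite ler_wpM2l.
  apply: le_trans h5 _.
  rewrite -(ler_pM2r n0).
  have -> : `|\det (pw A v)| * (enorm (A a *m x0) * enorm x0) * enorm x0 =
     enorm (A a *m x0) * (`|\det (pw A v)| * enorm x0 ^+ 2) by ring.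
  apply: le_trans (ler_wpM2l (ltW na) h2) _.
  have t0 : 0 <= C * theta ^+ k * enorm (Y v) by rewrite !mulr_ge0 ?exprn_ge0 ?enorm_ge0 // ltW.
  have h6 : c * (enorm (Y v) * enorm (A a *m x0)) <= enorm (pw A v *m (A a *m x0)) * enorm x0.
    apply: le_trans (ler_wpM2r (ltW n0) h1).
    by rewrite -mulrA ler_pM2l // [X in _ <= X]mulrAC ler_pM2r.
  have -> : C / c * theta ^+ k * (enorm (pw A v *m (A a *m x0)) * enorm (Y v)) * enorm x0 =
    C * theta ^+ k * enorm (Y v) * (c^-1 * (enorm (pw A v *m (A a *m x0)) * enorm x0)) by ring.
  have -> : enorm (A a *m x0) * (C * theta ^+ k * enorm (Y v) ^+ 2) =
    C * theta ^+ k * enorm (Y v) * (enorm (Y v) * enorm (A a *m x0)) by ring.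
  by rewrite ler_wpM2l // ler_pdivlMl.
have /choice[f hf] : forall s : Seq n, exists l, forall k, `|l - G k s| <= D / (1 - theta) * theta ^+ k.
  by move=> s; apply: (@geo_limit (G^~ s)).
set E := D / (1 - theta) in hf.
have E0 : 0 <= E by rewrite divr_ge0 // subr_ge0 ltW.
pose L := \sum_a `|ln (enorm (A a *m x0)) - ln (enorm x0)|.
have L0 : 0 <= L by apply: sumr_ge0.
have G0 s : `|G 0%N s| <= L.
  rewrite /G mkS /Y pw_cons !pw_nil mulmx1 mul1mx.
  by apply: (@sum_ge_elt _ _ _ (fun a => `|ln (enorm (A a *m x0)) - ln (enorm x0)|)); rewrite ?mem_index_enum.
have fb s : `|f s| <= E + L.
  have := hf s 0%N; rewrite expr0 mulr1 => h.
  by have := lerD h (G0 s); apply: le_trans; rewrite -{1}(subrK (G 0%N s) (f s)) ler_normD.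
exists (E / (1 - theta) + `|ln c| + 1), f; split.
  by rewrite ltr_wpDl // addr_ge0 // divr_ge0 // subr_ge0 ltW.
split.
  have E2 : 0 <= 2 * E / theta by apply: divr_ge0; [exact: mulr_ge0|exact: ltW].
  have EL : 0 <= 2 * (E + L) by apply: mulr_ge0 => //; exact: addr_ge0.
  exists (2 * E / theta + 2 * (E + L) + 1), theta; split.
    by apply: ltr_wpDl => //; exact: addr_ge0.
  (* [G k] sees the first [k.+1] letters only, so agreement on these leaves twice the approximation
     error; without a common letter the bound on [f] is used. *)
  split => // s t [|k] hst.
    rewrite expr0 mulr1; apply: le_trans (ler_normB _ _) _.
    have := fb s; have := fb t.
    by move: E2; lra.
  have Gst : G k s = G k t.
    rewrite /G; have -> : mkseq s k.+1 = mkseq t k.+1.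
      by apply/eq_in_map => j; rewrite mem_iota => /hst.
    have -> // : mkseq (Defs.shift s) k = mkseq (Defs.shift t) k.
    by apply/eq_in_map => j; rewrite mem_iota => hj; apply: hst.
  have h1 := hf s k; have h2 := hf t k; rewrite -Gst in h2.
  have h3 : `|f s - f t| <= 2 * (E * theta ^+ k).
    have -> : f s - f t = (f s - G k s) - (f t - G k s) by ring.
    by apply: le_trans (ler_normB _ _) _; move: h1 h2; lra.
  apply: le_trans h3 _.
  have -> : 2 * (E * theta ^+ k) = 2 * E / theta * theta ^+ k.+1.
    by rewrite exprS; field; exact: lt0r_neq0.
  by rewrite ler_wpM2r ?exprn_ge0 ?(ltW th0) // -addrA lerDl !addr_ge0 // mulr_ge0 // addr_ge0.
move=> s k; rewrite prodw_pw wseq_trunc -/(nw A _).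
(* The differences defining [G] telescope along the orbit, and the approximation errors form a
   geometric sum. *)
have key : `|birk f k s - (ln (enorm (Y (mkseq s k))) - ln (enorm x0))| <= E * ((1 - theta ^+ k) / (1 - theta)).
  elim: k s => [|k IH] s.
    by rewrite /birk big_ord0 /Y pw_nil mul1mx !subrr normr0 mul0r mulr0.
  have -> : birk f k.+1 s = f s + birk f k (Defs.shift s).
    by rewrite /birk big_ord_recl; congr (_ + _); apply: eq_bigr => j _; rewrite -iterSr.
  have -> : f s + birk f k (Defs.shift s) - (ln (enorm (Y (mkseq s k.+1))) - ln (enorm x0)) =
     (f s - G k s) + (birk f k (Defs.shift s) - (ln (enorm (Y (mkseq (Defs.shift s) k))) - ln (enorm x0))).
    by rewrite /G; ring.
  apply: le_trans (ler_normD _ _) _; apply: le_trans (lerD (hf s k) (IH _)) _.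
  rewrite -mulrDr ler_wpM2l // le_eqVlt; apply/orP; left; apply/eqP; rewrite exprS; field.
  by rewrite subr_eq0 gt_eqF.
have N0 := nw_gt0 hA (mkseq s k).
have c1 : c <= 1.
  have := hc x0 dx0 [::]; rewrite nw_nil pw_nil mul1mx mul1r.
  by rewrite -{2}[enorm x0]mul1r ler_pM2r.
have key2 : `|ln (enorm (Y (mkseq s k))) - ln (enorm x0) - ln (nw A (mkseq s k))| <= `|ln c|.
  have -> : ln (enorm (Y (mkseq s k))) - ln (enorm x0) - ln (nw A (mkseq s k)) =
     ln (enorm (Y (mkseq s k))) - ln (nw A (mkseq s k) * enorm x0).
    by rewrite lnM ?posrE //; ring.
  rewrite (ler0_norm (ln_le0 c1)); have <- : ln c^-1 = - ln c by rewrite lnV ?posrE.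
  apply: ln_between; rewrite ?invf_ge1 // ?mulr_gt0 // ?invrK; first exact: hc.
  apply: le_trans (enorm_mul _ _) _; rewrite ler_peMl ?mulr_ge0 ?(ltW N0) ?(ltW n0) //.
  by rewrite invf_ge1.
have -> : birk f k s - ln (nw A (mkseq s k)) =
  (birk f k s - (ln (enorm (Y (mkseq s k))) - ln (enorm x0))) +
  (ln (enorm (Y (mkseq s k))) - ln (enorm x0) - ln (nw A (mkseq s k))) by ring.
apply: le_trans (ler_normD _ _) _; apply: le_trans (lerD key key2) _.
rewrite -addrA lerD //; last by rewrite lerDl.
rewrite ler_wpM2l // ler_piMl ?invr_ge0 ?subr_ge0 ?(ltW th1) // gerBl exprn_ge0 // ltW //.
Qed.

End Domination.
End Cones.

(** * Conformal families *)

Section Conformal.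
Context {R : realType} {n : nat}.
Variable A : Alph n -> 'M[R]_2.
Hypothesis hA : forall i, A i \in unitmx.

Lemma orthogonal_isometry (B : 'M[R]_2) (v : 'cV[R]_2) : B *m B^T = 1%:M -> enorm (B *m v) = enorm v.
Proof.
move=> /mulmx1C hB; apply/eqP; rewrite -(@eqrXn2 _ 2) ?enorm_ge0 // !enorm_sqr.
have h i j : (B^T *m B) i j = (1%:M : 'M[R]_2) i j by rewrite hB.
have := h 0 0; have := h 0 1; have := h 1 1; rewrite !mulmx22 !mxE /= /inner !mulmx2v.
set b00 := B 0 0; set b01 := B 0 1; set b10 := B 1 0; set b11 := B 1 1.
move=> h11 h01 h00; apply/eqP.
have -> : (b00 * v 0 0 + b01 * v 1 0) * (b00 * v 0 0 + b01 * v 1 0) +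
   (b10 * v 0 0 + b11 * v 1 0) * (b10 * v 0 0 + b11 * v 1 0) =
   (b00 * b00 + b10 * b10) * v 0 0 * v 0 0 + 2 * (b00 * b01 + b10 * b11) * v 0 0 * v 1 0
   + (b01 * b01 + b11 * b11) * v 1 0 * v 1 0 by ring.
by rewrite h00 h01 h11; ring.
Qed.

(** The norm [enorm (M *m v)] is multiplied by exactly [sqrt |det (A i)|] at each letter; the
    condition number of [M] compares it with the Euclidean norm. *)
Lemma conformal_norm_potential : strongly_conformal A -> norm_potential A.
Proof.
move=> [M [hM hB]].
pose c i : R := (`|\det (A i)| `^ (- 2^-1))^-1.
have c0 i : 0 < c i by rewrite invr_gt0 powR_gt0 // normr_gt0 -unit_det.
have step i v : enorm (M *m A i *m invmx M *m v) = c i * enorm v.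
  have := orthogonal_isometry v (hB i); rewrite -scalemxAl enormZ => <-.
  rewrite gtr0_norm ?powR_gt0 ?normr_gt0 -?unit_det // mulrA mulVf ?mul1r //.
  by rewrite gt_eqF // powR_gt0 // normr_gt0 -unit_det.
pose cw w := \prod_(a <- w) c a.
have cw0 w : 0 < cw w by rewrite /cw; elim/big_rec: _ => // i x _ x0; rewrite mulr_gt0.
have iso w v : enorm (M *m (pw A w *m v)) = cw w * enorm (M *m v).
  elim: w v => [|a w IH] v; first by rewrite pw_nil mul1mx /cw big_nil mul1r.
  rewrite /cw big_cons -/(cw w) -mulrA -IH pw_cons -step !mulmxA.
  by rewrite (mulmxKV hM).
have M0 := opnorm_gt0 hM.
have hiM : invmx M \in unitmx by rewrite unitmx_inv.
have iM0 := opnorm_gt0 hiM.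
set K := opnorm M * opnorm (invmx M).
have K0 : 0 < K by rewrite mulr_gt0.
have K1 : 1 <= K by rewrite -opnorm1 -(mulmxV hM) opnormM.
have up w : nw A w <= K * cw w.
  apply: opnorm_le => v; rewrite -{1}(mulKmx hM (pw A w *m v)).
  apply: le_trans (enorm_mul _ _) _; rewrite iso /K.
  have := enorm_mul M v; rewrite -(ler_pM2l (mulr_gt0 iM0 (cw0 w))).
  by congr (_ <= _); ring.
have lo w : K^-1 * cw w <= nw A w.
  rewrite ler_pdivrMl //; have [x [x1 _]] := opnorm_col_half M.
  have v0 : invmx M *m x != 0 by rewrite unit_mul_neq0 // -enorm_gt0 x1.
  have := iso w (invmx M *m x); rewrite mulKVmx // x1 mulr1 => <-.
  apply: le_trans (enorm_mul _ _) _; rewrite /K -mulrA ler_pM2l // mulrC.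
  apply: le_trans (enorm_mul _ _) _; rewrite -/(nw A w) ler_wpM2l ?opnorm_ge0 //.
  by apply: le_trans (enorm_mul _ _) _; rewrite x1 mulr1.
exists (ln K + 1), (fun s : Seq n => 0 + ln (c (s 0%N))); split.
  by rewrite ltr_wpDl // ln_ge0.
split.
  apply: (holder_letter (fun i => ln (c i))); exists 1, 2^-1; split => //.
  split; first by apply/andP; split; lra.
  by move=> x y k _; rewrite subrr normr0 mul1r exprn_ge0 // invr_ge0.
move=> x k; rewrite prodw_pw wseq_trunc -/(nw A _) (birk_letter (fun=> 0) (fun i => ln (c i))).
have -> : birk (fun=> 0) k x + \sum_(a <- mkseq x k) ln (c a) = ln (cw (mkseq x k)).
  rewrite /birk big1 // add0r /cw; elim: (mkseq x k) => [|a w IH]; first by rewrite !big_nil ln1.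
  by rewrite !big_cons lnM ?posrE ?IH // (cw0 w).
rewrite distrC; apply: (@le_trans _ _ (ln K)); last by rewrite lerDl.
exact: ln_between.
Qed.

End Conformal.

Lemma norm_potential_of_cone {R : realType} {n : nat} (A : Alph n -> 'M[R]_2) :
  (forall i, A i \in unitmx) -> irreducible A ->
  (exists M : set R, multicone M /\ strongly_invariant M A) \/ strongly_conformal A ->
  norm_potential A.
Proof.
move=> hA hirr [[M [hM hS]]|hc]; last exact: conformal_norm_potential.
have [e He] := multicone_strict hA hM hS hirr.
exact: cone_norm_potential He.
Qed.

Lemma mulmx_ext {R : realType} (A B : 'M[R]_2) : (forall x : 'cV_2, A *m x = B *m x) -> A = B.
Proof.
move=> h; have c j : col j A = col j B by rewrite !colE h.
by apply/matrixP => i j; have /matrixP/(_ i 0) := c j; rewrite !mxE.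
Qed.

Lemma ultra_map (T T' : Type) (U : set_system T) (f : T -> T') :
  UltraFilter U -> UltraFilter (f @ U).
Proof.
move=> UU; split=> [|G GF sG]; first exact: fmap_proper_filter.
apply/seteqP; split=> // A GA; have [//|UnA] := in_ultra_setVsetC (f @^-1` A) UU.
have GnA : G (~` A) by apply: sG.
by have /filter_ex[x []] : G (A `&` ~` A) by exact: filterI.
Qed.

(** * Ultralimits and bounded semigroups *)

Section UltraLimits.
Context {R : realType}.
Variable U : set_system nat.
Hypothesis UU : UltraFilter U.
Hypothesis Uoo : \oo `<=` U.

Let PU : ProperFilter U := ultra_proper.

(** An ultrafilter gives limits to all bounded sequences at once, compatible with sums and products,
    so no subsequence has to be extracted. *)
Lemma ultra_lim (u : nat -> R) (K : R) : (forall k, `|u k| <= K) ->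
  exists l : R, u @ U --> l.
Proof.
move=> hu; have := @segment_compact R (- K) K; rewrite compact_ultra => /(_ (u @ U)).
case=> [||l [_ hl]]; last by exists l.
  exact: ultra_map.
apply: (@filterS _ U _ [set: nat]); last exact: filterT.
by move=> k _; rewrite /= in_itv /= -ler_norml.
Qed.

Definition mcvg (F : nat -> 'M[R]_2) (L : 'M[R]_2) :=
  forall i j, (fun k => F k i j) @ U --> L i j.

Lemma mcvg_ex (F : nat -> 'M[R]_2) K : (forall k, opnorm (F k) <= K) -> exists L, mcvg F L.
Proof.
move=> hF; have /choice[g hg] : forall ij : 'I_2 * 'I_2, exists l : R, (fun k => F k ij.1 ij.2) @ U --> l.
  by move=> [i j]; apply: (ultra_lim (K := K)) => k; apply: le_trans (entry_le_opnorm _ _ _) (hF k).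
by exists (\matrix_(i, j) g (i, j)) => i j; rewrite mxE; exact: hg (i, j).
Qed.

Lemma mcvg_cst (L : 'M[R]_2) : mcvg (fun=> L) L.
Proof. by move=> i j; exact: cvg_cst. Qed.

Lemma mcvg_mul F G L M : mcvg F L -> mcvg G M -> mcvg (fun k => F k *m G k) (L *m M).
Proof.
move=> hF hG i j; rewrite mulmx22.
under eq_fun do rewrite mulmx22.
by apply: cvgD; apply: cvgM.
Qed.

Lemma mcvg_det F L : mcvg F L -> (fun k => \det (F k)) @ U --> \det L.
Proof.
move=> hF; rewrite det2; under eq_fun do rewrite det2.
by apply: cvgB; apply: cvgM.
Qed.

Lemma mcvg_opnorm F L : mcvg F L -> (fun k => opnorm (F k)) @ U --> opnorm L.
Proof.
move=> hF; apply/cvgrPdist_le => e e0.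
have e4 : 0 < e / 4 by rewrite divr_gt0.
have h i j : \forall k \near U, `|L i j - F k i j| <= e / 4.
  by move: (hF i j) => /cvgrPdist_le; apply.
near=> k.
have := opnorm_le_entries (L - F k); rewrite !mxE => hh.
have h00 : `|L 0 0 - F k 0 0| <= e / 4 by near: k; exact: h.
have h01 : `|L 0 1 - F k 0 1| <= e / 4 by near: k; exact: h.
have h10 : `|L 1 0 - F k 1 0| <= e / 4 by near: k; exact: h.
have h11 : `|L 1 1 - F k 1 1| <= e / 4 by near: k; exact: h.
have hLF : opnorm (L - F k) <= e by lra.
have t1 : opnorm L <= opnorm (L - F k) + opnorm (F k) by rewrite -{1}(subrK (F k) L) opnormD.
have t2 : opnorm (F k) <= opnorm (L - F k) + opnorm L.
  have -> : opnorm (L - F k) = opnorm (F k - L).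
    by rewrite -opprB -scaleN1r opnormZ normrN1 mul1r.
  by rewrite -{1}(subrK L (F k)) opnormD.
by rewrite ler_norml; apply/andP; split; lra.
Unshelve. all: by end_near. Qed.

Lemma ultra_le (u v : nat -> R) (a b : R) : u @ U --> a -> v @ U --> b ->
  (forall k, u k <= v k) -> a <= b.
Proof. by move=> hu hv h; apply: ler_cvg_to hu hv _; exact: nearW. Qed.

Lemma ultra_unique (u : nat -> R) (a b : R) : u @ U --> a -> u @ U --> b -> a = b.
Proof. exact: cvg_unique. Qed.

Lemma ultra_of_oo (u : nat -> R) (a : R) : u @ \oo --> a -> u @ U --> a.
Proof. by move=> h A /h hA; exact: Uoo. Qed.

(** Bernoulli's inequality, applied to [x] and to its inverse. *)
Lemma power_bounded_eq1 (x a b c : R) : 0 <= x -> 0 < a -> 0 < b ->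
  (forall k, a <= x ^+ k * b) -> (forall k, x ^+ k * b <= c) -> x = 1.
Proof.
move=> x0 a0 b0 lo up.
have bern (y : R) k : 1 <= y -> 1 + k%:R * (y - 1) <= y ^+ k.
  move=> y1; elim: k => [|k IH]; first by rewrite mul0r addr0 expr0.
  rewrite exprS; apply: (@le_trans _ _ (y * (1 + k%:R * (y - 1)))); last by rewrite ler_wpM2l // (le_trans ler01).
  have : 0 <= k%:R * (y - 1) * (y - 1) by rewrite !mulr_ge0 ?subr_ge0.
  by rewrite -natr1; lra.
have no (y d : R) : (forall k, y ^+ k <= d) -> y <= 1.
  move=> h; rewrite leNgt; apply/negP => y1.
  have : y - 1 <= 0.
    apply: (@archi_le R _ _ d) => M; rewrite mulr0 addr0.
    apply: le_trans (h M.+1); have := bern y M.+1 (ltW y1); lra.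
  by rewrite subr_le0 leNgt y1.
have xle : x <= 1 by apply: (no x (c / b)) => k; rewrite ler_pdivlMr.
have xp : 0 < x.
  rewrite lt0r x0 andbT; apply/eqP => xz; have := lo 1%N; rewrite expr1 xz mul0r; lra.
have : x^-1 <= 1.
  apply: (no _ (b / a)) => k; rewrite exprVn ler_pdivlMr // mulrC ler_pdivrMr ?exprn_gt0 // mulrC //.
rewrite invf_le1 // => x1; apply/eqP; rewrite eq_le xle x1 //.
Qed.

(* A power-bounded [h] with [|det h| < 1] converges (along [U]) to a rank one [P], and
   [P Q P] is a multiple of [P] for every [Q]; boundedness forces all these multiples to
   be unimodular, which is only possible if an eigenline of [h] is invariant. *)
Lemma semigroup_line (S : 'M[R]_2 -> Prop) (K : R) (h : 'M[R]_2) :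
  (forall P Q, S P -> S Q -> S (P *m Q)) -> 0 < K ->
  (forall Q, S Q -> K^-1 <= opnorm Q <= K) ->
  S h -> 0 < `|\det h| < 1 ->
  exists2 v : 'cV[R]_2, v != 0 & forall Q, S Q -> exists c, Q *m v = c *: v.
Proof.
move=> SM K0 SK Sh /andP[dh0 dh1].
(* Limits of sequences in [S] inherit the semigroup law and the norm bounds. *)
pose S' L := exists2 F : nat -> 'M[R]_2, (forall k, S (F k)) & mcvg F L.
have SS' Q : S Q -> S' Q by move=> SQ; exists (fun=> Q) => //; exact: mcvg_cst.
have S'M P Q : S' P -> S' Q -> S' (P *m Q).
  move=> [F SF hF] [G SG hG]; exists (fun k => F k *m G k); last exact: mcvg_mul.
  by move=> k; exact: SM.
have S'K L : S' L -> K^-1 <= opnorm L <= K.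
  move=> [F SF hF]; have hn := mcvg_opnorm hF.
  apply/andP; split; [apply: (ultra_le (cvg_cst _) hn)|apply: (ultra_le hn (cvg_cst _))] => k;
  by have /andP[] := SK _ (SF k).
pose hp := fix hp k := if k is k'.+1 then h *m hp k' else h.
have Shp k : S (hp k) by elim: k => //= k IH; exact: SM.
have hpC k : h *m hp k = hp k *m h.
  by elim: k => //= k IH; rewrite {1}IH mulmxA.
have [P hP] : exists P, mcvg hp P.
  by apply: (@mcvg_ex _ K) => k; case/andP: (SK _ (Shp k)).
have S'P : S' P by exists hp.
have detP : \det P = 0.
  have e1 := mcvg_det hP.
  have e2 : (fun k => \det (hp k)) @ U --> (0 : R).
    apply: ultra_of_oo.
    have -> : (fun k => \det (hp k)) = (fun k => \det h * (\det h) ^+ k).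
      by apply: funext; elim=> [|k IH]; rewrite /= ?mulr1 // det_mulmx IH exprS.
    rewrite -(mulr0 (\det h)); apply: cvgM; first exact: cvg_cst.
    exact: cvg_expr.
  exact: ultra_unique e1 e2.
have hPc : h *m P = P *m h.
  have c1 : mcvg (fun k => h *m hp k) (h *m P) by apply: mcvg_mul hP; exact: mcvg_cst.
  have c2 : mcvg (fun k => hp k *m h) (P *m h) by apply: (mcvg_mul hP); exact: mcvg_cst.
  apply/matrixP => i j; apply: (ultra_unique (c1 i j)).
  by under eq_fun do rewrite hpC; exact: c2.
have nP : 0 < opnorm P by have /andP[p _] := S'K _ S'P; apply: lt_le_trans p; rewrite invr_gt0.
have [x0 [x01 hx0]] := opnorm_col_half P.
pose u := P *m x0.
have u0 : u != 0 by rewrite -enorm_gt0 /u; lra.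
have nu : enorm u ^+ 2 != 0 by rewrite expf_eq0 /= enorm_eq0.
pose phi x := inner u (P *m x) / enorm u ^+ 2.
have phiE x : P *m x = phi x *: u.
  have [c hc] : exists c, P *m x = c *: u.
    by apply: wedge_eq0_scale u0 _; rewrite wedge_mul detP mul0r.
  have -> // : phi x = c.
  rewrite /phi hc; have -> : inner u (c *: u) = c * enorm u ^+ 2.
    by rewrite enorm_sqr /inner !mxE; ring.
  by rewrite mulfK.
have phi_uniq x c : P *m x = c *: u -> phi x = c.
  rewrite phiE => /eqP; rewrite -subr_eq0 -scalerBl scaler_eq0 (negbTE u0) orbF subr_eq0 => /eqP //.
have phiD x y : phi (x + y) = phi x + phi y.
  by apply: phi_uniq; rewrite mulmxDr !phiE scalerDl.
have phiZ c x : phi (c *: x) = c * phi x.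
  by apply: phi_uniq; rewrite -scalemxAr phiE scalerA.
(* Since [P] has rank one, [P *m Q *m P = t *: P]; all [t ^+ k *: P] lie in [S'], whose norms are
   bounded on both sides. *)
have tQ Q : (forall L, S' L -> S' (Q *m L)) -> `|phi (Q *m u)| = 1.
  move=> SQ; set t := phi _.
  have pow k : S' (t ^+ k *: P).
    elim: k => [|k IH]; first by rewrite expr0 scale1r.
    have -> : t ^+ k.+1 *: P = P *m (Q *m (t ^+ k *: P)).
      have E : P *m (Q *m P) = t *: P.
        apply: mulmx_ext => x; have e1 : P *m (Q *m P) *m x = P *m (Q *m (P *m x)) by rewrite !mulmxA.
        rewrite e1 (phiE x) -!scalemxAr phiE -/t -scalemxAl (phiE x) !scalerA; congr (_ *: _); exact: mulrC.
      by rewrite -!scalemxAr E scalerA exprSr.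
    by apply: S'M => //; exact: SQ.
  apply: (@power_bounded_eq1 _ K^-1 (opnorm P) K); rewrite ?normr_ge0 ?invr_gt0 // => k;
  by have /andP[] := S'K _ (pow k); rewrite opnormZ normrX.
have tS Q : S Q -> `|phi (Q *m u)| = 1.
  by move=> SQ; apply: tQ => L; apply: S'M; exact: SS'.
have t1 : `|phi u| = 1 by rewrite -[u]mul1mx; apply: tQ => L; rewrite mul1mx.
have phu0 : phi u != 0 by rewrite -normr_gt0 t1.
(* [phi u] has modulus 1, so the kernel of [P], spanned by [u'], is transverse to [u]; [h] commutes
   with [P] and is therefore diagonal in this basis. *)
have [u' u'0 phu'] : exists2 u', wedge u u' != 0 & phi u' = 0.
  pose x := vperp u; exists (x + (- (phi x / phi u)) *: u); last by rewrite phiD phiZ mulNr mulfVK // subrr.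
  by rewrite wedgeDr wedgeZr wedgexx mulr0 addr0 wedge_perp.
have dec x : exists a b, x = a *: u + b *: u'.
  exists (wedge x u' / wedge u u'), (- (wedge x u / wedge u u')).
  apply: (scalerI u'0); rewrite plucker scalerDr !scalerA mulrN !(mulrC (wedge u u')) !mulfVK //.
  by rewrite scaleNr.
have h_u : exists2 a, h *m u = a *: u & `|a| = 1.
  exists (phi (h *m x0)); first by rewrite /u mulmxA hPc -mulmxA phiE.
  have : `|phi (h *m u)| = 1 by exact: tS.
  by rewrite {1}/u mulmxA hPc -mulmxA phiE phiZ normrM t1 mulr1.
have [a ha a1] := h_u.
have [m hm] : exists m, h *m u' = m *: u'.
  have [b [m hm]] := dec (h *m u'); exists m; rewrite hm.
  have : P *m (h *m u') = 0 by rewrite mulmxA -hPc -mulmxA phiE phu' scale0r mulmx0.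
  rewrite hm phiE phiD !phiZ phu' mulr0 addr0 => /eqP; rewrite scaler_eq0 (negbTE u0) orbF.
  by rewrite mulf_eq0 (negbTE phu0) orbF => /eqP ->; rewrite scale0r add0r.
have am : \det h = a * m.
  apply: (mulIf u'0); rewrite -wedge_mul ha hm wedgeZl wedgeZr; ring.
have key Q Z al be : S Q -> S Z -> Z *m u = al *: u + be *: u' -> be * phi (Q *m u') = 0.
  move=> SQ SZ hZ.
  have al1 : `|al| = 1.
    by have := tS Z SZ; rewrite hZ phiD !phiZ phu' mulr0 addr0 normrM t1 mulr1.
  have := tS (Q *m Z) (SM _ _ SQ SZ); have := tS (Q *m (h *m Z)) (SM _ _ SQ (SM _ _ Sh SZ)).
  rewrite -!mulmxA hZ !mulmxDr -!scalemxAr ha hm -!scalemxAr !phiD !phiZ.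
  have pQ : `|phi (Q *m u)| = 1 by exact: tS.
  set q := phi (Q *m u').
  have p1 : `|al * phi (Q *m u)| = 1 by rewrite normrM al1 pQ mulr1.
  set p := al * phi _ in p1 *.
  have -> : al * (a * phi (Q *m u)) + be * (m * q) = a * p + m * (be * q) by rewrite /p; ring.
  set r := be * q => e2 e1.
  have am1 : `|a * m| < 1 by rewrite -am.
  have am0 : 0 < `|a * m| by rewrite -am.
  have m0 : 0 < `|m| by move: am0; rewrite normrM a1 mul1r.
  have m1 : `|m| < 1 by move: am1; rewrite normrM a1 mul1r.
  apply/eqP; case: (eqVneq r 0) => // r0; exfalso.
  have sq (x : R) : `|x| = 1 -> x ^+ 2 = 1 by move=> hx; rewrite -real_normK ?num_real // hx expr1n.
  have m2 : m ^+ 2 < 1 by rewrite -real_normK ?num_real // expr_lt1.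
  have a2 := sq _ a1; have p2 := sq _ p1; have q1 := sq _ e1; have q2 := sq _ e2.
  (* Over the reals [p] and [p + r] are signs, so a nonzero [r] equals [- 2 * p]. Then
     [(a - 2 * m) ^+ 2 = a ^+ 2] leaves [m = 0] or [m = a], against [0 < |m| < 1]. *)
  have rp : r = - 2 * p.
    apply: (mulIf r0); move: q1; rewrite sqrrD p2; lra.
  have mm : m * (m - a) = 0.
    have : (a * p + m * r) ^+ 2 = a ^+ 2 * p ^+ 2 + 4 * p ^+ 2 * (m * (m - a)) by rewrite rp; ring.
    rewrite q2 a2 p2; lra.
  have : m = 0 \/ m = a.
    by move/eqP: mm; rewrite mulf_eq0 subr_eq0 => /orP[] /eqP; [left|right].
  by case=> mE; move: m0 m1; rewrite mE ?normr0 ?a1 ltxx.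
(* If some element moves [u] off its line, [key] makes the kernel line of [P] invariant; otherwise
   the line of [u] is. *)
have [[Z [SZ [al [be [hZ be0]]]]]|no] := pselect (exists Z, S Z /\ exists al be, Z *m u = al *: u + be *: u' /\ be != 0).
  exists u' => [|Q SQ].
    by apply: contraNneq u'0 => ->; rewrite /wedge !mxE !mulr0 subrr.
  have [al' [be' hQ]] := dec (Q *m u'); exists be'; rewrite hQ.
  have /eqP := key Q Z al be SQ SZ hZ; rewrite mulf_eq0 (negbTE be0) /= hQ phiD !phiZ phu' mulr0 addr0.
  by rewrite mulf_eq0 (negbTE phu0) orbF => /eqP ->; rewrite scale0r add0r.
exists u => // Q SQ; have [al [be hQ]] := dec (Q *m u); exists al.
case: (eqVneq be 0) hQ => [-> ->|be0 hQ]; first by rewrite scale0r addr0.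
by case: no; exists Q; split => //; exists al, be.
Qed.
End UltraLimits.

(** * From large almost multiplicative products to a multicone *)

Section ConeOfExpansion.
Context {R : realType} {n : nat}.
Variable B : Alph n -> 'M[R]_2.
Hypothesis hdet : forall i, `|\det (B i)| = 1.
Variable kap : R.
Hypothesis kap01 : 0 < kap <= 1.
Hypothesis hkap : forall u v, kap * (nw B u * nw B v) <= nw B (u ++ v).
Hypothesis hinf : forall L : R, exists m, forall w, (m <= size w)%N -> L < nw B w.
Implicit Types (u v w : seq (Alph n)) (x y z : 'cV[R]_2).

Lemma unit_of_det i : B i \in unitmx.
Proof. by rewrite unit_det -normr_gt0 hdet. Qed.
Let hB := unit_of_det.

Lemma det_pw w : `|\det (pw B w)| = 1.
Proof.
elim: w => [|a w IH]; first by rewrite pw_nil det1 normr1.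
by rewrite pw_cons det_mulmx normrM hdet IH mulr1.
Qed.

Lemma wedge_pw w x y : `|wedge (pw B w *m x) (pw B w *m y)| = `|wedge x y|.
Proof. by rewrite wedge_mul normrM det_pw mul1r. Qed.

Definition expanding c x := x != 0 /\ forall w, c * (nw B w * enorm x) <= enorm (pw B w *m x).

Lemma expandingZ c a x : a != 0 -> expanding c x -> expanding c (a *: x).
Proof.
move=> a0 [x0 h]; split; first by rewrite scaler_eq0 negb_or a0.
move=> w; rewrite -scalemxAr !enormZ.
have -> : c * (nw B w * (`|a| * enorm x)) = `|a| * (c * (nw B w * enorm x)) by ring.
by rewrite ler_pM2l ?normr_gt0.
Qed.

Lemma expanding_le c c' x : c' <= c -> expanding c x -> expanding c' x.
Proof.
move=> cc [x0 h]; split => // w; apply: le_trans (h w).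
by rewrite ler_wpM2r // mulr_ge0 ?enorm_ge0 ?opnorm_ge0.
Qed.

(* [pw v] is nearly of rank one with range spanned by [pw v x], so almost
   multiplicativity of the norm along [w ++ v] is felt at [pw v x]. *)
Lemma expanding_image v x : x != 0 -> 4 / kap <= nw B v ->
  kap / 8 * (nw B v * enorm x) <= enorm (pw B v *m x) -> expanding (kap / 2) (pw B v *m x).
Proof.
have /andP[k0 k1] := kap01.
move=> x0 hv hx; set y := pw B v *m x in hx *.
have y0 : y != 0 by rewrite unit_mul_neq0 // pw_unit.
split=> // w; have ny : 0 < enorm y by rewrite enorm_gt0.
have nx : 0 < enorm x by rewrite enorm_gt0.
have nv := nw_gt0 hB v; have nww := nw_gt0 hB w.
have main z : enorm y * enorm (pw B w *m (pw B v *m z)) <=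
   (nw B v * enorm (pw B w *m y) + nw B w * enorm x) * enorm z.
  set q := pw B v *m z.
  have fr := frame y q.
  have e1 : enorm y ^+ 2 * enorm (pw B w *m q) <=
     enorm y * (nw B v * enorm (pw B w *m y) + nw B w * enorm x) * enorm z.
    rewrite -[enorm y ^+ 2]ger0_norm ?exprn_ge0 ?enorm_ge0 // -enormZ scalemxAr fr mulmxDr -!scalemxAr.
    apply: le_trans (enormD _ _) _; rewrite !enormZ.
    have i1 : `|inner y q| <= enorm y * (nw B v * enorm z).
      by apply: le_trans (inner_le _ _) _; rewrite ler_pM2l // enorm_mul.
    have i2 : `|wedge y q| <= enorm x * enorm z by rewrite wedge_pw wedge_le.
    have i3 : enorm (pw B w *m vperp y) <= nw B w * enorm y by rewrite -(enorm_perp y) enorm_mul.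
    have j1 := ler_wpM2r (enorm_ge0 (pw B w *m y)) i1.
    have j2 := ler_pM (normr_ge0 _) (enorm_ge0 _) i2 i3.
    apply: le_trans (lerD j1 j2) _; rewrite le_eqVlt; apply/orP; left; apply/eqP; ring.
  by move: e1; rewrite expr2 -mulrA -[X in _ <= X]mulrA ler_pM2l.
have e2 : enorm y * nw B (w ++ v) <= nw B v * enorm (pw B w *m y) + nw B w * enorm x.
  rewrite -[enorm y]ger0_norm ?enorm_ge0 // -opnormZ; apply: opnorm_le => z.
  by rewrite -scalemxAl enormZ ger0_norm ?enorm_ge0 // pw_cat -mulmxA main.
have e3 := ler_wpM2l (ltW ny) (hkap w v).
have e4 : nw B w * enorm x <= kap / 2 * (nw B w * nw B v) * enorm y.
  have -> : kap / 2 * (nw B w * nw B v) * enorm y = nw B w * (kap / 2 * nw B v * enorm y) by ring.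
  rewrite ler_pM2l //; apply: le_trans (ler_wpM2l _ hx); last by rewrite !mulr_ge0 // ltW // divr_gt0.
  have -> : kap / 2 * nw B v * (kap / 8 * (nw B v * enorm x)) = ((kap / 4 * nw B v) ^+ 2) * enorm x by field.
  rewrite ler_peMl ?enorm_ge0 // exprn_ege1 //.
  by move: hv; rewrite ler_pdivrMr // mulrC => hv; lra.
suff : nw B v * (kap / 2 * (nw B w * enorm y)) <= nw B v * enorm (pw B w *m y) by rewrite ler_pM2l.
have := le_trans e3 e2; move: e4.
have -> : enorm y * (kap * (nw B w * nw B v)) = kap * (nw B w * nw B v) * enorm y by ring.
have -> : nw B v * (kap / 2 * (nw B w * enorm y)) = kap / 2 * (nw B w * nw B v) * enorm y by ring.
have -> : kap * (nw B w * nw B v) * enorm y = 2 * (kap / 2 * (nw B w * nw B v) * enorm y) by field.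
move: (kap / 2 * _ * _) (nw B w * enorm x) (nw B v * _) => a b c; lra.
Qed.

Lemma enorm_mul_near (P : 'M[R]_2) c d x y : x != 0 -> y != 0 ->
  `|wedge x y| <= d * (enorm x * enorm y) -> c * (opnorm P * enorm x) <= enorm (P *m x) ->
  (c - 2 * d) * (opnorm P * enorm y) <= enorm (P *m y).
Proof.
move=> x0 y0; have nx : 0 < enorm x by rewrite enorm_gt0.
have ny : 0 < enorm y by rewrite enorm_gt0.
have nrm z : z != 0 -> exists2 z', enorm z' = 1 & z = enorm z *: z'.
  rewrite -enorm_gt0 => z0; exists ((enorm z)^-1 *: z).
    by rewrite enormZ gtr0_norm ?invr_gt0 // mulVf // gt_eqF.
  by rewrite scalerA mulfV ?scale1r // gt_eqF.
have [x' x'1 ex] := nrm x x0; have [y' y'1 ey] := nrm y y0.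
move: (enorm x) (enorm y) nx ny ex ey => a b a0 b0 -> ->.
rewrite -!scalemxAr !enormZ wedgeZl wedgeZr !normrM !(gtr0_norm a0) !(gtr0_norm b0).
have -> : a * (b * `|wedge x' y'|) = `|wedge x' y'| * (a * b) by ring.
rewrite ler_pM2r ?mulr_gt0 // => hd.
have -> : c * (opnorm P * a) = a * (c * opnorm P) by ring.
rewrite ler_pM2l // => hP.
have -> : (c - 2 * d) * (opnorm P * b) = b * (c * opnorm P - 2 * d * opnorm P) by ring.
rewrite ler_pM2l //.
have [e [he hxy]] := near_sign x'1 y'1.
have t : enorm (P *m x') <= opnorm P * enorm (x' - e *: y') + enorm (P *m y').
  have -> : P *m x' = P *m (x' - e *: y') + e *: (P *m y').
    by rewrite mulmxBr -scalemxAr subrK.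
  by apply: le_trans (enormD _ _) _; rewrite enormZ he mul1r lerD2r enorm_mul.
have t2 := ler_wpM2l (opnorm_ge0 P) (le_trans hxy (ler_wpM2l (ler0n _ 2) hd)).
lra.
Qed.

Lemma nw_short_le m : exists2 K, 1 <= K & forall w, (size w <= m)%N -> nw B w <= K.
Proof.
pose L := 1 + \sum_i opnorm (B i).
have L1 : 1 <= L by rewrite lerDl sumr_ge0 // => i _; exact: opnorm_ge0.
have L0 : 0 <= L := le_trans ler01 L1.
exists (L ^+ m) => [|w hw]; first exact: exprn_ege1.
apply: (@le_trans _ _ (L ^+ size w)); last exact: ler_weXn2l.
elim: w {hw} => [|a w IH]; first by rewrite nw_nil expr0.
rewrite /= exprS; apply: le_trans (nw_cat B [:: a] w) _.
rewrite ler_pM ?opnorm_ge0 // /nw pw_seq1 /L (bigD1 a) //= addrCA lerDl.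
by rewrite addr_ge0 // sumr_ge0 // => i _; exact: opnorm_ge0.
Qed.

(** [x] is chosen so that its image is orthogonal to that of an almost maximally expanded [q]. Areas
    are preserved, so a large norm makes the image of [x] short relative to [x]. *)
Lemma not_expanding c : 0 < c -> exists2 x, x != 0 & ~ expanding c x.
Proof.
move=> c0; have [m hm] := hinf (1 + 2 / c).
pose w := nseq m (ord0 : Alph n).
have := hm w; rewrite size_nseq leqnn => /(_ isT) hw.
have [q [q1 hq]] := opnorm_col_half (pw B w); rewrite -/(nw B w) in hq.
have hP : pw B w \in unitmx by exact: pw_unit.
have c2 : 0 < 2 / c by rewrite divr_gt0.
have Pq0 : 0 < enorm (pw B w *m q) by lra.
pose x := invmx (pw B w) *m vperp (pw B w *m q).
have x0 : x != 0 by rewrite unit_mul_neq0 ?unitmx_inv // -enorm_gt0 enorm_perp.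
exists x => // -[_ /(_ w)]; have := wedge_pw w q x; have := wedge_le q x.
rewrite q1 mul1r /x mulKVmx // -/x wedge_perp enorm_perp => h1 h2 h3.
have nx : 0 < enorm x by rewrite enorm_gt0.
rewrite -h2 ger0_norm ?exprn_ge0 ?enorm_ge0 // in h1.
move: h1 h3 hq Pq0 hw c2 nx; move: (enorm _) (nw B w) (enorm x) => p N X h1 h3 hq p0 hw c2 X0.
have N0 : 0 < N by lra.
have h4 : c * (N * p) <= 1.
  rewrite -(ler_pM2r X0) mul1r; apply: le_trans h1; rewrite expr2.
  have -> : c * (N * p) * X = c * (N * X) * p by ring.
  by rewrite ler_pM2r.
have h5 : c * (N * N) <= 2.
  have : c * (N * N) <= c * (N * (2 * p)) by rewrite ler_pM2l // ler_pM2l.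
  have -> : c * (N * (2 * p)) = 2 * (c * (N * p)) by ring.
  lra.
have h6 : 1 < N by lra.
have h7 : 2 < c * N.
  have : c * (1 + 2 / c) < c * N by rewrite ltr_pM2l.
  by rewrite mulrDr mulr1 (mulrC c (2 / c)) divfK ?gt_eqF //; lra.
have : c * N < c * (N * N) by rewrite ltr_pM2l // ltr_pMr.
lra.
Qed.

(** One letter need not improve the expansion constant; a word of length [m] does, through
    [expanding_image]. So [F] collects the images of expanding vectors under all words shorter than
    [m], with thresholds that decrease with the length to leave room for neighbouring directions. *)
Lemma invariant_cone : exists (F : 'cV[R]_2 -> Prop) (e : R), [/\ 0 < e,
  forall a x, a != 0 -> F x -> F (a *: x),
  forall i x y, F x -> y != 0 ->
    `|wedge (B i *m x) y| <= e * (enorm (B i *m x) * enorm y) -> F y,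
  exists x, x != 0 /\ F x & exists2 x, x != 0 & ~ F x].
Proof.
have /andP[k0 k1] := kap01.
have [m0 hm0] := hinf (4 / kap); pose m := m0.+1.
have hm w : (m <= size w)%N -> 4 / kap <= nw B w.
  by move=> hw; apply/ltW/hm0/ltnW.
(* The thresholds start at [kap / 4] and stay above [kap / 8]. After [m] letters the constant is
   [kap / 2], which exceeds [c 0] and closes the cycle. *)
pose c j : R := kap / 8 * (1 + 2^-1 ^+ j).
have cS j : c j - c j.+1 = kap / 8 * 2^-1 ^+ j.+1 by rewrite /c !exprS; field.
have c8 j : kap / 8 <= c j by rewrite ler_peMr ?divr_ge0 ?(ltW k0) // lerDl exprn_ge0 // invr_ge0.
(* An angular error [d] costs [2 * d] of the expansion constant, at most the smallest drop
   [c j - c j.+1] with [j < m]. *)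
pose d := kap / 16 * 2^-1 ^+ m.
have d0 : 0 < d by rewrite mulr_gt0 ?divr_gt0 // exprn_gt0 // invr_gt0.
have cd j : (j < m)%N -> c j.+1 <= c j - 2 * d.
  move=> jm; suff : 2 * d <= c j - c j.+1 by lra.
  rewrite cS /d; have -> : 2 * (kap / 16 * 2^-1 ^+ m) = kap / 8 * 2^-1 ^+ m by field.
  rewrite ler_pM2l ?divr_gt0 // ler_wiXn2l ?invr_ge0 // invf_le1 //; lra.
have cdm j : (j < m)%N -> kap / 8 <= c j - 2 * d.
  by move=> /cd; apply: le_trans.
have [K K1 hK] := nw_short_le m; have K0 : 0 < K := lt_le_trans ltr01 K1.
pose F y := exists w z, [/\ (size w < m)%N, expanding (c (size w)) z & y = pw B w *m z].
(* This keeps [F] proper: by [not_expanding], some nonzero vector is not expanding with this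
   constant. *)
have Fexp y : F y -> expanding (kap ^+ 2 / 8) y.
  move=> [w [z [_ [z0 hz] ->]]]; split; first by rewrite unit_mul_neq0 // pw_unit.
  move=> u; rewrite mulmxA -pw_cat; apply: le_trans (hz _).
  apply: (@le_trans _ _ (kap / 8 * (nw B (u ++ w) * enorm z))); last first.
    by rewrite ler_wpM2r // mulr_ge0 ?enorm_ge0 ?opnorm_ge0.
  have -> : kap ^+ 2 / 8 * (nw B u * enorm (pw B w *m z)) =
     kap / 8 * (kap * nw B u * enorm (pw B w *m z)) by field.
  rewrite ler_pM2l ?divr_gt0 //; apply: (@le_trans _ _ (kap * (nw B u * nw B w) * enorm z)).
    have -> : kap * (nw B u * nw B w) * enorm z = kap * nw B u * (nw B w * enorm z) by ring.
    by rewrite ler_wpM2l ?enorm_mul // mulr_ge0 ?(ltW k0) ?opnorm_ge0.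
  by rewrite ler_wpM2r ?enorm_ge0.
(* Areas are preserved and lengths grow at most by [K] along at most [m] letters, so pulling back
   two directions enlarges the sine of their angle at most by [K ^+ 2]. *)
exists F, (d / K ^+ 2); split.
- by rewrite divr_gt0 // exprn_gt0.
- move=> a _ a0 [w [z [wm hz ->]]]; exists w, (a *: z); split => //; last by rewrite scalemxAr.
  exact: expandingZ.
- move=> i _ y [w [z [wm [z0 hz] ->]]] y0; rewrite mulmxA -pw_cons => hy.
  pose z' := invmx (pw B (i :: w)) *m y.
  have hP : pw B (i :: w) \in unitmx by exact: pw_unit.
  have z'0 : z' != 0 by rewrite unit_mul_neq0 // unitmx_inv.
  have ey : y = pw B (i :: w) *m z' by rewrite mulKVmx.
  have hzz : `|wedge z z'| <= d * (enorm z * enorm z').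
    rewrite ey wedge_pw in hy; apply: le_trans hy _.
    apply: (@le_trans _ _ (d / K ^+ 2 * ((K * enorm z) * (K * enorm z')))); last first.
      by rewrite le_eqVlt; apply/orP; left; apply/eqP; field; exact: lt0r_neq0.
    rewrite ler_wpM2l ?divr_ge0 ?exprn_ge0 ?(ltW d0) ?(ltW K0) //.
    have b x : enorm (pw B (i :: w) *m x) <= K * enorm x.
      by apply: le_trans (enorm_mul _ _) _; rewrite ler_wpM2r ?enorm_ge0 // hK.
    by rewrite ler_pM ?enorm_ge0.
  have near u := enorm_mul_near z0 z'0 hzz (hz u).
  have [iwm|iwm] := ltnP (size (i :: w)) m.
    exists (i :: w), z'; split => //; split => // u.
    by apply: le_trans (near u); rewrite ler_wpM2r ?cd // mulr_ge0 ?enorm_ge0 ?opnorm_ge0.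
  exists [::], y; split => //; last by rewrite pw_nil mul1mx.
  apply: (@expanding_le (kap / 2)); first by rewrite /c expr0; lra.
  rewrite ey; apply: expanding_image => //; first exact: hm.
  by apply: le_trans (near _); rewrite ler_wpM2r ?cdm // mulr_ge0 ?enorm_ge0 ?opnorm_ge0.
- pose w := nseq m (ord0 : Alph n); have [q [q1 hq]] := opnorm_col_half (pw B w).
  have q0 : q != 0 by rewrite -enorm_gt0 q1.
  have nwp := nw_gt0 hB w.
  exists (pw B w *m q); split; first by rewrite unit_mul_neq0 // pw_unit.
  exists [::], (pw B w *m q); split => //; last by rewrite pw_nil mul1mx.
  apply: (@expanding_le (kap / 2)); first by rewrite /c expr0; lra.
  apply: expanding_image => //; first by apply: hm; rewrite size_nseq.
  rewrite q1 mulr1; rewrite -/(nw B w) in hq.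
  apply: (@le_trans _ _ (1 / 8 * nw B w)); last lra.
  by rewrite ler_pM2r // ler_pM2r // invr_gt0.
- have [|x x0 hx] := @not_expanding (kap ^+ 2 / 8); first by rewrite divr_gt0 // exprn_gt0.
  by exists x => // /Fexp.
Qed.

Lemma sin_small (e : R) : 0 < e -> exists2 d, 0 < d & forall t : R, `|t| <= d -> `|sin t| <= e.
Proof.
move=> e0; have := @continuous_sin R 0; rewrite /continuous_at sin0.
move=> /cvgrPdist_le/(_ e e0)/nbhs_ballP[d /= d0 hd]; exists (d / 2); first by rewrite divr_gt0.
move=> t ht; have := hd t; rewrite /ball /= !sub0r !normrN; apply; lra.
Qed.

(** The image directions of [F] need not form finitely many intervals. Since [F] contains everything
    within angle [d] of them, they can be covered by intervals of a fine grid modulo [pi] that stay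
    inside [F]. *)
Lemma multicone_of_cone : exists M : set R, multicone M /\ strongly_invariant M B.
Proof.
have [F [e [e0 FZ Fin [z [z0 Fz]] [y y0 Fy]]]] := invariant_cone.
have [d d0 hd] := sin_small e0.
have p0 : 0 < pi :> R := pi_gt0 R.
have [m hm] : exists m : nat, 3 * (pi / m.+1%:R) <= d.
  exists (Num.truncn (3 * pi / d)); set k := Num.truncn _.
  have hk : 3 * pi / d < k.+1%:R by apply: real_truncnS_gt; rewrite num_real.
  rewrite ltr_pdivrMr // in hk; rewrite mulrA ler_pdivrMr ?ltr0n //; move: hk; lra.
set D := pi / m.+1%:R in hm; have D0 : 0 < D by rewrite divr_gt0.
have mD : m.+1%:R * D = pi by rewrite /D mulrC divfK.
have grid t : exists (j : 'I_m.+1) (k : int), j%:R * D + k%:~R * pi <= t <= j%:R * D + D + k%:~R * pi.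
  pose k := Num.floor (t / pi); have /andP[k1 k2] := floor_itv (t / pi).
  have r1 : 0 <= t - k%:~R * pi by move: k1; rewrite ler_pdivlMr //; lra.
  have r2 : t - k%:~R * pi < pi by move: k2; rewrite ltr_pdivrMr // intrD -/k; lra.
  have /andP[j1 j2] := truncn_itv (divr_ge0 r1 (ltW D0)).
  set j := Num.truncn _ in j1 j2; rewrite ler_pdivlMr // in j1; rewrite ltr_pdivrMr // -natr1 in j2.
  have hj : (j < m.+1)%N.
    rewrite ltnNge; apply/negP; rewrite -(ler_nat R) -(ler_pM2r D0) mD; lra.
  by exists (Ordinal hj), k; rewrite /=; apply/andP; split; lra.
pose G t := exists i x, F x /\ wedge (B i *m x) (dir t) = 0.
have Gpi t (k : int) : G t -> G (t - k%:~R * pi).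
  move=> [i [x [Fx h]]]; exists i, x; split => //.
  by have [a [_ ha]] := dir_pi t (- k); move: ha; rewrite mulrNz mulNr => ->; rewrite wedgeZr h mulr0.
have Fnear (t u : R) : G t -> `|u - t| <= d -> F (dir u).
  move=> [i [x [Fx h]]] ut; apply: (Fin i x) => //; first exact: dir_neq0.
  have [c hc] : exists c, B i *m x = c *: dir t.
    by apply: wedge_eq0_scale (dir_neq0 t) _; rewrite wedgeC h oppr0.
  rewrite hc wedgeZl normrM wedge_dir enormZ !enorm_dir !mulr1 mulrC.
  by rewrite ler_wpM2r // hd.
(* Every point of a selected interval is within [3 * D <= d] of an image direction, hence in [F];
   every grid interval meeting the [D]-neighbourhood of an image direction is selected, which gives
   the interior. *)
pose sel (j : 'I_m.+1) := exists t, G t /\ `|t - j%:R * D| <= 2 * D.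
have selG (t u : R) : G t -> `|u - t| <= D -> exists (j : 'I_m.+1) (k : int),
    sel j /\ j%:R * D + k%:~R * pi <= u <= j%:R * D + D + k%:~R * pi.
  move=> Gt ut; have [j [k /andP[u1 u2]]] := grid u; exists j, k; split; last by rewrite u1.
  exists (t - k%:~R * pi); split; first exact: Gpi.
  by move: ut; rewrite !ler_norml => /andP[? ?]; apply/andP; split; lra.
have [t1 Gt1] : exists t, G t.
  have [t _ ht] := polar (B ord0 *m z); exists t, ord0, z; split => //.
  by rewrite ht wedgeZl wedgexx mulr0.
have [js [_ [sjs _]]] : exists (j : 'I_m.+1) (k : int), sel j /\
    j%:R * D + k%:~R * pi <= t1 <= j%:R * D + D + k%:~R * pi.
  by apply: selG Gt1 _; rewrite subrr normr0 ltW.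
(* Unselected indices repeat the interval [js], so the union can run over all of ['I_m.+1]. *)
have /choice[g hg] : forall j, exists j', sel j' /\ (sel j -> j' = j).
  by move=> j; have [sj|nj] := pselect (sel j); [exists j|exists js].
pose a (j : 'I_m.+1) := (g j)%:R * D; pose b j := a j + D.
pose M := [set t : R | exists j (k : int), a j + k%:~R * pi <= t <= b j + k%:~R * pi].
have GM (t u : R) : G t -> `|u - t| <= D -> M u.
  by move=> Gt ut; have [j [k [sj h]]] := selG _ _ Gt ut; exists j, k; rewrite /b /a (hg j).2.
have MF (u : R) : M u -> F (dir u).
  move=> [j [k /andP[u1 u2]]]; have [t [Gt ht]] := (hg j).1.
  have : F (dir (u - k%:~R * pi)).
    apply: (Fnear t) => //; apply: le_trans hm; move: u1 u2 ht; rewrite /b /a.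
    by rewrite !ler_norml => u1 u2 /andP[? ?]; apply/andP; split; lra.
  have [s [s1 hs]] := dir_pi (u - k%:~R * pi) k; rewrite subrK in hs.
  by move=> h; rewrite hs; apply: FZ => //; rewrite -normr_gt0 s1.
exists M; split.
  split; first by exists m, a, b; split => // j; rewrite /b lerDl ltW.
  apply/eqP => MT; apply: Fy; have [t _ ht] := polar y; rewrite ht.
  by apply: FZ; [rewrite enorm_eq0|apply: MF; rewrite MT].
move=> i t u Mt htu; have Gu : G u by exists i, (dir t); split => //; exact: MF.
apply/nbhs_ballP; exists D => //= v; rewrite /ball /= => uv.
by apply: (GM u) => //; rewrite distrC ltW.
Qed.

End ConeOfExpansion.

(** * Bounded products *)

Section InvariantForm.
Context {R : realType} {n : nat}.
Variable B : Alph n -> 'M[R]_2.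
Hypothesis hdet : forall i, `|\det (B i)| = 1.
Variable K : R.
Hypothesis hK : forall w, nw B w <= K.
Implicit Types (w : seq (Alph n)) (x : 'cV[R]_2) (G H : 'M[R]_2).

Definition qform G x : R := inner x (G *m x).

(** It does not increase under any [B i] but need not be quadratic; an extremal form below it
    supplies the invariant one. *)
Definition orbit_sup x : R := sup [set enorm (pw B w *m x) ^+ 2 | w in [set: seq (Alph n)]].

Lemma orbit_has_sup x : has_sup [set enorm (pw B w *m x) ^+ 2 | w in [set: seq (Alph n)]].
Proof.
split; first by exists (enorm (pw B [::] *m x) ^+ 2), [::].
exists ((K * enorm x) ^+ 2) => _ [w _ <-].
rewrite lerXn2r ?nnegrE ?enorm_ge0 ?mulr_ge0 ?enorm_ge0 ?(le_trans (opnorm_ge0 _) (hK [::])) //.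
by apply: le_trans (enorm_mul _ _) _; rewrite ler_wpM2r ?enorm_ge0 //; exact: hK.
Qed.

Lemma orbit_sup_ge w x : enorm (pw B w *m x) ^+ 2 <= orbit_sup x.
Proof. by apply: (sup_upper_bound (orbit_has_sup x)); exists w. Qed.

Lemma orbit_sup_le x : orbit_sup x <= (K * enorm x) ^+ 2.
Proof.
apply: ge_sup => [|_ [w _ <-]]; first by case: (orbit_has_sup x).
rewrite lerXn2r ?nnegrE ?enorm_ge0 ?mulr_ge0 ?enorm_ge0 ?(le_trans (opnorm_ge0 _) (hK [::])) //.
by apply: le_trans (enorm_mul _ _) _; rewrite ler_wpM2r ?enorm_ge0 //; exact: hK.
Qed.

Lemma orbit_sup_mul i x : orbit_sup (B i *m x) <= orbit_sup x.
Proof.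
apply: ge_sup => [|_ [w _ <-]]; first by case: (orbit_has_sup (B i *m x)).
by rewrite mulmxA -(pw_seq1 B i) -pw_cat orbit_sup_ge.
Qed.

Definition subform G := G 0 1 = G 1 0 /\ forall x, 0 <= qform G x <= orbit_sup x.

Lemma qformE G x : G 0 1 = G 1 0 ->
  qform G x = G 0 0 * x 0 0 ^+ 2 + 2 * G 0 1 * x 0 0 * x 1 0 + G 1 1 * x 1 0 ^+ 2.
Proof. by move=> h; rewrite /qform /inner !mulmx2v -h; ring. Qed.

Lemma subform_entries G : subform G ->
  [/\ 0 <= G 0 0 <= K ^+ 2, 0 <= G 1 1 <= K ^+ 2 & `|G 0 1| <= K ^+ 2].
Proof.
move=> [sG hG].
have q a b : 0 <= G 0 0 * a ^+ 2 + 2 * G 0 1 * a * b + G 1 1 * b ^+ 2 <= K ^+ 2 * (a ^+ 2 + b ^+ 2).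
  pose x : 'cV[R]_2 := \col_i (if i == 0 then a else b).
  have /andP[h1 h2] := hG x; have h3 := le_trans h2 (orbit_sup_le x).
  by move: h1 h3; rewrite exprMn enorm_sqr qformE // /inner !mxE /= -!expr2 => -> ->.
have /andP[a1 a2] := q 1 0; have /andP[b1 b2] := q 0 1.
have /andP[c1 _] := q 1 1; have /andP[d1 _] := q 1 (-1).
have h1 : 0 <= G 0 0 <= K ^+ 2 by apply/andP; split; lra.
have h2 : 0 <= G 1 1 <= K ^+ 2 by apply/andP; split; lra.
by split => //; rewrite ler_norml; case/andP: h1; case/andP: h2 => *; apply/andP; split; lra.
Qed.

Lemma subform_opnorm G : subform G -> opnorm G <= 4 * K ^+ 2.
Proof.
move=> sG; have [/andP[a1 a2] /andP[b1 b2] c] := subform_entries sG.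
apply: le_trans (opnorm_le_entries _) _; rewrite -sG.1 (ger0_norm a1) (ger0_norm b1); lra.
Qed.

(** The empty word makes the identity admissible, so the maximal determinant is at least 1 and the
    maximal form is nondegenerate. Admissible forms are bounded, and a maximising sequence converges
    along an ultrafilter. *)
Lemma subform_max : exists G, [/\ subform G, 1 <= \det G & forall H, subform H -> \det H <= \det G].
Proof.
pose E := [set \det G | G in subform].
have s1 : subform 1%:M.
  split; first by rewrite !mxE.
  move=> x; rewrite /qform mul1mx -enorm_sqr exprn_ge0 ?enorm_ge0 //=.
  by have := orbit_sup_ge [::] x; rewrite pw_nil mul1mx.
have hE : has_sup E.
  split; first by exists (\det (1%:M : 'M[R]_2)), 1%:M.
  exists (K ^+ 2 * K ^+ 2) => _ [G sG <-].
  have [/andP[a1 a2] /andP[b1 b2] c] := subform_entries sG.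
  rewrite det2 -sG.1; apply: (@le_trans _ _ (G 0 0 * G 1 1)); last exact: ler_pM.
  by rewrite gerBl -expr2 sqr_ge0.
have /choice[F hF] : forall k : nat, exists G, subform G /\ sup E - k.+1%:R^-1 <= \det G.
  move=> k; have k0 : 0 < k.+1%:R^-1 :> R by rewrite invr_gt0.
  have [_ [G sG <-] hG] := sup_adherent k0 hE.
  by exists G; split => //; exact: ltW.
have [U [UU Uoo]] := @ultraFilterLemma nat \oo _.
have PU : ProperFilter U := ultra_proper.
have [G hG] := mcvg_ex UU (fun k => subform_opnorm (hF k).1).
have sG : subform G.
  split; first by apply: (ultra_unique UU (hG 0 1)); rewrite (_ : (fun k => _) = fun k => F k 1 0) //; apply: funext => k; exact: (hF k).1.1.
  move=> x; have c : (fun k => qform (F k) x) @ U --> qform G x.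
    rewrite /qform /inner !mulmx2v; under eq_fun do rewrite !mulmx2v.
    by apply: cvgD; (apply: cvgM; first exact: cvg_cst); apply: cvgD; (apply: cvgM; last exact: cvg_cst).
  by apply/andP; split; [apply: (ultra_le UU (cvg_cst _) c)|apply: (ultra_le UU c (cvg_cst _))] => k;
    have /andP[] := (hF k).1.2 x.
have dG : sup E <= \det G.
  have c0 : (fun k : nat => sup E - k.+1%:R^-1) @ U --> sup E - 0.
    by apply: cvgB; [exact: cvg_cst|apply: (ultra_of_oo Uoo); exact: cvg_harmonic].
  by rewrite -[sup E]subr0; apply: (ultra_le UU c0 (mcvg_det UU hG)) => k; case: (hF k).
have ub H : subform H -> \det H <= sup E by move=> sH; apply: (sup_upper_bound hE); exists H.
exists G; split => //; first by rewrite -(det1 R 2) (le_trans (ub _ s1)).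
by move=> H /ub /le_trans; apply.
Qed.

(* Strict log-concavity of [det] on positive forms. *)
Lemma det_mid_eq (a b c a' b' c' d : R) : 0 < a -> 0 < a' -> 0 < d ->
  a * c - b * b = d -> a' * c' - b' * b' = d ->
  (a + a') * (c + c') - (b + b') * (b + b') <= 4 * d -> [/\ a = a', b = b' & c = c'].
Proof.
move=> a0 a'0 d0 h1 h2 h.
have k : d * (a - a') ^+ 2 + (a * b' - a' * b) ^+ 2 <= 0.
  have -> : d * (a - a') ^+ 2 + (a * b' - a' * b) ^+ 2 =
    a * a' * ((a + a') * (c + c') - (b + b') * (b + b') - 4 * d)
    - a * a' * (a * c - b * b - d) - a * a' * (a' * c' - b' * b' - d)
    - a' ^+ 2 * (a * c - b * b - d) - a ^+ 2 * (a' * c' - b' * b' - d) by ring.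
  rewrite h1 h2 !subrr !mulr0 !subr0 mulr_ge0_le0 ?mulr_ge0 ?(ltW a0) ?(ltW a'0) //; lra.
have k1 : (a - a') ^+ 2 = 0.
  apply/eqP; rewrite eq_le sqr_ge0 andbT -(ler_pM2l d0) mulr0.
  by have := sqr_ge0 (a * b' - a' * b); lra.
have k2 : (a * b' - a' * b) ^+ 2 = 0.
  by apply/eqP; rewrite eq_le sqr_ge0 andbT; move: k; rewrite k1; lra.
have ea : a = a' by move/eqP: k1; rewrite sqrf_eq0 subr_eq0 => /eqP.
have eb : b = b'.
  move/eqP: k2; rewrite sqrf_eq0 -ea -mulrBr mulf_eq0 (gt_eqF a0) /= subr_eq0 => /eqP //.
split => //; have a'n : a' != 0 by rewrite gt_eqF.
by apply: (mulfI a'n); move: h1 h2; rewrite ea eb; lra.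
Qed.

(** Pulling the maximal form back by [B i] keeps it admissible, by [orbit_sup_mul], and keeps its
    determinant. The midpoint of the two forms is admissible as well, so [det_mid_eq] identifies
    them. *)
Lemma invariant_form : exists G, [/\ 0 < G 0 0, G 0 1 = G 1 0, 0 < \det G &
  forall i, (B i)^T *m G *m B i = G].
Proof.
have [G [sG dG1 mG]] := subform_max.
have dG0 : 0 < \det G := lt_le_trans ltr01 dG1.
have pos H : subform H -> 0 < \det H -> 0 < H 0 0.
  move=> sH; have [/andP[a _] _ _] := subform_entries sH.
  move=> h; rewrite lt0r a andbT; apply: contraTneq h; rewrite det2 => ->.
  by rewrite -sH.1 mul0r sub0r oppr_gt0 -leNgt -expr2 sqr_ge0.
exists G; split => //; first exact: pos; first exact: sG.1.
move=> i; set H := (B i)^T *m G *m B i.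
have qH x : qform H x = qform G (B i *m x).
  by rewrite /qform /H /inner !mulmx2v !mulmx22 !mxE; ring.
have sH : subform H.
  split; first by rewrite /H !mulmx22 !mxE sG.1; ring.
  move=> x; rewrite qH; have /andP[-> h] := sG.2 (B i *m x).
  exact: le_trans h (orbit_sup_mul i x).
have dH : \det H = \det G.
  rewrite /H !det_mulmx det_tr mulrAC -expr2 -real_normK ?num_real // hdet expr1n mul1r //.
clearbody H.
have sm : subform (2^-1 *: (G + H)).
  split; first by rewrite !mxE sG.1 sH.1.
  move=> x; have -> : qform (2^-1 *: (G + H)) x = 2^-1 * (qform G x + qform H x).
    by rewrite /qform -scalemxAl mulmxDl /inner !mxE; ring.
  have /andP[g1 g2] := sG.2 x; have /andP[h1 h2] := sH.2 x.
  by apply/andP; split; lra.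
have [e1 e2 e3] : [/\ G 0 0 = H 0 0, G 0 1 = H 0 1 & G 1 1 = H 1 1].
  apply: (@det_mid_eq _ _ _ _ _ _ (\det G)) => //.
  - exact: pos.
  - by apply: pos => //; rewrite dH.
  - by rewrite det2 -sG.1.
  - by rewrite -dH det2 -sH.1.
  - have := mG _ sm; rewrite det2 !mxE -sG.1 -sH.1.
    have -> : 2^-1 * (G 0 0 + H 0 0) * (2^-1 * (G 1 1 + H 1 1)) -
       2^-1 * (G 0 1 + H 0 1) * (2^-1 * (G 0 1 + H 0 1)) = 4^-1 *
       ((G 0 0 + H 0 0) * (G 1 1 + H 1 1) - (G 0 1 + H 0 1) * (G 0 1 + H 0 1)) by field.
    lra.
by apply: mx2P; rewrite -?e1 -?e2 -?e3 // -sG.1 -sH.1.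
Qed.

Lemma conformal_of_bounded : exists M : 'M[R]_2, M \in unitmx /\
  forall i, (M *m B i *m invmx M) *m (M *m B i *m invmx M)^T = 1%:M.
Proof.
have [G [a0 sG d0 hG]] := invariant_form.
pose a := G 0 0; pose d := \det G.
(* The Cholesky factor of [G]: it turns the invariant form into the Euclidean one. *)
pose M : 'M[R]_2 := \matrix_(i, j) (if i == 0 then (if j == 0 then Num.sqrt a else G 0 1 / Num.sqrt a)
   else (if j == 0 then 0 else Num.sqrt (d / a))).
have sa : Num.sqrt a ^+ 2 = a by rewrite sqr_sqrtr // ltW.
have sda : Num.sqrt (d / a) ^+ 2 = d / a by rewrite sqr_sqrtr // divr_ge0 ?ltW.
have sa0 : Num.sqrt a != 0 by rewrite gt_eqF // sqrtr_gt0.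
have MG : M^T *m M = G.
  have an : a != 0 by rewrite gt_eqF.
  apply: mx2P; rewrite mulmx22 !mxE /=.
  - by rewrite mul0r addr0 -expr2.
  - by rewrite mul0r addr0 mulrC divfK.
  - by rewrite mulr0 addr0 divfK.
  - rewrite -!expr2 sda expr_div_n sa /d det2 -sG -/a; field.
    by [].
have hM : M \in unitmx.
  have := det_mulmx M^T M; rewrite MG det_tr unit_det => h.
  by apply: contraTneq d0 => M0; rewrite h M0 mul0r ltxx.
exists M; split => // i; apply: mulmx1C.
rewrite !trmx_mul !mulmxA -(mulmxA _ M^T M) MG.
have e : (invmx M)^T *m (B i)^T *m G *m B i = (invmx M)^T *m G by rewrite -{2}(hG i) !mulmxA.
by rewrite e -MG mulmxA -trmx_mul mulmxV // trmx1 mul1mx mulmxV.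
Qed.

End InvariantForm.

(** * Unbounded products *)

Section UnboundedProducts.
Context {R : realType} {n : nat}.
Variable B : Alph n -> 'M[R]_2.
Hypothesis hdet : forall i, `|\det (B i)| = 1.
Hypothesis hirr : irreducible B.
Variables (C : R) (f : Seq n -> R).
Hypothesis hf : holder f.
Hypothesis hC : forall x k, `|birk f k x - ln (opnorm (prodw B (trunc x k)))| <= C.
Implicit Types (u v w a : seq (Alph n)).

Let hB : forall i, B i \in unitmx := unit_of_det hdet.

Lemma birk_nw x w : mkseq x (size w) = w -> `|birk f (size w) x - ln (nw B w)| <= C.
Proof. by move=> h; have := hC x (size w); rewrite prodw_pw wseq_trunc h. Qed.

Lemma nw_ge1 w : 1 <= nw B w.
Proof.
have := det_opnorm (pw B w); rewrite det_pw // -/(nw B w) => h.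
by rewrite -(@expr_ge1 _ 2) // ltW // nw_gt0.
Qed.

(** Birkhoff sums are additive along a point of the cylinder of [u ++ v]; each of the three words
    contributes one error [C]. *)
Lemma almost_multiplicative u v : expR (- (3 * C)) * (nw B u * nw B v) <= nw B (u ++ v).
Proof.
have pos w : nw B w \is Num.pos by rewrite posrE nw_gt0.
have h := mkseq_fill (u ++ v); have [hu hv] := mkseq_cat_inv h.
have := birk_nw h; have := birk_nw hu; have := birk_nw hv.
rewrite -[nw B u]lnK // -[nw B v]lnK // -[nw B (u ++ v)]lnK // -!expRD ler_expR !lnK //.
rewrite size_cat birkD; move: (birk _ _ _) (birk _ _ _) (ln _) (ln _) (ln _) => p q x y z.
by rewrite !ler_norml => /andP[h1 h2] /andP[h3 h4] /andP[h5 h6]; clear -h1 h2 h3 h4 h5 h6; lra.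
Qed.

Section BoundedSubsequence.
Variables (L : R) (e : nat -> seq (Alph n)).
Hypothesis e_long : forall k, (k <= size (e k))%N.
Hypothesis e_le : forall k, nw B (e k) <= L.

(** Each block [e k ++ a] is followed by another copy of the long [e k], so its Birkhoff sum depends
    on the later blocks only up to order [tau ^+ k]. *)
Let T k (l : seq (seq (Alph n))) := flatten [seq e k ++ a | a <- l].
Let r k a := birk f (size (e k ++ a)) (fillw (e k ++ a ++ e k)).

(** [C] enters once however many blocks there are, and the error per block vanishes as [k] grows; in
    the limit the norm is a product over blocks up to a factor [exp C]. *)
Lemma block_sum : exists V tau, [/\ 0 <= V, 0 < tau < 1 & forall k l,
  `|ln (nw B (T k l)) - \sum_(a <- l) r k a| <= C + (size l)%:R * (V * tau ^+ k)].
Proof.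
have [V [tau [V0 t01 hV]]] := birk_variation hf; exists V, tau; split => // k l.
have /andP[t0 t1] := t01.
have key x : mkseq x (size (T k l ++ e k)) = T k l ++ e k ->
    `|birk f (size (T k l)) x - \sum_(a <- l) r k a| <= (size l)%:R * (V * tau ^+ k).
  elim: l x => [|a l IH] x; first by rewrite /birk big_ord0 big_nil subrr normr0 mul0r.
  have -> : T k (a :: l) = (e k ++ a) ++ T k l by [].
  rewrite -catA => h; have [h1 h2] := mkseq_cat_inv h.
  rewrite size_cat birkD big_cons opprD addrACA -natr1 mulrDl mul1r [X in _ <= X]addrC.
    apply: le_trans (ler_normD _ _) _; rewrite lerD //; last exact: IH.
    have [t ht] : exists t, T k l ++ e k = e k ++ t.
      by case: (l) => [|b l']; [exists [::]; rewrite cats0|exists (b ++ T k l' ++ e k); rewrite /T /= -!catA].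
    apply: (@le_trans _ _ (V * tau ^+ size (e k))).
      apply: hV; rewrite -size_cat -catA; apply: mkseq_eq; rewrite mkseq_fill.
      by move: h; rewrite ht !catA => /mkseq_cat_inv[].
    by rewrite ler_wpM2l // ler_wiXn2l // ltW.
pose x := fillw (T k l ++ e k).
have hx := mkseq_fill (T k l ++ e k); have h1 := key x hx.
have h2 := birk_nw (mkseq_cat_inv hx).1; rewrite -/x in h2.
rewrite -[ln _](subrK (birk f (size (T k l)) x)) -addrA.
by apply: le_trans (ler_normD _ _) _; rewrite lerD // distrC.
Qed.

Lemma bounded_subsequence_bounded : exists K, forall w, nw B w <= K.
Proof.
apply: contrapT => unb.
have hunb K : exists w, K < nw B w.
  apply: contrapT => hK; apply: unb; exists K => w; rewrite leNgt; apply/negP => h.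
  by apply: hK; exists w.
have [U [UU Uoo]] := @ultraFilterLemma nat \oo _.
have PU : ProperFilter U := ultra_proper.
have [V [tau [V0 /andP[t0 t1] hV]]] := block_sum.
have [E hE] := mcvg_ex UU e_le.
have dE : `|\det E| = 1.
  have c1 : (fun k => `|\det (pw B (e k))|) @ U --> `|\det E|.
    exact: (cvg_norm (mcvg_det UU hE)).
  apply: (ultra_unique UU c1); rewrite (_ : (fun k => _) = fun=> 1); first exact: cvg_cst.
  by apply: funext => k; rewrite det_pw.
have Eu : E \in unitmx by rewrite unit_det -normr_gt0 dE.
have rb a k : `|r k a| <= V + C + ln (L * nw B a).
  have := hV k [:: a]; rewrite /T /= cats0 big_seq1 mul1r => h.
  have n1 : 0 <= ln (nw B (e k ++ a)) by rewrite ln_ge0 // nw_ge1.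
  have n2 : ln (nw B (e k ++ a)) <= ln (L * nw B a).
    have p := nw_gt0 hB (e k ++ a).
    have q : nw B (e k ++ a) <= L * nw B a.
      by apply: le_trans (nw_cat _ _ _) _; rewrite ler_wpM2r ?e_le ?opnorm_ge0.
    by rewrite ler_ln ?posrE // (lt_le_trans p).
  have tk : V * tau ^+ k <= V by rewrite ler_piMr // exprn_ile1 // ltW.
  move: h n1 n2 tk; rewrite !ler_norml; move: (ln _) (ln _) (r k a) (V * _) => p q z y.
  by move=> /andP[h1 h2] h3 h4 h5; apply/andP; split; lra.
have /choice[rho hrho] : forall a, exists l : R, (fun k => r k a) @ U --> l.
  by move=> a; exact: (ultra_lim UU (rb a)).
pose GE := fix GE (l : seq (seq (Alph n))) := if l is a :: l' then E *m pw B a *m GE l' else 1%:M.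
have hGE l : mcvg U (fun k => pw B (T k l)) (GE l).
  elim: l => [|a l IH]; first by rewrite /T /= pw_nil; exact: mcvg_cst.
  rewrite (_ : (fun k => _) = fun k => pw B (e k) *m pw B a *m pw B (T k l)); last first.
    by apply: funext => k; rewrite /T /= !pw_cat.
  by apply: (mcvg_mul UU) => //; apply: (mcvg_mul UU) => //; exact: mcvg_cst.
have hsum l : (fun k => \sum_(a <- l) r k a) @ U --> \sum_(a <- l) rho a.
  elim: l => [|a l IH].
    by rewrite big_nil; under eq_fun do rewrite big_nil; exact: cvg_cst.
  rewrite big_cons; under eq_fun do rewrite big_cons.
  exact: cvgD.
have herr (m : R) : (fun k => C + m * (V * tau ^+ k)) @ U --> C.
  rewrite -[X in _ --> X]addr0 -(mulr0 m) -(mulr0 V).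
  apply: cvgD; first exact: cvg_cst.
  apply: cvgM; first exact: cvg_cst.
  apply: cvgM; first exact: cvg_cst.
  by apply: (ultra_of_oo Uoo); apply: cvg_expr; rewrite ger0_norm // ltW.
have hexp (g : nat -> R) y : g @ U --> y -> (fun k => expR (g k)) @ U --> expR y.
  by move=> hg; apply: continuous_cvg hg; exact: continuous_expR.
have bounds l : expR (\sum_(a <- l) rho a - C) <= opnorm (GE l) <= expR (\sum_(a <- l) rho a + C).
  have cN := mcvg_opnorm UU (hGE l).
  have c1 : (fun k => expR (\sum_(a <- l) r k a - (C + (size l)%:R * (V * tau ^+ k)))) @ U -->
      expR (\sum_(a <- l) rho a - C).
    by apply: hexp; apply: cvgB (hsum l) (herr _).
  have c2 : (fun k => expR (\sum_(a <- l) r k a + (C + (size l)%:R * (V * tau ^+ k)))) @ U -->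
      expR (\sum_(a <- l) rho a + C).
    by apply: hexp; apply: cvgD (hsum l) (herr _).
  by apply/andP; split; [apply: (ultra_le UU c1 cN)|apply: (ultra_le UU cN c2)] => k;
    rewrite -/(nw B (T k l)) -[nw B _]lnK ?posrE ?nw_gt0 // ler_expR;
    have := hV k l; rewrite ler_norml => /andP[]; move: (ln _) (\sum_(_ <- _) _) (_ + _) => *; lra.
(* Normalised in this way the limits form a semigroup, under concatenation of lists, with norms
   between [exp (- C)] and [exp C]. *)
pose Y l := expR (- \sum_(a <- l) rho a) *: GE l.
have GEcat l l' : GE (l ++ l') = GE l *m GE l'.
  by elim: l => [|a l IH]; rewrite ?mul1mx //= IH !mulmxA.
(* A norm this large forces [rho a > 0], so [Y [:: a]] has determinant of modulus
   [exp (- 2 rho a) < 1]. *)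
have [a ha] := hunb (opnorm (invmx E) * expR C).
have rho0 : 0 < rho a.
  have /andP[_] := bounds [:: a]; rewrite big_seq1 /= mulmx1 => h1.
  have h2 : nw B a <= opnorm (invmx E) * opnorm (E *m pw B a).
    by rewrite /nw -{1}(mulKmx Eu (pw B a)); exact: opnormM.
  have i0 : 0 < opnorm (invmx E) by rewrite opnorm_gt0 // unitmx_inv.
  have := lt_le_trans ha (le_trans h2 (ler_wpM2l (ltW i0) h1)).
  by rewrite ltr_pM2l // ltr_expR; lra.
have [| | | | |v v0 hv] := @semigroup_line R U UU Uoo (fun Q => exists l, Q = Y l) (expR C) (Y [:: a]).
- move=> _ _ [l ->] [l' ->]; exists (l ++ l').
  by rewrite /Y big_cat opprD expRD GEcat -scalemxAl -scalemxAr scalerA.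
- exact: expR_gt0.
- move=> _ [l ->]; rewrite /Y opnormZ ger0_norm ?expR_ge0 // -expRN.
  have /andP[h1 h2] := bounds l; have p := expR_gt0 (- \sum_(b <- l) rho b).
  have := ler_wpM2l (ltW p) h1; have := ler_wpM2l (ltW p) h2.
  by rewrite -!expRD !addrA addNr !add0r => -> ->.
- by exists [:: a].
- rewrite /Y detZ normrM normrX ger0_norm ?expR_ge0 //= mulmx1 det_mulmx normrM dE det_pw // !mulr1.
  by rewrite big_seq1 exprn_gt0 ?expR_gt0 //= exprn_ilt1 ?expR_ge0 // -expR0 ltr_expR; lra.
have lin b : exists c, E *m (pw B b *m v) = c *: v.
  have [c] := hv (Y [:: b]) (ex_intro _ _ erefl); rewrite /Y /= mulmx1 -scalemxAl => h.
  exists ((expR (- \sum_(a <- [:: b]) rho a))^-1 * c).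
  by rewrite -scalerA -h scalerA mulVf ?gt_eqF ?expR_gt0 // scale1r mulmxA.
(* The empty word shows that [E] preserves the line, so [E] can be cancelled from [E *m B i]. *)
have [c hc] := lin [::]; rewrite pw_nil mul1mx in hc.
have c0 : c != 0.
  by apply: contraTneq (unit_mul_neq0 Eu v0) => h; rewrite hc h scale0r eqxx.
apply: (hirr v0) => i; have [c' hc'] := lin [:: i]; rewrite pw_seq1 in hc'.
exists (c' / c); apply: (can_inj (mulKmx Eu)).
by rewrite hc' -scalemxAr hc scalerA divfK.
Qed.

End BoundedSubsequence.

Lemma nw_tends_to_infinity : ~ (exists K, forall w, nw B w <= K) ->
  forall L : R, exists m, forall w, (m <= size w)%N -> L < nw B w.
Proof.
move=> unb L; apply: contrapT => h; apply: unb.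
have /choice[e he] : forall m : nat, exists w, (m <= size w)%N /\ nw B w <= L.
  move=> m; apply: contrapT => hm; apply: h; exists m => w mw; rewrite ltNge; apply/negP => hw.
  by apply: hm; exists w.
by apply: (@bounded_subsequence_bounded L e) => k; case: (he k).
Qed.

End UnboundedProducts.

(** * Reduction to determinants of modulus one *)

Section Normalisation.
Context {R : realType} {n : nat}.
Variable A : Alph n -> 'M[R]_2.
Hypothesis hA : forall i, A i \in unitmx.

(** Rescaling leaves the action on lines unchanged and shifts a norm potential by the one-letter
    function [ln (p i)]. *)
Let p i : R := `|\det (A i)| `^ (- 2^-1).
Let B i := p i *: A i.

Let p0 i : 0 < p i.
Proof. by rewrite powR_gt0 // normr_gt0 -unit_det. Qed.

Let det_B i : `|\det (B i)| = 1.
Proof.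
have d0 : 0 < `|\det (A i)| by rewrite normr_gt0 -unit_det.
rewrite detZ normrM normrX gtr0_norm ?p0 // /p -powR_mulrn ?powR_ge0 // -powRrM.
by rewrite mulNr mulVf ?pnatr_eq0 // powR_inv1 ?(ltW d0) // mulVf // gt_eqF.
Qed.

Let irr_B : irreducible A -> irreducible B.
Proof.
move=> hirr v v0 h; apply: (hirr v v0) => i; have [c hc] := h i; exists ((p i)^-1 * c).
by rewrite -scalerA -hc /B -scalemxAl scalerA mulVf ?scale1r // gt_eqF.
Qed.

Let pw_B w : pw B w = (\prod_(a <- w) p a) *: pw A w.
Proof.
elim: w => [|a w IH]; first by rewrite !pw_nil big_nil scale1r.
by rewrite !pw_cons IH big_cons -scalemxAl -scalemxAr scalerA.
Qed.

Let norm_potential_B : norm_potential A -> norm_potential B.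
Proof.
move=> [C [f [C0 [hf h]]]]; exists C, (fun x => f x + ln (p (x 0%N))); split => //; split.
  exact: (holder_letter (fun i => ln (p i))).
move=> x k; rewrite (birk_letter f (fun i => ln (p i))).
have := h x k; rewrite !prodw_pw wseq_trunc pw_B opnormZ.
have P0 w : 0 < \prod_(a <- w) p a by apply: prodr_gt0.
rewrite (gtr0_norm (P0 _)) lnM ?posrE //; last exact: nw_gt0.
have -> : ln (\prod_(a <- mkseq x k) p a) = \sum_(a <- mkseq x k) ln (p a).
  elim: (mkseq x k) => [|a w IH]; first by rewrite !big_nil ln1.
  by rewrite !big_cons lnM ?posrE // IH.
move: (birk f k x) (\sum_(_ <- _) _) (ln _) => a b c.
by rewrite (_ : a + b - (b + c) = a - c) //; ring.
Qed.

Lemma cone_of_norm_potential : irreducible A -> norm_potential A ->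
  (exists M : set R, multicone M /\ strongly_invariant M A) \/ strongly_conformal A.
Proof.
move=> /irr_B hirr /norm_potential_B[C [f [C0 [hf hC]]]].
have [[K hK]|unb] := pselect (exists K, forall w, nw B w <= K).
  right; have [M [hM h]] := conformal_of_bounded det_B hK; exists M; split => // i.
  by rewrite /= -/(p i) [p i *: _](_ : _ = M *m B i *m invmx M) // /B -scalemxAr -scalemxAl.
left; have hinf := nw_tends_to_infinity det_B hirr hf hC unb.
have [|M [hM hS]] := multicone_of_cone det_B _ (almost_multiplicative det_B hC) hinf.
  by rewrite expR_gt0 -[X in _ <= X]expR0 ler_expR; lra.
exists M; split => // i t u Mt; rewrite parallelE => h; apply: (hS i t u Mt).
by rewrite parallelE /B -scalemxAl wedgeZl h mulr0.
Qed.

End Normalisation.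

Unset Implicit Arguments.
Set Strict Implicit.

Theorem theorem2p9 (R : realType) (n : nat) (A : Alph n -> 'M[R]_2)
  (hGL : forall i, A i \in unitmx) (hirr : irreducible A)
  (s : R) (hs : 0 < s) (mu : probability (SigmaM n) R)
  (heq : equilibrium_state A s mu) :
  ((exists f : Seq n -> R, holder f /\ gibbs mu f) <->
   ((exists M : set R, multicone M /\ strongly_invariant M A) \/ strongly_conformal A))
  /\
  (((exists M : set R, multicone M /\ strongly_invariant M A) \/ strongly_conformal A) <->
   (exists (C : R) (f : Seq n -> R), 0 < C /\ holder f /\
      forall (x : Seq n) (k : nat),
        `|birk f k x - ln (opnorm (prodw A (trunc x k)))| <= C)).
Proof.
have h12 := norm_potential_of_cone hGL hirr.
have h21 := cone_of_norm_potential hGL hirr.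
have h13 := gibbs_to_norm_potential hGL hirr hs heq.
have h31 := norm_potential_to_gibbs hGL hirr hs heq.
split; split=> [h|h].
- exact/h21/h13.
- exact/h31/h12.
- exact: h12.
- exact: h21.
Qed.
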